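(* Let $\ell\ge 3$ be an integer and put $d_\ell:=(2\ell)^{4\ell}$. Then for Lebesgue-almost every $\alpha\in\mathbb{R}$, the sequence $\mathcal{X}_\alpha^d=\{\alpha n^d \bmod 1\}_{n\ge 1}$ has Poissonian $\ell$-point correlation for every integer $d$ with $d>d_\ell$.
   Context: For an integer $d>1$ and a real $\alpha\neq 0$, let $x(n)=\alpha n^d \bmod 1$ and $\mathcal{X}_\alpha^d=\{x(n)\}_{n>0}$. Write $[N]=\{1,\dots,N\}$. For $f\in C_c^\infty(\mathbb{R}^{\ell-1})$ define $$R_\ell^N(\mathcal{X}_\alpha^d,f)=\frac1N\sum^{*}_{\mathbf{n}\in[N]^\ell}\sum_{\mathbf{k}\in\mathbb{Z}^{\ell-1}} f\big(N(x(n_1)-x(n_2)+k_1),\dots,N(x(n_{\ell-1})-x(n_\ell)+k_{\ell-1})\big),$$ where $\sum^*$ means the coordinates of $\mathbf{n}=(n_1,\dots,n_\ell)$ are pairwise distinct. The sequence has Poissonian $\ell$-point correlation if for every $f\in C_c^\infty(\mathbb{R}^{\ell-1})$ the limit $\lim_{N\to\infty}R_\ell^N(\mathcal{X}_\alpha^d,f)$ exists and equals $\int_{\mathbb{R}^{\ell-1}}f(\mathbf{x})\,d\mathbf{x}$. *)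

(* Defs.v *)
From HB Require Import structures.
From mathcomp Require Import all_boot all_order all_algebra.
From mathcomp Require Import all_classical all_reals all_analysis.
Set Implicit Arguments. Unset Strict Implicit. Unset Printing Implicit Defensive.
Import Order.TTheory GRing.Theory Num.Theory.
Import numFieldNormedType.Exports.
Local Open Scope classical_set_scope.
Local Open Scope ring_scope.

Definition frac {R : realType} (x : R) : R := x - (Num.floor x)%:~R.

Definition xseq {R : realType} (alpha : R) (d n : nat) : R :=
  frac (alpha * (n%:R) ^+ d).

Fixpoint iter_deriv {R : realType} (m : nat) (vs : seq 'rV[R]_m)
  (f : 'rV[R]_m -> R) : 'rV[R]_m -> R :=
  match vs with
  | [::] => f
  | v :: vs' => fun x => 'D_v (iter_deriv vs' f) x
  end.

Definition smooth {R : realType} (m : nat) (f : 'rV[R]_m -> R) : Prop :=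
  forall vs : seq 'rV[R]_m,
    (forall x v, derivable (iter_deriv vs f) x v) /\
    continuous (iter_deriv vs f).

Definition compact_support {R : realType} (m : nat) (f : 'rV[R]_m -> R) : Prop :=
  compact (closure (f @^-1` [set~ 0])).

Definition Cc_infty {R : realType} (m : nat) (f : 'rV[R]_m -> R) : Prop :=
  smooth f /\ compact_support f.

(* Lebesgue integral over R^m, computed as an iterated integral
   (equal to the m-dimensional Lebesgue integral for f in C_c) *)
Fixpoint int_Rn {R : realType} (m : nat) : ('rV[R]_m -> R) -> R :=
  match m return ('rV[R]_m -> R) -> R with
  | 0 => fun f => f 0
  | m'.+1 => fun f =>
      Rintegral (@lebesgue_measure R) setT
        (fun t : R => int_Rn (fun v : 'rV[R]_m' => f (row_mx (const_mx t : 'rV[R]_1) v)))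
  end.

(* R_l^N(X_alpha^d, f), with l >= 1; f : R^(l-1) -> R.
   n ranges over injective maps 'I_l -> [N] (n_i = (n i).+1 in {1..N});
   coordinate i of the argument uses n_i and n_{i+1} (indices 0-based). *)
Definition Rcorr {R : realType} (l N d : nat) (alpha : R)
  (f : 'rV[R]_(l.-1) -> R) : R :=
  N%:R^-1 * \sum_(n : {ffun 'I_(l.-1).+1 -> 'I_N} | injectiveb n)
    \sum_(k \in [set: 'rV[int]_(l.-1)])
      f (\row_(i < l.-1)
           (N%:R * (xseq alpha d (n (widen_ord (leqnSn _) i)).+1
                    - xseq alpha d (n (lift ord0 i)).+1
                    + (k ord0 i)%:~R))).

Arguments Rcorr {R} l N d alpha f.

Definition poissonian_corr {R : realType} (l d : nat) (alpha : R) : Prop :=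
  forall f : 'rV[R]_(l.-1) -> R, Cc_infty f ->
    (fun N : nat => Rcorr l N d alpha f) @ \oo --> int_Rn f.

(* Main.v *)
Require Import Defs.
From HB Require Import structures.
From mathcomp Require Import all_boot all_order all_algebra.
From mathcomp Require Import boolp.
From mathcomp Require Import perm zify ring lra.

(** Idea.  Write Q = lam N and expand a product of Fejer kernels F_Q(alpha (n_i^d - n_(i+1)^d) - th_i / N)
    into cosines.  The variance in alpha of its average over injective n counts pairs (n, z) with
    sum_j z_j nu_j = 0, where the nu_j are 2 l signed d-th powers <= N^d and 0 < max |z_j| <= 2 Q.
    When N = M^A this count is O(N^(2 l) / M^2): solving for pivot variables, every pivot n_i
    satisfies a relation c0 n_i^d = sum_j c_j n_j^d over the non-pivots, with small coefficients, and a
    p-adic pigeonhole argument (d is huge compared with l) leaves M^O(l) values for n_i; the remaining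
    loss is regained either from a large denominator or numerator in the dependence of z on its pivots,
    or from Jarnik's bound for the integer points on a x^d + b y^d = c.
    Since M^-2 is summable, the averages converge almost everywhere along N = M^A to their means.
    Interpolating f on the grid of mesh 1 / lam by Fejer kernels transfers this to f, with an error
    O(1 / lam) times the average of a majorant that is again built from Fejer kernels; monotonicity
    in N of sums of nonnegative terms then fills the gaps between consecutive values M^A. *)

Set Implicit Arguments. Unset Strict Implicit. Unset Printing Implicit Defensive.
Import Order.TTheory GRing.Theory Num.Theory.

(** * Primes between M and M^2 *)

(** Working with [N = M ^ A] separates two scales. The exponent [2 * t] in the sparsity bound
    depends on [l] but not on [A], so for large [A] the bound is a tiny power of [N], and all losses
    of powers of [M] can be repaid from a fixed power of [N]. At the same time the ratio of
    consecutive values of [M ^ A] still tends to 1, as the filling of the gaps requires. The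
    non-pivot powers in a relation can be as large as [N ^ d]. They enter only the matrices that
    express one family of monomials through another, never the entries whose size is estimated. A
    large [d] helps because [(x - z) ^ d] is divisible by [p ^ d] on the class of [z] modulo [p],
    while the relation brings [c0 * (x - z) ^ d] back below degree [d] in [x] at the cost of one
    degree in the coefficients. Fejer kernels are finite sums of cosines with integer frequencies,
    so the integral of a square over [[-K, K]] reduces to coincidences of frequencies, with no tail
    to control; being nonnegative, they also serve as majorants. *)

Lemma leq_expl m n e : m <= n -> m ^ e <= n ^ e.
Proof. by case: e => // e mn; rewrite leq_exp2r. Qed.

Lemma big_nat_widen0 (a b c : nat) (F : nat -> nat) : a <= b -> b <= c ->
  (forall k, b <= k -> F k = 0) -> \sum_(a <= k < c) F k = \sum_(a <= k < b) F k.
Proof.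
move=> ab bc F0; rewrite (big_cat_nat (n := b)) //=.
suff -> : \sum_(b <= i < c) F i = 0 by rewrite addn0.
by rewrite big_nat_cond big1 // => k /andP [/andP [bk _] _]; exact: F0.
Qed.

(** Legendre's formula. The cut-off [K] is left free so that the sums for [2 * n] and for [n] run
    over the same range. *)
Lemma logn_fact_sum p n K : prime p -> n < p ^ K ->
  logn p n`! = \sum_(1 <= k < K) n %/ p ^ k.
Proof.
move=> pp; elim: n => [|n ih] nK.
  by rewrite big1 ?logn1 // => k _; rewrite div0n.
rewrite factS lognM ?fact_gt0 // ih; last exact: ltnW.
under [RHS]eq_bigr => k _ do rewrite divnS ?expn_gt0 ?prime_gt0 //.
rewrite big_split /=; congr (_ + _).
rewrite logn_count_dvd //.
have z k : n < p ^ k -> (p ^ k %| n.+1) = (n.+1 == p ^ k) :> nat.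
  move=> nk; case: eqP => [<-|/eqP ne]; first by rewrite dvdnn.
  by rewrite gtnNdvd // ltn_neqAle ne.
have z1 k : n.+1 <= k -> (p ^ k %| n.+1) = 0 :> nat.
  move=> nk; rewrite gtnNdvd //.
  by apply: (leq_ltn_trans nk); rewrite ltn_expl ?prime_gt1.
have z2 k : K <= k -> (p ^ k %| n.+1) = 0 :> nat.
  move=> nk; rewrite gtnNdvd //.
  by apply: (leq_trans nK); rewrite leq_exp2l ?prime_gt1.
have [KL|LK] := leqP n.+1 K; first by rewrite (@big_nat_widen0 1 n.+1 K).
clear ih; case: K nK LK z2 => [|K] // nK LK z2.
by rewrite (@big_nat_widen0 1 K.+1 n.+1) // ltnW.
Qed.

(** Each power of [p] up to [2 * n] contributes at most one unit, so the full power of [p] in the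
    binomial coefficient is at most [2 * n]. *)
Lemma logn_central_bin p n : prime p -> 0 < n ->
  logn p 'C(2 * n, n) <= trunc_log p (2 * n).
Proof.
move=> pp n0; have n20 : 0 < 2 * n by rewrite muln_gt0.
pose K := (trunc_log p (2 * n)).+1.
have nK : 2 * n < p ^ K by rewrite trunc_log_ltn ?prime_gt1.
have nK' : n < p ^ K by apply: leq_ltn_trans nK; rewrite leq_pmull.
have := congr1 (logn p) (bin_fact (leq_pmull n (isT : 0 < 2))).
have -> : 2 * n - n = n by lia.
rewrite !lognM ?muln_gt0 ?fact_gt0 ?bin_gt0 ?leq_pmull //.
rewrite (logn_fact_sum pp nK) (logn_fact_sum pp nK').
have : \sum_(1 <= k < K) (2 * n) %/ p ^ k <= \sum_(1 <= k < K) (1 + 2 * (n %/ p ^ k)).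
  apply: leq_sum => k _; rewrite addSn add0n -ltnS ltn_divLR ?expn_gt0 ?prime_gt0 //.
  have h : 0 < p ^ k by rewrite expn_gt0 prime_gt0.
  have := divn_eq n (p ^ k); have := ltn_pmod n h; move: h; move: (n %/ p ^ k) (n %% p ^ k) (p ^ k) => u v w h; clear -h; nia.
rewrite big_split /= -big_distrr /= sum_nat_const_nat /K subn1 /= muln1.
by move: (\sum_(_ <= _ < _) _) (\sum_(_ <= _ < _) _) => u v; lia.
Qed.

Lemma central_bin_ge n : 2 ^ n <= 'C(2 * n, n).
Proof.
elim: n => [|n ih]; first by [].
have e : n.+1 * 'C(2 * n.+1, n.+1) = 2 * (2 * n + 1) * 'C(2 * n, n).
  have e1 := mul_bin_diag (2 * n).+2 n; have e2 := mul_bin_down (2 * n).+1 n.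
  have e3 : 2 * n.+1 = (2 * n).+2 by lia.
  have e4 : (2 * n).+1 - n = n.+1 by lia.
  rewrite e3; move: e1 e2; rewrite e4 /= => e1 e2.
  apply/eqP; rewrite -(eqn_pmul2l (ltn0Sn n)) -e1; apply/eqP; nia.
rewrite expnS -(leq_pmul2l (ltn0Sn n)) e; nia.
Qed.

(** Chebyshev's argument with [n = M ^ 2 %/ 2]. Every prime power in ['C(2 * n, n)] is at most
    [M ^ 2]; with fewer than [B] primes from [M] to [M ^ 2] there are at most [M + B] of them, and
    [(M ^ 2) ^ (M + B)] is too small against [2 ^ n]. *)
Lemma many_primes B : exists M0, forall M, M0 <= M ->
  exists ps : seq nat, [/\ uniq ps, all prime ps, all (leq M) ps,
    all (fun p => p <= M ^ 2) ps & B <= size ps].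
Proof.
exists (2 ^ (B + 20)) => M MM.
pose ps := [seq p <- iota M ((M ^ 2).+1 - M) | prime p].
exists ps; have M2 : M <= M ^ 2 by rewrite leq_pmull // (leq_trans _ MM) // expn_gt0.
split; first by rewrite filter_uniq // iota_uniq.
- exact: filter_all.
- by apply/allP => p; rewrite mem_filter mem_iota => /andP [_ /andP []].
- by apply/allP => p; rewrite mem_filter mem_iota => /andP [_ /andP [_]]; rewrite subnKC ?ltnS // ltnW.
rewrite leqNgt; apply/negP => sB.
pose n := (M ^ 2) %/ 2.
have n0 : 0 < n by rewrite divn_gt0 //; apply: leq_trans M2; apply: leq_trans MM; rewrite (@leq_exp2l 2 1) // addnC.
have n2M : 2 * n <= M ^ 2 by rewrite mulnC leq_trunc_div.
pose C := 'C(2 * n, n).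
have C0 : 0 < C by rewrite bin_gt0 leq_pmull.
have CE : C <= (M ^ 2) ^ (M + B).
  rewrite {1}(prod_prime_decomp C0) prime_decompE big_map /=.
  have szC : size (primes C) <= M + B.
    rewrite -(count_predC (fun p => p < M)) -!size_filter leq_add //.
      rewrite -[X in _ <= X](size_iota 0); apply: uniq_leq_size.
        by rewrite filter_uniq // primes_uniq.
      by move=> p; rewrite mem_filter mem_iota /= add0n => /andP [].
    apply: ltnW; apply: leq_ltn_trans sB; apply: uniq_leq_size.
      by rewrite filter_uniq // primes_uniq.
    move=> p; rewrite mem_filter mem_primes /= -leqNgt => /and4P [Mp pp _ pC].
    rewrite mem_filter pp mem_iota Mp /= subnKC; last exact: leqW.
    rewrite ltnS; apply: leq_trans n2M.
    have l1 : 0 < logn p C by rewrite logn_gt0 mem_primes pp C0.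
    have := leq_trans l1 (logn_central_bin pp n0).
    by rewrite trunc_log_gt0 => /andP [_]; move: (prime_gt0 pp); lia.
  apply: (@leq_trans ((M ^ 2) ^ size (primes C))); last first.
    by rewrite leq_pexp2l // (leq_trans _ M2) // (leq_trans _ MM) // expn_gt0.
  have : {subset primes C <= primes C} by [].
  elim: {1 3 4}(primes C) => [|p l ih] sub /=; first by rewrite big_nil.
  rewrite big_cons expnS leq_mul ?ih //; last by move=> q ql; apply: sub; rewrite inE ql orbT.
  have : p \in primes C by apply: sub; rewrite mem_head.
  rewrite mem_primes => /and3P [pp _ _]; apply: leq_trans n2M.
  apply: (@leq_trans (p ^ trunc_log p (2 * n))).
    by rewrite leq_pexp2l ?prime_gt0 // logn_central_bin.
  by rewrite trunc_logP ?prime_gt1 // muln_gt0.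
have M0 : 0 < M by apply: leq_trans MM; rewrite expn_gt0.
pose s := trunc_log 2 M.
have sM : 2 ^ s <= M by rewrite trunc_logP.
have Ms : M <= 2 ^ s.+1 by apply: ltnW; rewrite trunc_log_ltn.
have sB' : B + 20 <= s by rewrite trunc_log_max.
have BM : B <= M by apply: leq_trans MM; apply: leq_trans (ltnW (ltn_expl _ _)) => //; rewrite leq_addr.
have lt : 2 ^ n <= 2 ^ (s.+1 * 2 * (M + B)).
  apply: leq_trans (central_bin_ge n) _; apply: leq_trans CE _.
  rewrite !expnM; apply: leq_expl; exact: leq_expl.
move: lt; rewrite leq_exp2l // leqNgt => /negP; apply.
have big : 16 * s.+1 <= 2 ^ s.
  have : 20 <= s by apply: leq_trans sB'; rewrite leq_addl.
  elim: (s) => // r ih; rewrite leq_eqVlt => /orP [/eqP <-|/ih h]; first by [].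
  by rewrite expnS; move: h; lia.
have : M * (16 * s.+1) <= M * M by rewrite leq_pmul2l // (leq_trans big).
have := divn_eq (M ^ 2) 2; have := ltn_pmod (M ^ 2) (isT : 0 < 2); rewrite -/n -mulnn.
nia.
Qed.

Local Open Scope ring_scope.

(** * Sparsity of the solutions of relations between powers *)

Definition maskmx (a n : nat) (G : 'M[int]_(a, n)) (S : {set 'I_n}) : 'M[rat]_(a, n) :=
  \matrix_(i, j) if j \in S then (G i j)%:~R else 0.

Definition mrank a n (G : 'M[int]_(a, n)) S := \rank (maskmx G S).

Lemma mulmx_maskmx a n (u : 'rV[int]_a) (G : 'M[int]_(a, n)) (S : {set 'I_n}) x : x \in S ->
  (map_mx intr u *m maskmx G S) 0 x = ((u *m G) 0 x)%:~R.
Proof.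
move=> xS; rewrite !mxE rmorph_sum; apply: eq_bigr => i _.
by rewrite !mxE xS rmorphM.
Qed.

(** Cramer's rule at a maximal nonzero minor: a combination of rows is determined on [S] by its
    values at the points [s], with the minor as denominator. A prime power [q] transfers
    divisibility, [q = 0] transfers vanishing. *)
Lemma rank_minor a n (G : 'M[int]_(a, n)) S (r := mrank G S) :
  exists (f : 'I_r -> 'I_a) (s : 'I_r -> 'I_n),
   [/\ forall j, s j \in S, \det (mxsub f s G) != 0 &
     forall (u : 'rV[int]_a) (q : int), (forall j, (u *m G) 0 (s j) \in dvdz q) ->
     forall x, x \in S -> \det (mxsub f s G) * (u *m G) 0 x \in dvdz q].
Proof.
pose A := maskmx G S; pose f := maxrankfun A; pose A1 := rowsub f A.
have fA1 : row_free A1 by exact: maxrowsub_free.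
have fA2 : row_full A1^T by rewrite /row_full mxrank_tr; exact: fA1.
pose s := fullrankfun fA2.
have uX : mxsub f s A \in unitmx.
  have -> : mxsub f s A = (rowsub s A1^T)^T by apply/matrixP => i j; rewrite !mxE.
  by rewrite unitmx_tr fullrowsub_unit.
have sS j : s j \in S.
  apply/negPn/negP => sj; move: uX; rewrite unitmxE.
  suff -> : \det (mxsub f s A) = 0 by rewrite unitr0.
  rewrite (expand_det_col _ j) big1 // => i _; rewrite !mxE (negPf sj) mul0r //.
have mE : mxsub f s A = map_mx intr (mxsub f s G).
  by apply/matrixP => i j; rewrite !mxE sS.
exists f, s; split => //.
  by move: uX; rewrite mE unitmxE det_map_mx unitfE intr_eq0.
move=> u q uq x xS.
set X := mxsub f s G.
have /submxP [w wE] : (map_mx intr u *m A <= A1)%MS.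
  by rewrite /A1 eq_maxrowsub submxMl.
have wX : w *m map_mx intr X = map_mx intr (\row_j (u *m G) 0 (s j)).
  rewrite -mE; apply/rowP => j; rewrite !mxE.
  transitivity ((w *m A1) 0 (s j)); first by rewrite !mxE; apply: eq_bigr => i _; rewrite !mxE.
  rewrite -wE mulmx_maskmx // !mxE; congr (_%:~R).
set v := \row_j _ in wX.
have wd : (\det X)%:~R *: w = map_mx intr (v *m \adj X) :> 'rV[rat]_r.
  rewrite map_mxM -wX map_mx_adj -mulmxA mul_mx_adj det_map_mx.
  by rewrite mul_mx_scalar.
have : (\det X * (u *m G) 0 x)%:~R = ((v *m \adj X *m rowsub f G) 0 x)%:~R :> rat.
  rewrite rmorphM /= -(mulmx_maskmx u G xS) wE.
  have -> : (\det X)%:~R * (w *m A1) 0 x = (((\det X)%:~R *: w) *m A1) 0 x.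
    by rewrite -scalemxAl [RHS]mxE.
  rewrite wd mxE [in RHS]mxE rmorph_sum /=; apply: eq_bigr => i _.
  by rewrite rmorphM !mxE xS.
move/eqP; rewrite eqr_int => /eqP ->.
rewrite mxE; apply: rpred_sum => i _; apply: dvdz_mulr.
rewrite mxE; apply: rpred_sum => j _; apply: dvdz_mulr.
by rewrite mxE uq.
Qed.

Lemma mrank_le_rows a n (G : 'M[int]_(a, n)) S : (mrank G S <= a)%N.
Proof. exact: rank_leq_row. Qed.

Lemma mrank_sub_mul a b n (G : 'M[int]_(a, n)) (G' : 'M[int]_(b, n)) (c : 'rV[int]_n) (S : {set 'I_n}) :
  (forall j, j \in S -> c 0 j != 0) ->
  (exists L : 'M[int]_(a, b), G *m diag_mx c = L *m G') ->
  (mrank G S <= mrank G' S)%N.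
Proof.
move=> c0 [L GL]; rewrite /mrank.
have E : maskmx G S *m diag_mx (\row_j if j \in S then (c 0 j)%:~R else 1)
       = map_mx intr L *m maskmx G' S.
  apply/matrixP => i j; rewrite mul_mx_diag !mxE.
  case: ifP => jS; last first.
    by rewrite mul0r big1 // => k _; rewrite !mxE jS mulr0.
  have /matrixP/(_ i j) := GL; rewrite mul_mx_diag !mxE => /(congr1 (intr : int -> rat)).
  rewrite rmorphM /= => ->; rewrite rmorph_sum; apply: eq_bigr => k _.
  by rewrite !mxE jS rmorphM.
have uD : diag_mx (\row_j if j \in S then (c 0 j)%:~R else 1 : rat) \in unitmx.
  rewrite unitmxE det_diag unitfE; apply/prodf_neq0 => j _.
  by rewrite mxE; case: ifP => jS //; rewrite ?oner_eq0 // intr_eq0 c0.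
rewrite -row_free_unit in uD; by rewrite -(mxrankMfree _ uD) E mxrankM_maxr.
Qed.

Lemma mrank_ge1 a n (G : 'M[int]_(a, n)) (S : {set 'I_n}) i j :
  j \in S -> G i j != 0 -> (1 <= mrank G S)%N.
Proof.
move=> jS gij; rewrite /mrank lt0n mxrank_eq0; apply/eqP => /matrixP/(_ i j).
by rewrite !mxE jS => /eqP; rewrite intr_eq0 (negPf gij).
Qed.

Definition is_minor a n (G : 'M[int]_(a, n)) (S : {set 'I_n}) r
    (f : 'I_r -> 'I_a) (s : 'I_r -> 'I_n) :=
   [/\ forall j, s j \in S, \det (mxsub f s G) != 0 &
     forall (u : 'rV[int]_a) (q : int), (forall j, (u *m G) 0 (s j) \in dvdz q) ->
     forall x, x \in S -> \det (mxsub f s G) * (u *m G) 0 x \in dvdz q].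

Lemma intr_Fp_eq0 (p : nat) (pp : prime p) (x : int) :
  ((x%:~R : 'F_p) == 0) = (p%:Z %| x)%Z.
Proof.
have pos n : (((n%:Z)%:~R : 'F_p) == 0) = (p%:Z %| n%:Z)%Z.
  by rewrite -pmulrn -(dvdn_pcharf (pchar_Fp pp)) dvdzE.
by case: x => n; [exact: pos|rewrite NegzE rmorphN oppr_eq0 rpredN pos].
Qed.

Lemma det_Fp (p : nat) (pp : prime p) n (M : 'M[int]_n) :
  ~~ (p%:Z %| \det M)%Z -> (map_mx (intr : int -> 'F_p) M) \in unitmx.
Proof. by move=> h; rewrite unitmxE det_map_mx unitfE intr_Fp_eq0. Qed.

Lemma lift_Fp (p : nat) (pp : prime p) n (v : 'rV['F_p]_n) :
  exists u : 'rV[int]_n, map_mx intr u = v.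
Proof.
exists (\row_j (nat_of_ord (v 0 j))%:Z); apply/rowP => j; rewrite !mxE -pmulrn.
by rewrite natr_Zp.
Qed.

Lemma pigeonhole (A B : finType) (R : {pred B}) (F : A -> B) :
  (forall a, F a \in R) -> (#|R| < #|A|)%N -> exists a a', a != a' /\ F a = F a'.
Proof.
move=> FR lt.
have : ~~ injectiveb F.
  apply/negP => /injectiveP inj; move: lt; rewrite ltnNge => /negP; apply.
  rewrite -(card_imset _ inj); apply: subset_leq_card; apply/subsetP => b.
  by case/imsetP => a _ ->.
by case/injectivePn => a [a' aa' e]; exists a, a'; rewrite e aa'.
Qed.

Lemma inord_mod_eq (q : nat) (x y : int) : (0 < q)%N ->
  (inord (absz (modz x q)) : 'I_q.-1.+1) = inord (absz (modz y q)) -> x - y \in dvdz q.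
Proof.
move=> q0; have nz : q%:Z != 0 by rewrite eqz_nat -lt0n.
have nn v : (`|modz v q| < q.-1.+1)%N.
  by rewrite prednK // -ltz_nat gez0_abs ?modz_ge0 // ltz_pmod // ltz_nat.
move/(congr1 val); rewrite /= !inordK // => /(congr1 Posz).
by rewrite !gez0_abs ?modz_ge0 // => /eqP; rewrite eqz_mod_dvd.
Qed.

Lemma coprimez_primeX (p k : nat) (x : int) : prime p -> x \notin dvdz p ->
  coprimez (p ^ k)%N x.
Proof.
move=> pp; rewrite dvdzE coprimezE => px; rewrite !absz_nat in px *.
by rewrite coprimeXl // prime_coprime.
Qed.

Lemma dvdz_small (q : nat) (x : int) : x \in dvdz q -> `|x| < q%:Z -> x = 0.
Proof.
move=> dx xq; apply/eqP/negPn/negP => nz; move: dx.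
by rewrite dvdzE absz_nat gtnNdvd ?lt0n ?absz_eq0 // -ltz_nat abszE.
Qed.

Lemma norm_sub_le (X : nat) (x y : 'I_X.+1) : `|(x : nat)%:Z - (y : nat)%:Z| <= X%:Z.
Proof. have := ltn_ord x; have := ltn_ord y; lia. Qed.

(* [G] and [G'] evaluate two families of functions on [S]; [w] multiplies the first family into the
   span of the second and is divisible by [p ^ (2 h)] on [S'], but prime to [p] at the points [s] of
   a minor of [G]. *)
Section Drop.
Variables (a a' n : nat) (G : 'M[int]_(a, n)) (G' : 'M[int]_(a', n)).
Variables (S S' : {set 'I_n}) (p h X : nat) (w : 'rV[int]_n) (L : 'M[int]_(a, a')).
Hypothesis pp : prime p.
Hypothesis GL : G *m diag_mx w = L *m G'.
Hypothesis SS : S' \subset S.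
Variables (l l' : nat) (f : 'I_l -> 'I_a) (s : 'I_l -> 'I_n).
Variables (f' : 'I_l' -> 'I_a') (s' : 'I_l' -> 'I_n).
Hypothesis mn : is_minor G S f s.
Hypothesis mn' : is_minor G' S f' s'.
Hypothesis pd : ~~ (p%:Z %| \det (mxsub f s G))%Z.
Hypothesis pd' : ~~ (p%:Z %| \det (mxsub f' s' G'))%Z.
Hypothesis pw : forall j, w 0 (s j) \notin dvdz p.
Hypothesis XE : X = (p ^ h)%N.
Hypothesis qw : forall x, x \in S' -> w 0 x \in dvdz (X * X)%N.

Let H : 'M[int]_(l, l') := \matrix_(i, j) (w 0 (s' j) * G (f i) (s' j)).

Lemma comb_H (b : 'rV[int]_l) x :
  (b *m rowsub f 1%:M *m L *m G') 0 x = w 0 x * \sum_i b 0 i * G (f i) x.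
Proof.
rewrite -!mulmxA -GL !mulmxA mul_mx_diag mxE mulrC; congr (_ * _).
rewrite -mulmxA -rowsubE mxE; apply: eq_bigr => i _; by rewrite !mxE.
Qed.

(** A combination that vanishes modulo [p] at the points [s'] vanishes on [S] by the minor of [G'],
    hence at the points [s]. There [w] is invertible modulo [p], and the minor of [G] kills the
    coefficients. *)
Lemma H_free : row_free (map_mx (intr : int -> 'F_p) H).
Proof.
apply/inj_row_free => v vH; have [b bv] := lift_Fp pp v.
have d1 j : (b *m rowsub f 1%:M *m L *m G') 0 (s' j) \in dvdz p.
  rewrite comb_H -intr_Fp_eq0 //; move/rowP/(_ j): vH; rewrite -bv !mxE => /eqP.
  congr (_ == _); rewrite rmorphM rmorph_sum mulr_sumr; apply: eq_bigr => i _.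
  by rewrite !mxE !rmorphM /= mulrCA.
have d2 := (let: And3 _ _ X := mn' in X) _ _ d1.
have [sS _ _] := mn.
have d3 j : ((\sum_i b 0 i * G (f i) (s j))%:~R : 'F_p) == 0.
  have := d2 _ (sS j); rewrite comb_H -intr_Fp_eq0 // !rmorphM /= !mulf_eq0.
  by rewrite !intr_Fp_eq0 // (negPf pd') (negPf (pw j)).
suff : v *m map_mx intr (mxsub f s G) = 0.
  by move/(canRL (mulmxK (det_Fp pp pd))); rewrite mul0mx.
apply/rowP => j; rewrite [RHS]mxE -(eqP (d3 j)) rmorph_sum mxE.
by apply: eq_bigr => i _; rewrite -bv !mxE rmorphM.
Qed.

Variables (r : nat) (f1 : 'I_r -> 'I_a') (s1 : 'I_r -> 'I_n).
Hypothesis mn1 : is_minor G' S' f1 s1.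
Variable Bd : nat.
Hypothesis GB : forall i x, x \in S' -> `|G' i x| <= Bd%:Z.
Hypothesis small : (r * Bd < X)%N.

(* Otherwise too many combinations of the rows of [G'] with coefficients at most [X = p ^ h] compete
   for their residues, modulo [w] times the rows of [G], at the points [s'] of a minor; a nonzero one
   is divisible by [p ^ (2 h)] on [S'], hence vanishes there by size. *)
Lemma rank_drop : (r <= 2 * (l' - l))%N.
Proof.
rewrite leqNgt; apply/negP => rg.
have p1 : (0 < p)%N by exact: prime_gt0.
have fullH : row_full (map_mx (intr : int -> 'F_p) H)^T.
  by rewrite /row_full mxrank_tr; exact: H_free.
(* These select [l] of the points [s'] at which the rows of [H] are independent modulo [p].
   Subtracting a combination of those rows clears the coordinates in [J], so only [l' - l] residues
   modulo [q = X ^ 2] are left to match, whence the bound [2 * (l' - l)]. *)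
pose k := fullrankfun fullH.
have k_inj : injective k by exact: fullrankfun_inj.
pose eta := \det (colsub k H).
have peta : ~~ (p%:Z %| eta)%Z.
  rewrite -intr_Fp_eq0 // -det_map_mx -det_tr -unitfE -unitmxE.
  have -> : (map_mx (intr : int -> 'F_p) (colsub k H))^T
     = rowsub k (map_mx intr H)^T by apply/matrixP => i j; rewrite !mxE.
  exact: fullrowsub_unit.
have X1 : (0 < X)%N by rewrite XE expn_gt0 p1.
have [q qE] : exists q, q = (X * X)%N by exists (X * X)%N.
have q0 : (0 < q)%N by rewrite qE muln_gt0 X1.
pose J := [set k i | i : 'I_l].
have cJ : #|J| = l by rewrite card_imset // card_ord.
pose V (u : 'rV[int]_a') : 'rV[int]_l' := \row_j (u *m G') 0 (s' j).
pose b (u : 'rV[int]_a') : 'rV[int]_l := colsub k (V u) *m \adj (colsub k H).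
pose T u := eta *: V u - b u *m H.
have TJ u j : j \in J -> T u 0 j = 0.
  case/imsetP => i _ ->; rewrite !mxE.
  have -> : \sum_j0 b u 0 j0 * H j0 (k i) = (b u *m colsub k H) 0 i.
    by rewrite !mxE; apply: eq_bigr => j0 _; rewrite !mxE.
  by rewrite /b -mulmxA mul_adj_mx mul_mx_scalar -/eta !mxE subrr.
pose U (g : {ffun 'I_r -> 'I_X.+1}) : 'rV[int]_a' :=
  \sum_i (g i)%:Z *: delta_mx 0 (f1 i).
pose F (g : {ffun 'I_r -> 'I_X.+1}) : {ffun 'I_l' -> 'I_q.-1.+1} :=
  [ffun j => if j \in J then ord0 else inord (absz (modz (T (U g) ord0 j) q%:Z))].
have [||g [g' [gg' eF]]] := @pigeonhole _ _ (pffun_on (ord0 : 'I_q.-1.+1) (~: J) predT) F.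
- move=> g; apply/pffun_onP; split => //.
  by apply/subsetP => j; rewrite !inE /F ffunE; case: ifP => //; rewrite eqxx.
- rewrite card_pffun_on.
  rewrite card_ffun !card_ord.
  have e : (q ^ (l' - l) <= X.+1 ^ (2 * (l' - l)))%N.
    have -> : (q ^ (l' - l) = X ^ (2 * (l' - l)))%N by rewrite qE mulnn expnM.
    by case: (2 * (l' - l))%N => // e; rewrite leq_exp2r.
  apply: (@leq_ltn_trans (X.+1 ^ (2 * (l' - l)))%N); last by rewrite ltn_exp2l // ltnS.
  by rewrite cardsCs setCK card_ord cJ prednK.
have TB u v : T (u - v) = T u - T v.
  have VB : V (u - v) = V u - V v by rewrite /V mulmxBl; apply/rowP => j; rewrite !mxE.
  have bB : b (u - v) = b u - b v.
    by rewrite /b -mulmxBl; congr (_ *m _); rewrite VB; apply/rowP => j; rewrite !mxE.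
  by rewrite /T VB bB scalerBr mulmxBl opprD addrACA -opprD.
pose u := U g - U g'.
have Tu j : T u 0 j \in dvdz q.
  have [jJ|jJ] := boolP (j \in J); first by rewrite TJ // rpred0.
  have -> : T u 0 j = T (U g) ord0 j - T (U g') ord0 j.
    by rewrite /u TB mxE [X in _ + X]mxE.
  move/ffunP/(_ j): eF; rewrite ![F _ _]ffunE (negPf jJ); exact: (@inord_mod_eq q _ _ q0).
(* The cleared combination, written in the rows of [G']. It is divisible by [q] at the points [s'],
   hence on [S]; on [S'] the subtracted part carries the factor [w], so [u] itself is divisible by
   [q] there. *)
pose u' := eta *: u - b u *m rowsub f 1%:M *m L.
have u'E x : (u' *m G') 0 x = eta * (u *m G') 0 x - w 0 x * \sum_i b u 0 i * G (f i) x.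
  by rewrite mulmxBl mxE [X in _ + X]mxE comb_H -scalemxAl mxE.
have d1 j : (u' *m G') 0 (s' j) \in dvdz q.
  rewrite u'E; have := Tu j.
  have -> : T u 0 j = eta * V u 0 j - (b u *m H) 0 j.
    by rewrite /T [LHS]mxE [X in X + _]mxE [X in _ + X]mxE.
  have -> : V u 0 j = (u *m G') 0 (s' j) by rewrite [LHS]mxE.
  have -> : (b u *m H) 0 j = w 0 (s' j) * \sum_i b u 0 i * G (f i) (s' j); last by [].
  rewrite mxE mulr_sumr; apply: eq_bigr => i _.
  by rewrite [H i j]mxE mulrCA.
have d2 := (let: And3 _ _ X := mn' in X) _ _ d1.
have cp x : x \notin dvdz p -> coprimez q x.
  by move=> px; rewrite qE XE -expnD; exact: coprimez_primeX.
have d3 x : x \in S' -> (u *m G') 0 x = 0.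
  move=> xS'; have xS : x \in S by exact: (subsetP SS).
  have e1 : (u *m G') 0 x \in dvdz q.
    have := d2 _ xS; rewrite (Gauss_dvdzr _ (cp _ pd')) u'E.
    rewrite rpredBr; last by apply: dvdz_mulr; rewrite qE; exact: qw.
    by rewrite (Gauss_dvdzr _ (cp _ peta)).
  have e2 : `|(u *m G') 0 x| < q%:Z.
    have ui : u *m G' = \sum_i ((g i)%:Z - (g' i)%:Z) *: row (f1 i) G'.
      rewrite mulmxBl /U !mulmx_suml -sumrB; apply: eq_bigr => i _.
      by rewrite scalerBl -!scalemxAl -!rowE.
    rewrite ui summxE.
    apply: (@le_lt_trans _ _ ((r * Bd) * X)%N%:Z); last first.
      by rewrite ltz_nat qE ltn_pmul2r.
    apply: (le_trans (ler_norm_sum _ _ _)).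
    apply: (@le_trans _ _ (\sum_(i < r) (Bd * X)%N%:Z)); last first.
      by rewrite sumr_const card_ord -mulr_natl natz -PoszM mulnA.
    apply: ler_sum => i _; rewrite !mxE normrM PoszM mulrC.
    apply: ler_pM (normr_ge0 _) (normr_ge0 _) (GB _ xS') _; exact: norm_sub_le.
  exact: dvdz_small e1 e2.
have [s1S d1n _] := mn1.
have : (\row_i ((g i)%:Z - (g' i)%:Z)) *m mxsub f1 s1 G' = 0.
  apply/rowP => j; rewrite [RHS]mxE -(d3 _ (s1S j)).
  rewrite mulmxBl /U !mulmx_suml -sumrB summxE mxE; apply: eq_bigr => i _.
  by rewrite -!scalemxAl -!rowE !mxE mulrBl.
move: (gg') => /eqP ne d0; apply: ne; apply/ffunP => i.
have uX : map_mx (intr : int -> rat) (mxsub f1 s1 G') \in unitmx.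
  by rewrite unitmxE det_map_mx unitfE intr_eq0.
have := congr1 (map_mx (intr : int -> rat)) d0.
rewrite map_mxM map_mx0 => /(canRL (mulmxK uX)); rewrite mul0mx => /rowP/(_ i).
rewrite !mxE => /eqP; rewrite intr_eq0 subr_eq0 eqz_nat => /eqP; exact: val_inj.
Qed.
End Drop.

Section Monomials.
Variables (n k d : nat) (x : 'I_n -> int) (c0 : 'I_n -> int).
Variables (c : 'I_k -> 'I_n -> int) (Y : 'I_k -> int).
Hypothesis rel : forall s, c0 s * x s ^+ d = \sum_i Y i * c i s.

(** Homogeneous of degree [E] in [c0] and the [c i]. The relation [rel] trades [c0 * x ^ d] for
    terms linear in the [c i], so the exponent of [x] can be kept below [d]. The [Y i] do not occur
    here, so relations with huge [Y i] do not enlarge the entries. *)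
Definition monom (E : nat) (e : 'I_k -> nat) (r : nat) (s : 'I_n) : int :=
  c0 s ^+ (E - \sum_i e i) * \prod_i c i s ^+ e i * x s ^+ r.

Definition mon_ix E : finType := ({ffun 'I_k -> 'I_E.+1} * 'I_d)%type.

(** Exponents of total degree above [E] index zero rows, which keeps the index type a plain
    product. *)
Definition mon_mx E : 'M[int]_(#|mon_ix E|, n) :=
  \matrix_(i, s) let j : mon_ix E := enum_val i in
    if (\sum_i j.1 i <= E)%N then monom E (fun i => j.1 i) j.2 s else 0.

Definition inV E (F : 'I_n -> int) := exists u : 'rV[int]_(#|mon_ix E|),
  forall s, F s = (u *m mon_mx E) 0 s.

Lemma inV_ext E F F' : F =1 F' -> inV E F -> inV E F'.
Proof. by move=> e [u uE]; exists u => s; rewrite -e. Qed.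

Lemma inV_add E F F' : inV E F -> inV E F' -> inV E (fun s => F s + F' s).
Proof. by move=> [u uE] [v vE]; exists (u + v) => s; rewrite mulmxDl mxE uE vE. Qed.

Lemma inV_scale E F a : inV E F -> inV E (fun s => a * F s).
Proof. by move=> [u uE]; exists (a *: u) => s; rewrite -scalemxAl mxE uE. Qed.

Lemma inV_sum E (I : Type) (l : seq I) (P : pred I) (F : I -> 'I_n -> int) :
  (forall i, inV E (F i)) -> inV E (fun s => \sum_(i <- l | P i) F i s).
Proof.
move=> h; elim: l => [|i l ih].
  by exists 0 => s; rewrite mul0mx mxE big_nil.
case Pi: (P i); last by apply: inV_ext ih => s; rewrite big_cons Pi.
by apply: inV_ext (inV_add (h i) ih) => s; rewrite big_cons Pi.
Qed.

Lemma inV_monom E (e : 'I_k -> nat) r : (\sum_i e i <= E)%N -> (r < d)%N ->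
  inV E (monom E e r).
Proof.
move=> eE rd.
have le i : (e i < E.+1)%N by rewrite ltnS (leq_trans _ eE) // (bigD1 i) //= leq_addr.
pose j : mon_ix E := ([ffun i => Ordinal (le i)], Ordinal rd).
exists (delta_mx 0 (enum_rank j)) => s; rewrite -rowE !mxE enum_rankK /=.
have -> : (\sum_i [ffun i0 => Ordinal (le i0)] i = \sum_i e i)%N.
  by apply: eq_bigr => i _; rewrite ffunE.
rewrite eE /monom; congr (_ * _); congr (_ ^+ (_ - _) * _).
  by apply: eq_bigr => i _; rewrite ffunE.
by apply: eq_bigr => i _; rewrite ffunE.
Qed.

Lemma inV_mul E E' (phi F : 'I_n -> int) :
  (forall e r, (\sum_i e i <= E)%N -> (r < d)%N ->
     inV E' (fun s => phi s * monom E e r s)) ->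
  inV E F -> inV E' (fun s => phi s * F s).
Proof.
move=> h [u uE].
pose T i : 'I_n -> int := fun s => u 0 i * (phi s * mon_mx E i s).
apply: (@inV_ext _ (fun s => \sum_i T i s)) => [s|].
  rewrite uE mxE mulr_sumr; apply: eq_bigr => i _; by rewrite /T mulrCA.
apply: inV_sum => i; apply: inV_scale.
pose j : mon_ix E := enum_val i.
case: (leqP (\sum_i j.1 i) E) => jE.
  by apply: inV_ext (h (fun i => j.1 i) j.2 jE (ltn_ord _)) => s; rewrite mxE /= jE.
exists 0 => s; rewrite mul0mx !mxE /=; case: ifP; rewrite ?mulr0 //.
by rewrite leqNgt jE.
Qed.

Lemma inV_c E F i : inV E F -> inV E.+1 (fun s => c i s * F s).
Proof.
apply: inV_mul => e r eE rd.
pose e' j := (e j + (j == i))%N.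
have e'S : (\sum_j e' j = (\sum_j e j).+1)%N.
  rewrite /e' big_split /= -addn1; congr (_ + _)%N.
  by rewrite (bigD1 i) //= eqxx big1 // => j /negPf ->.
apply: (@inV_ext _ (monom E.+1 e' r)) => [s|]; last by apply: inV_monom; rewrite ?e'S.
rewrite /monom e'S subSS -!mulrA [RHS]mulrCA; congr (_ * _); rewrite mulrA; congr (_ * _).
rewrite (bigD1 i) //= [in RHS](bigD1 i) //= /e' eqxx addn1 exprS mulrA; congr (_ * _).
by apply: eq_bigr => j /negPf ->; rewrite addn0.
Qed.

(** Once [r + j] reaches [d], one factor [c0 * x ^ d] is replaced by [\sum_i Y i * c i]; since
    [r + j < 2 * d], a single replacement suffices. *)
Lemma inV_c0x E F j : (j <= d)%N -> inV E F -> inV E.+1 (fun s => c0 s * x s ^+ j * F s).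
Proof.
move=> jd; apply: inV_mul => e r eE rd.
have [rj|rj] := ltnP (r + j) d.
  apply: (@inV_ext _ (monom E.+1 e (r + j))) => [s|]; last by apply: inV_monom => //; exact: leqW.
  by rewrite /monom subSn // exprS exprD; ring.
have lt : (r + j - d < d)%N by lia.
apply: (@inV_ext _ (fun s => \sum_i Y i * (c i s * monom E e (r + j - d) s))) => [s|].
  transitivity ((\sum_i Y i * c i s) * monom E e (r + j - d) s).
    by rewrite mulr_suml; apply: eq_bigr => i _; rewrite mulrA.
  rewrite -rel /monom.
  have e1 : x s ^+ d * x s ^+ (r + j - d) = x s ^+ j * x s ^+ r.
    by rewrite -!exprD; congr (_ ^+ _); lia.
  have -> : c0 s * x s ^+ d * (c0 s ^+ (E - \sum_i e i) * \prod_i c i s ^+ e i * x s ^+ (r + j - d))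
    = c0 s * c0 s ^+ (E - \sum_i e i) * \prod_i c i s ^+ e i * (x s ^+ d * x s ^+ (r + j - d)) by ring.
  by rewrite e1; ring.
by apply: inV_sum => i; apply: inV_scale; apply: inV_c; apply: inV_monom.
Qed.

Lemma inV_c0 E F : inV E F -> inV E.+1 (fun s => c0 s * F s).
Proof. by move/(inV_c0x (leq0n d)); apply: inV_ext => s; rewrite expr0 mulr1. Qed.

(** In the binomial expansion every power [x ^ (d - i)] shares the single factor [c0], so a factor
    divisible by [p ^ d] on the class of [z] costs only one degree. *)
Lemma inV_xi z E F : inV E F -> inV E.+1 (fun s => c0 s * (x s - z) ^+ d * F s).
Proof.
move=> h.
pose T (i : 'I_d.+1) := fun s => ((-1) ^+ i * z ^+ i *+ 'C(d, i)) * (c0 s * x s ^+ (d - i) * F s).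
apply: (@inV_ext _ (fun s => \sum_i T i s)) => [s|].
  rewrite exprBn mulr_sumr mulr_suml; apply: eq_bigr => i _.
  rewrite /T !mulrnAr !mulrnAl; congr (_ *+ _).
  move: (c0 s) (x s ^+ _) (z ^+ _) ((-1) ^+ i) (F s) => a1 a2 a3 a4 a5; ring.
by apply: inV_sum => i; apply: inV_scale; apply: inV_c0x => //; rewrite leq_subr.
Qed.

Lemma inV_iter (phi : 'I_n -> int) b :
  (forall E F, inV E F -> inV E.+1 (fun s => phi s * F s)) ->
  forall E F, inV E F -> inV (E + b) (fun s => phi s ^+ b * F s).
Proof.
move=> h E F hF; elim: b => [|b ih].
  by rewrite addn0; apply: inV_ext hF => s; rewrite expr0 mul1r.
by rewrite addnS; apply: inV_ext (h _ _ ih) => s; rewrite exprS mulrA.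
Qed.

Lemma mon_mx_mul (phi : 'I_n -> int) E E' :
  (forall F, inV E F -> inV E' (fun s => phi s * F s)) ->
  exists L : 'M[int]_(#|mon_ix E|, #|mon_ix E'|),
    mon_mx E *m diag_mx (\row_s phi s) = L *m mon_mx E'.
Proof.
move=> h.
have /fin_all_exists [u uE] : forall i, exists u : 'rV[int]_(#|mon_ix E'|),
    forall s, phi s * mon_mx E i s = (u *m mon_mx E') 0 s.
  move=> i; apply: h; exists (delta_mx 0 i) => s; by rewrite -rowE [RHS]mxE.
exists (\matrix_i u i); apply/row_matrixP => i.
rewrite [RHS]row_mul rowK; apply/rowP => s.
by rewrite -uE mul_mx_diag !mxE mulrC.
Qed.

Lemma card_mon_ix E : #|mon_ix E| = (E.+1 ^ k * d)%N.
Proof. by rewrite card_prod card_ffun !card_ord. Qed.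

Lemma mon_mx_bound (H N : nat) E i s : (0 < H)%N -> (0 < N)%N ->
  `|c0 s| <= H%:Z -> (forall j, `|c j s| <= H%:Z) -> `|x s| <= N%:Z ->
  `|mon_mx E i s| <= (H ^ E * N ^ d)%N%:Z.
Proof.
move=> H0 N0 h0 hc hx; rewrite mxE /=.
case: ifP => [jE|_]; last by rewrite normr0.
rewrite /monom !normrM PoszM.
apply: ler_pM => //.
  set a := (E - _)%N; have -> : (H ^ E = H ^ a * H ^ (\sum_j (enum_val i).1 j))%N.
    by rewrite -expnD subnK.
  rewrite PoszM; apply: ler_pM => //.
    by rewrite normrX -[(_ ^ _)%N%:Z]natz natrX natz lerXn2r ?nnegrE.
  rewrite normr_prod -natz expn_sum natr_prod; apply: ler_prod => j _.
  by rewrite normr_ge0 /= normrX natrX natz lerXn2r ?nnegrE.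
rewrite normrX -[(_ ^ _)%N%:Z]natz natrX natz.
apply: (@le_trans _ _ (N%:Z ^+ (enum_val i).2)); first by rewrite lerXn2r ?nnegrE.
by apply: ler_weXn2l; [rewrite lez_nat|exact: ltnW].
Qed.
End Monomials.

Lemma prod_primes_dvdn (s : seq nat) D : uniq s -> all prime s ->
  all (dvdn^~ D) s -> (\prod_(p <- s) p %| D)%N.
Proof.
elim: s => [|p s ih] /=; first by rewrite big_nil dvd1n.
case/andP=> ps us /andP [pp aps] /andP [pD sD]; rewrite big_cons Gauss_dvd ?pD ?ih //.
rewrite prime_coprime //; apply/negP; rewrite Euclid_dvd_prod // big_has => /hasP [q qs /= pq].
move: ps; rewrite (_ : p = q) ?qs //; apply/eqP.
by rewrite -dvdn_prime2 // (allP aps).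
Qed.

(** The product of the primes of [s] dividing [D] divides [D], and each of them is at least [M]. *)
Lemma count_primes_dvd (M G : nat) (s : seq nat) (D : int) : (0 < M)%N -> uniq s ->
  all prime s -> all (leq M) s -> D != 0 -> (`|D| < M ^ G)%N ->
  (count (fun p : nat => D \in dvdz p) s < G)%N.
Proof.
move=> M0 us ps sM D0 DG; rewrite -size_filter; set s' := filter _ s.
rewrite ltnNge; apply/negP => Gs; move: DG; rewrite ltnNge => /negP; apply.
apply: (@leq_trans (\prod_(p <- s') p)%N).
  apply: (@leq_trans (M ^ size s')%N); first exact: leq_pexp2l.
  have : all (leq M) s' by rewrite /s' all_filter; apply: sub_all sM => p /= ->; rewrite implybT.
  elim: s' {Gs} => [|p l ih] /=; first by rewrite big_nil.
  by case/andP=> Mp /ih h; rewrite big_cons expnS leq_mul.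
apply: dvdn_leq; first by rewrite absz_gt0.
apply: prod_primes_dvdn; first exact: filter_uniq.
  by rewrite all_filter; apply: sub_all ps => p /= ->; rewrite implybT.
by apply/allP => p; rewrite mem_filter => /andP []; rewrite dvdzE absz_nat.
Qed.

Lemma det_bound r (X : 'M[int]_r) (B : nat) : (forall i j, `|X i j| <= B%:Z) ->
  `|\det X| <= (r`! * B ^ r)%N%:Z.
Proof.
move=> h; rewrite /determinant; apply: (le_trans (ler_norm_sum _ _ _)).
apply: (@le_trans _ _ (\sum_(s : 'S_r) (B ^ r)%N%:Z)).
  apply: ler_sum => s _; rewrite normrM normrX normrN1 expr1n mul1r normr_prod.
  apply: (@le_trans _ _ (\prod_(i < r) B%:Z)).
    by apply: ler_prod => i _; rewrite normr_ge0 h.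
  by rewrite prodr_const card_ord -natz -natrX natz.
by rewrite sumr_const card_Sn -mulr_natl natz PoszM.
Qed.

Lemma card_bigcup_le (I T : finType) (F : I -> {set T}) :
  (#|\bigcup_i F i| <= \sum_i #|F i|)%N.
Proof.
elim/big_rec2: _ => [|i m U _ h]; first by rewrite cards0.
by apply: leq_trans (leq_card_setU _ _).1 _; rewrite leq_add2l.
Qed.

Lemma avg_exists (I : eqType) (s : seq I) (F : I -> nat) (m : nat) :
  (0 < size s)%N -> (\sum_(i <- s) F i <= size s * m)%N -> exists2 i, i \in s & (F i <= m)%N.
Proof.
move=> s0 h; case: (boolP (has (fun i => (F i <= m)%N) s)) => [/hasP [i is_ Fi]|]; first by exists i.
rewrite -all_predC => /allP /= sm; move: h; rewrite leqNgt => /negP []; move: s0 sm.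
elim: s => // i s ih _ sm; rewrite big_cons /= mulSn.
have Fi : (m < F i)%N by rewrite ltnNge sm // mem_head.
case: s ih sm => [|j s] ih sm; first by rewrite big_nil /= mul0n addn0 addn0.
by rewrite -addSn leq_add // ltnW // ih // => k ks; apply: sm; rewrite inE ks orbT.
Qed.

Lemma leq_of_half (u v m : nat) : (u + v = m -> 2 * u <= m -> m <= 2 * v)%N.
Proof. lia. Qed.

Lemma sub_of_add (a b g m n : nat) : (a + b = n -> a < g -> g + m <= n -> m <= b)%N.
Proof. lia. Qed.

Lemma Posz_exp_sq (p e : nat) : (p ^ e * p ^ e)%N%:Z = p%:Z ^+ (2 * e).
Proof. by rewrite -expnD addnn -mul2n -[LHS]natz natrX natz. Qed.

Section Step.
Variables (n k d : nat) (x : 'I_n -> nat) (c0 : 'I_n -> int).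
Variables (c : 'I_k -> 'I_n -> int) (Y : 'I_k -> int).
Let xz s := (x s)%:Z.
Hypothesis rel : forall s, c0 s * xz s ^+ d = \sum_i Y i * c i s.
Hypothesis x_inj : injective x.
Hypothesis c0n : forall s, c0 s != 0.
Variables (H N M A b2 T G1 : nat).
Hypothesis NE : N = (M ^ A)%N.
Hypothesis M1 : (1 < M)%N.
Hypothesis H0 : (0 < H)%N.
Hypothesis hc0 : forall s, `|c0 s| <= H%:Z.
Hypothesis hc : forall j s, `|c j s| <= H%:Z.
Hypothesis hx : forall s, (x s <= N)%N.
Let b := (2 * b2)%N.
Let Bd := (H ^ (T * b) * N ^ d)%N.
Let R := ((T * b).+1 ^ k * d)%N.
Let Lp := (T.+1 * R)%N.
Hypothesis small : (R * Bd < M ^ (d * b2))%N.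
Hypothesis bigG : ((R`! * Bd ^ R) ^ T.+1 * H ^ Lp < M ^ G1)%N.
Variable ps : seq nat.
Hypothesis ups : uniq ps.
Hypothesis pps : all prime ps.
Hypothesis psM : all (leq M) ps.
Hypothesis psM2 : all (fun p => p <= M ^ 2)%N ps.
Hypothesis sps : (G1 + 2 * (A * Lp).+1 <= size ps)%N.

Definition lev (S : {set 'I_n}) e := mrank (mon_mx d xz c0 c (e * b)) S.

Let M0 : (0 < M)%N. Proof. exact: ltnW. Qed.
Let N0 : (0 < N)%N. Proof. by rewrite NE expn_gt0 M0. Qed.

Lemma lev_le S e : (e <= T)%N -> (lev S e <= R)%N.
Proof.
move=> eT; apply: leq_trans (mrank_le_rows _ _) _; rewrite card_mon_ix leq_mul2r.
by rewrite leq_expl ?orbT // ltnS leq_mul.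
Qed.

Lemma entry_bound e i s : (e <= T)%N -> `|mon_mx d xz c0 c (e * b) i s| <= Bd%:Z.
Proof.
move=> eT; have hx' : `|xz s| <= N%:Z by rewrite /xz ger0_norm // lez_nat hx.
apply: (le_trans (mon_mx_bound i H0 N0 (hc0 s) (fun j => hc j s) hx')).
by rewrite lez_nat leq_mul // leq_pexp2l // leq_mul.
Qed.

(* [S'] is a residue class of [S] modulo a prime of [ps] that divides none of the chosen minors and
   contains none of their points, so that [rank_drop] applies at all levels simultaneously with
   [w = (c0 (x - x0)^d)^b]. *)
Lemma few_step (S : {set 'I_n}) : exists S' : {set 'I_n},
  [/\ S' \subset S, (#|S| <= Lp + 2 * M ^ 2 * #|S'|)%N &
   forall e, (e < T)%N -> (lev S' e.+1 <= 2 * (lev S e.+1 - lev S e))%N].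
Proof.
have /fin_all_exists [f /fin_all_exists [pt mn]] : forall e : 'I_T.+1,
    exists (f : 'I_(lev S e) -> 'I_(#|mon_ix k d (e * b)|)) (s : 'I_(lev S e) -> 'I_n),
    is_minor (mon_mx d xz c0 c (e * b)) S f s.
  by move=> e; exact: rank_minor.
pose P := \bigcup_(e < T.+1) [set pt e j | j : 'I_(lev S e)].
have PS : P \subset S.
  apply/bigcupsP => e _; apply/subsetP => _ /imsetP [j _ ->].
  by case: (mn e).
have cP : (#|P| <= Lp)%N.
  apply: (leq_trans (card_bigcup_le _)).
  apply: (@leq_trans (\sum_(e < T.+1) R)%N); last by rewrite sum_nat_const card_ord.
  apply: leq_sum => e _; apply: (leq_trans (leq_imset_card _ _)).
  by rewrite card_ord lev_le // -ltnS.
pose delta (e : 'I_T.+1) : int := \det (mxsub (f e) (pt e) (mon_mx d xz c0 c (e * b))).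
pose D := (\prod_e delta e) * \prod_(s in P) c0 s.
have D0 : D != 0.
  apply: mulf_neq0; apply/prodf_neq0 => s _; last exact: c0n.
  by case: (mn s).
have DG : (`|D| < M ^ G1)%N.
  rewrite -ltz_nat abszE; apply: le_lt_trans (_ : _ <= Posz _) _; last by rewrite ltz_nat; exact: bigG.
  rewrite normrM PoszM; apply: ler_pM => //.
    rewrite normr_prod; apply: (@le_trans _ _ (\prod_(e < T.+1) (R`! * Bd ^ R)%N%:Z)).
      apply: ler_prod => e _; rewrite normr_ge0 /=.
      have eT : (e <= T)%N by rewrite -ltnS.
      apply: le_trans (det_bound (B := Bd) _) _.
        by move=> i j; rewrite mxE entry_bound.
      rewrite lez_nat leq_mul //; first by rewrite leq_fact // lev_le.
      by rewrite leq_pexp2l ?lev_le // muln_gt0 !expn_gt0 H0 N0.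
    by rewrite prodr_const card_ord -natz -natrX natz.
  rewrite normr_prod; apply: (@le_trans _ _ (\prod_(s in P) H%:Z)).
    by apply: ler_prod => s _; rewrite normr_ge0 hc0.
  rewrite prodr_const -natz -natrX natz lez_nat leq_pexp2l //.
pose ps1 := filter (fun p : nat => D \notin dvdz p) ps.
have sps1 : (2 * (A * Lp).+1 <= size ps1)%N.
  have := count_primes_dvd M0 ups pps psM D0 DG.
  have -> : size ps1 = count (predC (fun p : nat => D \in dvdz p)) ps by rewrite size_filter; exact: eq_count.
  by move=> h; apply: sub_of_add (count_predC _ _) h sps.
(* [p] divides [W s] exactly when [s] shares its class modulo [p] with a point of a minor. For each
   [s] off [P] at most [A * Lp] of the primes do so; as at least twice [(A * Lp).+1] primes are
   left, one of them spoils at most half of the points. *)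
pose W s := \prod_(q in P) (xz s - xz q).
have W0 s : s \notin P -> W s != 0.
  move=> sP; apply/prodf_neq0 => q qP; rewrite subr_eq0 eqz_nat.
  by apply: contraNneq sP => /x_inj ->.
have WG s : s \notin P -> (`|W s| < M ^ (A * Lp).+1)%N.
  move=> sP; rewrite -ltz_nat abszE normr_prod.
  apply: (@le_lt_trans _ _ (\prod_(q in P) N%:Z)).
    apply: ler_prod => q _; rewrite normr_ge0 /= /xz.
    by have := hx s; have := hx q; lia.
  rewrite prodr_const -natz -natrX natz ltz_nat NE -expnM.
  by rewrite ltn_exp2l // ltnS leq_mul2l cP orbT.
have [p pps1 pgood] : exists2 p, p \in ps1 & (2 * #|[set s in S :\: P | W s \in dvdz p]| <= #|S :\: P|)%N.
  apply: avg_exists; first exact: leq_trans sps1.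
  rewrite -big_distrr /=.
  have -> : (\sum_(p <- ps1) #|[set s in S :\: P | W s \in dvdz p]| =
     \sum_(s in S :\: P) count (fun p : nat => W s \in dvdz p) ps1)%N.
    transitivity (\sum_(p <- ps1) \sum_(s in S :\: P) (W s \in dvdz p))%N.
      apply: eq_bigr => p _; rewrite -sum1_card big_mkcond [RHS]big_mkcond /=.
      by apply: eq_bigr => s _; rewrite in_set; case: (s \in _) => //=; case: (_ \in _).
    rewrite exchange_big; apply: eq_bigr => s _; rewrite -sum1_count [RHS]big_mkcond.
    by apply: eq_bigr => p _; case: ifP.
  apply: (@leq_trans (2 * (#|S :\: P| * (A * Lp).+1))%N); last first.
    by rewrite mulnCA mulnC leq_mul.
  rewrite leq_pmul2l // -sum_nat_const; apply: leq_sum => s.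
  rewrite inE => /andP [sP _]; apply: ltnW.
  apply: count_primes_dvd (M0) _ _ _ (W0 _ sP) (WG _ sP).
  - exact: filter_uniq.
  - by rewrite all_filter; apply: sub_all pps => q /= ->; rewrite implybT.
  - by rewrite all_filter; apply: sub_all psM => q /= ->; rewrite implybT.
move: (pps1); rewrite mem_filter => /andP [pD pps'].
have pp : prime p by exact: (allP pps).
pose Gd := [set s in S :\: P | W s \notin dvdz p].
have cGd : (#|S :\: P| <= 2 * #|Gd|)%N.
  have := cardsID [set s | W s \in dvdz p] (S :\: P).
  have -> : (S :\: P) :\: [set s | W s \in dvdz p] = Gd.
    by apply/setP => s; rewrite !inE andbC.
  have -> : (S :\: P) :&: [set s | W s \in dvdz p] = [set s in S :\: P | W s \in dvdz p].
    by apply/setP => s; rewrite !inE.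
  by move=> h; apply: leq_of_half h pgood.
have p0 : (0 < p)%N by exact: prime_gt0.
pose cl (z : nat) := [set s in Gd | x s %% p == z]%N.
have [z cz] : exists z, (#|Gd| <= p * #|cl z|)%N.
  case: (boolP [exists z : 'I_p, (#|Gd| <= p * #|cl z|)%N]) => [/existsP [z] |].
    by exists z.
  rewrite negb_exists => /forallP h; exfalso.
  have e : (#|Gd| = \sum_(z < p) #|cl z|)%N.
    rewrite -sum1_card (partition_big (fun s => Ordinal (ltn_pmod (x s) p0)) xpredT) //=.
    apply: eq_bigr => z _; rewrite -sum1_card; apply: eq_bigl => s.
    by rewrite !inE -val_eqE.
  have : (\sum_(z < p) (p * #|cl z|).+1 <= \sum_(z < p) #|Gd|)%N.
    by apply: leq_sum => z _; rewrite ltnNge h.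
  rewrite sum_nat_const card_ord.
  under eq_bigr => z _ do rewrite -addn1.
  rewrite big_split /= -big_distrr /= -e sum1_card card_ord.
  by rewrite -[X in (_ <= X)%N]addn0 leq_add2l leqNgt p0.
exists (cl z); have clS : cl z \subset S.
  by apply/subsetP => s; rewrite !inE => /andP [/andP [/andP [_ ->]]].
split => // [|e eT].
  have := psM2 => /allP/(_ _ pps') pM.
  have : (#|S| <= #|P| + #|S :\: P|)%N by rewrite -(cardsID P S) (setIidPr PS).
  move/leq_trans; apply; apply: leq_add => //; apply: (leq_trans cGd).
  by rewrite -mulnA leq_pmul2l //; apply: (leq_trans cz); rewrite leq_mul2r pM orbT.
have [cl0|[s0 s0cl]] := set_0Vmem (cl z).
  rewrite /lev /mrank (_ : maskmx _ _ = 0) ?mxrank0 //.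
  by apply/matrixP => i j; rewrite !mxE cl0 inE.
have xz_cl s : s \in cl z -> xz s - z%:Z \in dvdz p.
  by rewrite inE => /andP [_ /eqP sz]; rewrite -eqz_mod_dvd -sz !modz_nat modn_mod.
have xz_P q : q \in P -> xz q - z%:Z \notin dvdz p.
  move=> qP; apply/negP => h; move: (s0cl); rewrite !inE => /andP [/andP [_ ]].
  move=> /negP ws _; apply: ws; rewrite /W (bigD1 q) //=; apply: dvdz_mulr.
  by have := rpredB (xz_cl _ s0cl) h; rewrite opprB addrA subrK.
have pdelta e' : delta e' \notin dvdz p.
  by apply: contra pD => h; rewrite /D (bigD1 e') //= -mulrA; apply: dvdz_mulr.
have pc0 q : q \in P -> c0 q \notin dvdz p.
  move=> qP; apply: contra pD => h; rewrite /D (bigD1 q qP) /= mulrCA; exact: dvdz_mulr.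
have rm := @rank_minor _ _ (mon_mx d xz c0 c (e.+1 * b)) (cl z).
case: rm => f1 [s1 mn1].
have [L GL] : exists L, mon_mx d xz c0 c (e * b) *m diag_mx (\row_s (c0 s * (xz s - z%:Z) ^+ d) ^+ b)
    = L *m mon_mx d xz c0 c (e.+1 * b).
  apply: mon_mx_mul => F hF; rewrite mulSn addnC.
  have /(_ _ _ _ hF) := @inV_iter n k d xz c0 c (fun s => c0 s * (xz s - z%:Z) ^+ d) b.
  by apply=> E F'; apply: (inV_xi rel).
have eT1 : (e < T.+1)%N by exact: ltnW.
have eT2 : (e.+1 < T.+1)%N by [].
apply: (rank_drop pp GL clS (mn (Ordinal eT1)) (mn (Ordinal eT2)) _ _ _ (erefl (p ^ (d * b2))%N) _ mn1 (Bd := Bd)).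
- exact: pdelta.
- exact: pdelta.
- move=> j; rewrite mxE; set q := pt _ j.
  have qP : q \in P by apply/bigcupP; exists (Ordinal eT1) => //; apply/imsetP; exists j.
  have pz a : (a \in dvdz p) = ((a%:~R : 'F_p) == 0) by rewrite intr_Fp_eq0.
  have := pc0 _ qP; have := xz_P _ qP; rewrite !pz !rmorphXn !rmorphM /= !rmorphXn /= => h1 h2.
  by rewrite expf_neq0 // mulf_neq0 // expf_neq0.
- move=> s scl; rewrite mxE exprMn -exprM.
  rewrite Posz_exp_sq (_ : (2 * (d * b2) = d * b)%N); last by rewrite mulnCA.
  apply: dvdz_mull; apply: dvdz_exp2r; exact: xz_cl.
- by move=> i s _; apply: entry_bound.
- apply: (leq_ltn_trans (n := R * Bd)); first by rewrite leq_mul2r lev_le ?orbT.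
  apply: (leq_trans small); apply: leq_expl; exact: (allP psM).
Qed.
End Step.

Section Iterate.
Variables (n k d : nat) (x : 'I_n -> nat) (c0 : 'I_n -> int).
Variables (c : 'I_k -> 'I_n -> int) (Y : 'I_k -> int).
Let xz s := (x s)%:Z.
Hypothesis rel : forall s, c0 s * xz s ^+ d = \sum_i Y i * c i s.
Hypothesis c0n : forall s, c0 s != 0.
Hypothesis d0 : (0 < d)%N.
Variables (b2 Q Lp R t mm : nat).
Let b := (2 * b2)%N.
Let T := (mm * t)%N.
Let lv (S : {set 'I_n}) e := lev d x c0 c b2 S e.
Hypothesis lvR : forall S, (lv S T <= R)%N.
Hypothesis step : forall S : {set 'I_n}, exists S' : {set 'I_n},
  [/\ S' \subset S, (#|S| <= Lp + Q * #|S'|)%N &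
   forall e, (e < T)%N -> (lv S' e.+1 <= 2 * (lv S e.+1 - lv S e))%N].
Hypothesis Q0 : (0 < Q)%N.
Hypothesis big : (2 ^ t * R < mm ^ t)%N.

(** Multiplication by [c0 ^ b], which vanishes nowhere, maps each level into the next. *)
Lemma lv_mono S e j : (lv S e <= lv S (e + j))%N.
Proof.
elim: j => [|j ih]; first by rewrite addn0.
apply: (leq_trans ih); rewrite addnS.
apply: (@mrank_sub_mul _ _ _ _ _ (\row_s c0 s ^+ b)).
  by move=> s _; rewrite mxE expf_neq0.
apply: mon_mx_mul => F hF; rewrite mulSn addnC.
have /(_ _ _ _ hF) := @inV_iter n k d xz c0 c c0 b.
by apply=> E F'; apply: (inV_c0 rel).
Qed.

Lemma lv0_ge1 (S : {set 'I_n}) s : s \in S -> (1 <= lv S 0)%N.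
Proof.
move=> sS.
pose j : mon_ix k d (0 * b) := ([ffun=> ord0], Ordinal d0).
apply: (mrank_ge1 (i := enum_rank j) sS).
have e : (\sum_i [ffun _ : 'I_k => (ord0 : 'I_(0 * b).+1)] i = 0)%N.
  by rewrite big1 // => i _; rewrite ffunE.
rewrite !mxE enum_rankK /= e leq0n /monom e mul0n subn0 expr0 mulr1 mul1r.
by rewrite big1 ?oner_neq0 // => i _; rewrite ffunE expr0.
Qed.

(* Summing the rank drops over [mm] consecutive levels telescopes to [mm * lv S' e <= 2 * lv S (e + mm)]. *)
Lemma iterate i : (i <= t)%N -> exists S : {set 'I_n},
  (n <= i * Lp * Q ^ i + Q ^ i * #|S|)%N /\
  (mm ^ i * lv S (mm * (t - i)) <= 2 ^ i * R)%N.
Proof.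
elim: i => [|i ih] it.
  exists [set: 'I_n]; rewrite cardsT card_ord !mul0n add0n expn0 !mul1n subn0; split => //.
have [S [nS lS]] := ih (ltnW it).
have [S' [SS cS lS']] := step S; exists S'; split.
  apply: (leq_trans nS).
  apply: (@leq_trans (i * Lp * Q ^ i.+1 + Q ^ i * (Lp + Q * #|S'|))%N).
    apply: leq_add; last by rewrite leq_mul2l cS orbT.
    by rewrite leq_mul2l leq_pexp2l ?orbT.
  rewrite mulnDr mulnA -expnSr addnA leq_add2r mulSn mulnDl [X in (_ <= X)%N]addnC leq_add2l.
  by rewrite mulnC leq_mul2l leq_pexp2l ?orbT.
pose E := (mm * (t - i.+1))%N.
have EE : (E + mm = mm * (t - i))%N by rewrite /E -mulnSr subnSK.
have ET : (E + mm <= T)%N by rewrite EE /T leq_mul2l leq_subr orbT.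
have h j : (j <= mm)%N -> (j * lv S' E <= 2 * (lv S (E + j) - lv S E))%N.
  elim: j => // j ih2 jm.
  have h1 := lS' _ (leq_trans (_ : E + j < E + mm)%N ET).
  rewrite ltn_add2l in h1; have h2 := h1 jm; have h3 := ih2 (ltnW jm).
  have h4 := lv_mono S' E j.+1; have h5 := lv_mono S E j; have h6 := lv_mono S (E + j) 1.
  rewrite addn1 in h6; rewrite addnS in h4 *; rewrite mulSn.
  clear -h2 h3 h4 h5 h6; move: (lv S' _) (lv S' E) (j * _)%N (lv S E) (lv S _) (lv S (E + j)) h2 h3 h4 h5 h6.
  lia.
have := h mm (leqnn _); rewrite EE => h1.
have h2 : (mm * lv S' E <= 2 * lv S (mm * (t - i)))%N.
  by apply: (leq_trans h1); rewrite leq_mul2l leq_subr.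
rewrite -/E expnSr -mulnA [(2 ^ _)%N]expnS -mulnA.
apply: (leq_trans (n := mm ^ i * (2 * lv S (mm * (t - i))))); first by rewrite leq_mul2l h2 orbT.
by rewrite mulnCA leq_mul2l lS.
Qed.

(** After [t] rounds the rank at level 0 is below 1, whereas one point already has rank 1 because of
    the constant monomial. So no point survives, and each round loses only a factor [Q] and [Lp]
    points. *)
Lemma iterate_bound : (n <= t * Lp * Q ^ t)%N.
Proof.
have [S [nS lS]] := iterate (leqnn t).
have [S0|[s sS]] := set_0Vmem S; first by move: nS; rewrite S0 cards0 muln0 addn0.
have := lv0_ge1 sS; move: lS; rewrite subnn muln0 => lS l1.
by move: big; rewrite ltnNge (leq_trans _ lS) // leq_pmulr.
Qed.
End Iterate.

Lemma sparse_numeric (R C1 U V W dd M A cc d : nat) :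
  (A * cc * U + A * d < dd)%N -> (R * C1 ^ U < M)%N ->
  (R * ((C1 * M ^ (A * cc)) ^ U * (M ^ A) ^ d) < M ^ dd)%N.
Proof.
move=> h1 h2; have M0 : (0 < M)%N by apply: leq_ltn_trans h2.
apply: (@leq_trans (M * M ^ (A * cc * U + A * d))%N); last by rewrite -expnS leq_pexp2l.
rewrite expnMn expnD !expnM mulnA.
by rewrite mulnA [X in (_ < X)%N]mulnA ltn_pmul2r ?ltn_pmul2r ?expn_gt0 ?M0.
Qed.

(** [cond1] with this [b] makes [p ^ (d * b2)] exceed the monomial entries, and [cond2] exhausts the
    rank within [t] rounds, each costing a factor [2 * M ^ 2]. Values of [M] below [M1], where the
    primes or the estimates may fail, are absorbed by the trivial bound in [C2]. *)
Lemma sparse_powers (k d A t mm C1 cc : nat) (b := (4 * A.+1)%N) (T := (mm * t)%N) :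
  (0 < d)%N -> (0 < C1)%N -> (4 * (A * cc) * T <= d)%N ->
  (2 ^ t * ((T * b).+1 ^ k * d) < mm ^ t)%N ->
  exists C2 : nat, forall (M : nat) (Y : 'I_k -> int) (S : seq nat), (0 < M)%N -> uniq S ->
   (forall x, x \in S -> (x <= M ^ A)%N /\ exists (c0 : int) (c : 'I_k -> int),
     [/\ c0 != 0, `|c0| <= (C1 * M ^ (A * cc))%N%:Z,
         forall i, `|c i| <= (C1 * M ^ (A * cc))%N%:Z &
         c0 * x%:Z ^+ d = \sum_i Y i * c i]) ->
   (size S <= C2 * M ^ (2 * t))%N.
Proof.
move=> d0 C10 cond1 cond2.
pose b2 := (2 * A.+1)%N.
have bE : (2 * b2 = b)%N by rewrite /b2 /b mulnA.
pose R := ((T * b).+1 ^ k * d)%N; pose Lp := (T.+1 * R)%N.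
have R0 : (0 < R)%N by rewrite muln_gt0 expn_gt0.
pose G1 := ((1 + d * b2 * R) * T.+1 + (1 + A * cc) * Lp).+1.
have [M0 HM0] := many_primes (G1 + 2 * (A * Lp).+1).
pose M1 := (M0 + R * C1 ^ (T * b) + R`! + C1 + 2)%N.
exists (M1 ^ A + 1 + t * Lp * 2 ^ t)%N => M Y S M_gt0 uS hS.
have [MM1|M1M] := ltnP M M1.
  apply: (@leq_trans (M1 ^ A + 1)%N); last first.
    rewrite -[X in (X <= _)%N]muln1; apply: leq_mul; first by rewrite leq_addr.
    by rewrite expn_gt0 M_gt0.
  have : {subset S <= iota 0 (M1 ^ A + 1)}.
    move=> x /hS [xM _]; rewrite mem_iota add0n addn1 ltnS (leq_trans xM) //.
    by rewrite leq_expl // ltnW.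
  by move/(uniq_leq_size uS); rewrite size_iota.
have M1' : (1 < M)%N by apply: leq_trans M1M; rewrite /M1; lia.
have C1M : (C1 <= M)%N by apply: leq_trans M1M; rewrite /M1; lia.
have RM : (R`! <= M)%N by apply: leq_trans M1M; rewrite /M1; lia.
have RCM : (R * C1 ^ (T * b) < M)%N by apply: leq_trans M1M; rewrite /M1; lia.
have M0M : (M0 <= M)%N by apply: leq_trans M1M; rewrite /M1; lia.
have [ps [ups pps psM psM2 sps]] := HM0 M M0M.
pose n := size S; pose x (s : 'I_n) := nth 0%N S s.
have xS s : x s \in S by apply: mem_nth.
have xinj : injective x.
  by move=> s s' /eqP; rewrite nth_uniq // => /eqP /val_inj.
have /fin_all_exists [c0 /fin_all_exists [c hc]] : forall s : 'I_n,
   exists (c0 : int) (c : 'I_k -> int),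
     [/\ c0 != 0, `|c0| <= (C1 * M ^ (A * cc))%N%:Z,
         forall i, `|c i| <= (C1 * M ^ (A * cc))%N%:Z &
         c0 * (x s)%:Z ^+ d = \sum_i Y i * c i].
  by move=> s; case: (hS _ (xS s)).
pose H := (C1 * M ^ (A * cc))%N.
have H0 : (0 < H)%N by rewrite muln_gt0 C10 expn_gt0 M_gt0.
have sm : (R * (H ^ (T * b) * (M ^ A) ^ d) < M ^ (d * b2))%N.
  have e : (A * cc * (T * b) + A * d < d * b2)%N.
    have h : (4 * (A * cc) * T * A.+1 <= d * A.+1)%N by rewrite leq_mul2r cond1 orbT.
    have e1 : (4 * (A * cc) * T * A.+1 = A * cc * (T * b))%N by rewrite /b; ring.
    have e2 : (d * b2 = d * A.+1 + (A * d + d))%N by rewrite /b2; ring.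
    by rewrite e2 -e1 -addnS leq_add // -[(A * d).+1]addn1 leq_add2l.
  exact: sparse_numeric e RCM.
have bigG : ((R`! * (H ^ (T * (2 * b2)) * (M ^ A) ^ d) ^ R) ^ T.+1 * H ^ Lp < M ^ G1)%N.
  rewrite bE; set Bd := (_ * (M ^ A) ^ d)%N.
  have BdM : (Bd <= M ^ (d * b2))%N.
    by apply: ltnW; apply: leq_ltn_trans sm; rewrite leq_pmull.
  have HM : (H <= M ^ (1 + A * cc))%N by rewrite expnD expn1 leq_mul2r C1M orbT.
  rewrite /G1 [X in (_ < X)%N]expnS; apply: (@leq_ltn_trans (M ^ ((1 + d * b2 * R) * T.+1 + (1 + A * cc) * Lp))%N).
    have hh : (R`! * Bd ^ R <= M ^ (1 + d * b2 * R))%N.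
      by rewrite expnD expn1 [X in (_ <= _ * X)%N]expnM; apply: leq_mul; [exact: RM|exact: (leq_expl _ BdM)].
    rewrite expnD; apply: leq_mul; rewrite [X in (_ <= X)%N]expnM; [exact: (leq_expl _ hh)|exact: (leq_expl _ HM)].
  by rewrite ltn_Pmull // expn_gt0 M_gt0.
have nle : (n <= t * Lp * (2 * M ^ 2) ^ t)%N.
  apply: (@iterate_bound n k d x c0 (fun i s => c s i) Y _ _ d0 b2 (2 * M ^ 2) Lp R t mm).
  - by move=> s; case: (hc s).
  - by move=> s; case: (hc s).
  - by move=> S'; rewrite /R -bE; apply: lev_le.
  - move=> S'; rewrite /Lp /R -bE.
    apply: (@few_step n k d x c0 (fun i s => c s i) Y _ xinj _ H (M ^ A) M A b2 T G1
      (erefl _) M1' H0 _ _ _ _ _ ps ups pps psM psM2 _).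
    + by move=> s; case: (hc s).
    + by move=> s; case: (hc s).
    + by move=> s; case: (hc s).
    + by move=> i s; case: (hc s).
    + by move=> s; case: (hS _ (xS s)).
    + by rewrite bE.
    + by rewrite bE; rewrite bE in bigG.
    + by rewrite bE.
  - by rewrite muln_gt0 expn_gt0 M_gt0.
  - exact: cond2.
apply: (leq_trans nle); rewrite expnMn -expnM mulnA.
by apply: leq_mul => //; rewrite leq_addl.
Qed.

(** * Integer points on a x^d + b y^d = c *)

Section Parallelogram.
Variables (R : realFieldType) (d : nat).
Hypothesis d2 : (1 < d)%N.
Implicit Types a b C x y h k u v : R.

Let d0 : (0 < d)%N. Proof. exact: ltnW. Qed.

(** The cofactor of [u - v] in [u ^ d - v ^ d]; its monotonicity in both arguments stands for the
    convexity of the power function. *)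
Let S u v := \sum_(i < d) u ^+ (d.-1 - i) * v ^+ i.

Let SE u v : u ^+ d - v ^+ d = (u - v) * S u v.
Proof. exact: subrXX. Qed.

Let pow_pM u u' v v' m n : 0 < u -> u <= u' -> 0 < v -> v <= v' ->
  u ^+ m * v ^+ n <= u' ^+ m * v' ^+ n.
Proof.
move=> u0 uu v0 vv.
have u0' := lt_le_trans u0 uu; have v0' := lt_le_trans v0 vv.
by apply: ler_pM; rewrite ?exprn_ge0 ?(ltW u0) ?(ltW v0) // lerXn2r // nnegrE ltW.
Qed.

Let S_ltr u u' v v' : 0 < u -> u <= u' -> 0 < v -> v < v' -> S u v < S u' v'.
Proof.
rewrite /S; case: d d2 => [|[|e]] // _ u0 uu v0 vv.
have u0' := lt_le_trans u0 uu; have v0' := lt_trans v0 vv.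
rewrite big_ord_recr [X in _ < X]big_ord_recr /=; apply: ler_ltD.
  apply: ler_sum => i _; apply: pow_pM => //; exact: ltW.
by rewrite subnn !expr0 !mul1r ltr_pXn2r ?nnegrE ?ltW.
Qed.

Let S_ler u u' v v' : 0 < u -> u <= u' -> 0 < v -> v <= v' -> S u v <= S u' v'.
Proof.
move=> u0 uu v0 vv; have u0' := lt_le_trans u0 uu; have v0' := lt_le_trans v0 vv.
apply: ler_sum => i _; exact: pow_pM.
Qed.

Let S_gt0 u v : 0 < u -> 0 < v -> 0 < S u v.
Proof.
move=> u0 v0; rewrite /S; case: d d2 => [|e] // _.
rewrite big_ord_recr /= ltr_wpDl ?mulr_gt0 ?exprn_gt0 //.
by apply: sumr_ge0 => i _; rewrite mulr_ge0 ?exprn_ge0 ?ltW.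
Qed.

Let S_scale r u v : S (r * u) (r * v) = r ^+ d.-1 * S u v.
Proof.
rewrite /S mulr_sumr; apply: eq_bigr => i _; rewrite !exprMn mulrACA -exprD.
by congr (_ ^+ _ * _); have := ltn_ord i; lia.
Qed.

Let pow_lt u v : 0 < u -> 0 < v -> (u ^+ d < v ^+ d) = (u < v).
Proof. by move=> u0 v0; rewrite ltr_pXn2r ?nnegrE ?ltW. Qed.

(* [a x^d + b y^d = C] with [a, b > 0] is a strictly concave decreasing arc: the second
   differences of both terms along a parallelogram are positive. *)
Let no_para_same a b C x y h k h' k' : 0 < a -> 0 < b -> 0 < h -> 0 < h' ->
  0 < x -> 0 < y -> 0 < y + k -> 0 < y + k' -> 0 < y + k + k' ->
  a * x ^+ d + b * y ^+ d = C -> a * (x + h) ^+ d + b * (y + k) ^+ d = C ->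
  a * (x + h') ^+ d + b * (y + k') ^+ d = C ->
  a * (x + h + h') ^+ d + b * (y + k + k') ^+ d = C -> False.
Proof.
move=> a0 b0 h0 h0' x0 y0 y1 y2 y3 e1 e2 e3 e4.
have dec z w t s : 0 < z -> 0 < w -> 0 < t -> 0 < s -> z < w ->
    a * z ^+ d + b * t ^+ d = C -> a * w ^+ d + b * s ^+ d = C -> s < t.
  move=> z0 w0 t0 s0 zw f1 f2; rewrite -pow_lt // -(ltr_pM2l b0).
  have : a * z ^+ d < a * w ^+ d by rewrite ltr_pM2l // pow_lt.
  by lra.
have k0 : k < 0 by have := dec _ _ _ _ x0 _ y0 y1 _ e1 e2; rewrite gtrDl => -> //; lra.
have k0' : k' < 0 by have := dec _ _ _ _ x0 _ y0 y2 _ e1 e3; rewrite gtrDl => -> //; lra.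
have D u g g' : 0 < u -> 0 < g -> 0 < g' ->
    0 < (u + g + g') ^+ d - (u + g) ^+ d - (u + g') ^+ d + u ^+ d.
  move=> u0 g0 g0'.
  have -> : (u + g + g') ^+ d - (u + g) ^+ d - (u + g') ^+ d + u ^+ d
     = ((u + g + g') ^+ d - (u + g') ^+ d) - ((u + g) ^+ d - u ^+ d) by ring.
  rewrite !SE; have -> : u + g + g' - (u + g') = g by ring.
  have -> : u + g - u = g by ring.
  by rewrite -mulrBr mulr_gt0 // subr_gt0 S_ltr //; lra.
have := D _ _ _ x0 h0 h0'.
have := D (y + k + k') (- k) (- k') y3 _ _.
have -> : y + k + k' - k - k' = y by ring.
have -> : y + k + k' - k = y + k' by ring.
have -> : y + k + k' - k' = y + k by ring.
rewrite !oppr_gt0 => /(_ k0 k0'); set U := (X in 0 < X) => U0; set V := (X in 0 < X) => V0.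
have : 0 < a * V + b * U by rewrite addr_gt0 ?mulr_gt0.
suff -> : a * V + b * U = 0 by rewrite ltxx.
by rewrite /U /V; lra.
Qed.

(** Along this arc both coordinates increase and [x / y] decreases. Two equal parallel chords give
    equal quotients of [S] in [x] by [S] in [y] ([e5]). But with [r] the ratio at the vertex
    [x + h'], the first quotient exceeds [r ^ (d - 1)] and the second does not. The order [h <= h']
    ensures that the ratio at [x + h] is at least [r]. *)
Let no_para_opp a b C x y h k h' k' : 0 < a -> 0 < b -> 0 < C -> 0 < h -> h <= h' ->
  0 < x -> 0 < y -> 0 < y + k -> 0 < y + k' -> 0 < y + k + k' ->
  a * x ^+ d - b * y ^+ d = C -> a * (x + h) ^+ d - b * (y + k) ^+ d = C ->
  a * (x + h') ^+ d - b * (y + k') ^+ d = C ->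
  a * (x + h + h') ^+ d - b * (y + k + k') ^+ d = C -> False.
Proof.
move=> a0 b0 C0 h0 hh' x0 y0 y1 y2 y3 e1 e2 e3 e4.
have inc z w t s : 0 < z -> 0 < w -> 0 < t -> 0 < s -> z < w ->
    a * z ^+ d - b * t ^+ d = C -> a * w ^+ d - b * s ^+ d = C -> t < s /\ w * t < z * s.
  move=> z0 w0 t0 s0 zw f1 f2.
  have ts : t < s.
    rewrite -pow_lt // -(ltr_pM2l b0).
    have : a * z ^+ d < a * w ^+ d by rewrite ltr_pM2l // pow_lt.
    by lra.
  split => //; rewrite -pow_lt ?mulr_gt0 // !exprMn -(ltr_pM2l a0) !mulrA.
  have -> : a * w ^+ d = C + b * s ^+ d by lra.
  have -> : a * z ^+ d = C + b * t ^+ d by lra.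
  by rewrite !mulrDl [X in _ + X < _]mulrAC ltrD2r ltr_pM2l // pow_lt.
have h0' : 0 < h' by lra.
have [|k0 _] := inc _ _ _ _ x0 (addr_gt0 x0 h0) y0 y1 _ e1 e2; first by lra.
have [|k0' r1] := inc _ _ _ _ x0 (addr_gt0 x0 h0') y0 y2 _ e1 e3; first by lra.
have x2 : 0 < x + h' by lra.
have x3 : 0 < x + h + h' by lra.
have [|_ r2] := inc _ _ _ _ x2 x3 y2 y3 _ e3 e4; first by lra.
have r3 : (x + h') * (y + k) <= (x + h) * (y + k').
  have [lt|ge] := ltP h h'.
    by apply: ltW; have [|_ ] := inc _ _ _ _ (addr_gt0 x0 h0) x2 y1 y2 _ e2 e3; first by lra.
  have hE : h' = h by lra.
  suff -> : k' = k by rewrite hE.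
  apply/eqP; move: e3; rewrite hE => e3.
  have : (y + k') ^+ d = (y + k) ^+ d.
    by apply: (mulfI (lt0r_neq0 b0)); lra.
  by move=> /eqP; rewrite eqrXn2 ?ltW // => /eqP; lra.
pose r := (x + h') / (y + k').
have r0 : 0 < r by rewrite divr_gt0.
have rx : r * (y + k') = x + h' by rewrite /r divfK // lt0r_neq0.
have c1 : a * (h * S (x + h) x) = b * (k * S (y + k) y).
  have := SE (x + h) x; have := SE (y + k) y.
  have -> : x + h - x = h by ring.
  have -> : y + k - y = k by ring.
  by move=> <- <-; lra.
have c2 : a * (h * S (x + h + h') (x + h')) = b * (k * S (y + k + k') (y + k')).
  have := SE (x + h + h') (x + h'); have := SE (y + k + k') (y + k').
  have -> : x + h + h' - (x + h') = h by ring.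
  have -> : y + k + k' - (y + k') = k by ring.
  by move=> <- <-; lra.
have kk : 0 < k by lra.
have ry : r * y < x by rewrite /r mulrAC ltr_pdivrMr.
have ryk : r * (y + k) <= x + h by rewrite /r mulrAC ler_pdivrMr.
have ryk' : x + h + h' < r * (y + k + k') by rewrite /r mulrAC ltr_pdivlMr.
have s1 : r ^+ d.-1 * S (y + k) y < S (x + h) x.
  by rewrite -S_scale; apply: S_ltr => //; rewrite mulr_gt0.
have s2 : S (x + h + h') (x + h') <= r ^+ d.-1 * S (y + k + k') (y + k').
  by rewrite -S_scale rx; apply: S_ler => //; exact: ltW.
have Sy0 := S_gt0 y1 y0; have Sy1 := S_gt0 y3 y2.
have Sx0 := S_gt0 (addr_gt0 x0 h0) x0; have Sx1 := S_gt0 x3 x2.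
have e5 : S (x + h) x * S (y + k + k') (y + k') = S (x + h + h') (x + h') * S (y + k) y.
  have ne : a * h * (b * k) != 0 by rewrite !mulf_neq0 ?lt0r_neq0.
  apply: (mulfI ne).
  transitivity ((a * (h * S (x + h) x)) * (b * (k * S (y + k + k') (y + k')))); first by ring.
  by rewrite c1 -c2; ring.
have : S (x + h) x * S (y + k + k') (y + k') > r ^+ d.-1 * S (y + k) y * S (y + k + k') (y + k').
  by rewrite ltr_pM2r.
rewrite e5 ltNge => /negP; apply.
by rewrite mulrAC ler_pM2r.
Qed.
Let no_para_opp' a b C x y h k h' k' : 0 < a -> 0 < b -> 0 < C -> 0 < h -> 0 < h' ->
  0 < x -> 0 < y -> 0 < y + k -> 0 < y + k' -> 0 < y + k + k' ->
  a * x ^+ d - b * y ^+ d = C -> a * (x + h) ^+ d - b * (y + k) ^+ d = C ->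
  a * (x + h') ^+ d - b * (y + k') ^+ d = C ->
  a * (x + h + h') ^+ d - b * (y + k + k') ^+ d = C -> False.
Proof.
move=> a0 b0 C0 h0 h0' x0 y0 y1 y2 y3 e1 e2 e3 e4.
have [hh|/ltW hh] := leP h h'; first exact: (no_para_opp a0 b0 C0 h0 hh x0 y0 y1 y2 y3 e1 e2 e3 e4).
rewrite addrAC in y3; rewrite (addrAC x) (addrAC y) in e4.
exact: (no_para_opp a0 b0 C0 h0' hh x0 y0 y2 y1 y3 e1 e3 e2 e4).
Qed.

(** When [b] and [C] are both negative, exchanging the coordinates leads back to the previous case.
    With [C = 0] the curve could be a line through the origin, full of degenerate parallelograms. *)
Let no_para_pos a b C x y h k h' k' : 0 < a -> b != 0 -> C != 0 -> 0 < h -> 0 < h' ->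
  0 < x -> 0 < y -> 0 < y + k -> 0 < y + k' -> 0 < y + k + k' ->
  a * x ^+ d + b * y ^+ d = C -> a * (x + h) ^+ d + b * (y + k) ^+ d = C ->
  a * (x + h') ^+ d + b * (y + k') ^+ d = C ->
  a * (x + h + h') ^+ d + b * (y + k + k') ^+ d = C -> False.
Proof.
move=> a0 bn Cn h0 h0' x0 y0 y1 y2 y3 e1 e2 e3 e4.
have x1 := addr_gt0 x0 h0; have x2 := addr_gt0 x0 h0'; have x3 := addr_gt0 x1 h0'.
move: bn; rewrite neq_lt => /orP [b0|b0]; last first.
  exact: (no_para_same a0 b0 h0 h0' x0 y0 y1 y2 y3 e1 e2 e3 e4).
have b0' : 0 < - b by lra.
move: Cn; rewrite neq_lt => /orP [C0|C0]; last first.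
  by apply: (no_para_opp' a0 b0' C0 h0 h0' x0 y0 y1 y2 y3); rewrite mulNr opprK.
have C0' : 0 < - C by lra.
have inc z w t s : 0 < z -> 0 < w -> 0 < t -> 0 < s -> z < w ->
    a * z ^+ d + b * t ^+ d = C -> a * w ^+ d + b * s ^+ d = C -> t < s.
  move=> z0 w0 t0 s0 zw f1 f2.
  rewrite -pow_lt // -(ltr_pM2l b0').
  have : a * z ^+ d < a * w ^+ d by rewrite ltr_pM2l // pow_lt.
  by lra.
have k0 : 0 < k by have := inc _ _ _ _ x0 x1 y0 y1 _ e1 e2; rewrite !ltrDl => ->.
have k0' : 0 < k' by have := inc _ _ _ _ x0 x2 y0 y2 _ e1 e3; rewrite !ltrDl => ->.
apply: (no_para_opp' b0' a0 C0' k0 k0' y0 x0 x1 x2 x3); rewrite mulNr -opprD addrC.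
- by rewrite e1.
- by rewrite e2.
- by rewrite e3.
- by rewrite e4.
Qed.

Lemma no_parallelogram a b C x y h k h' k' : a != 0 -> b != 0 -> C != 0 ->
  (h, k) != 0 -> (h', k') != 0 -> 0 < x -> 0 < x + h -> 0 < x + h' -> 0 < x + h + h' ->
  0 < y -> 0 < y + k -> 0 < y + k' -> 0 < y + k + k' ->
  a * x ^+ d + b * y ^+ d = C -> a * (x + h) ^+ d + b * (y + k) ^+ d = C ->
  a * (x + h') ^+ d + b * (y + k') ^+ d = C ->
  a * (x + h + h') ^+ d + b * (y + k + k') ^+ d = C -> False.
Proof.
wlog a0 : a b C / 0 < a.
  move=> W an; have [/W|a0] := ltP 0 a; first exact.
  move=> bn Cn hk hk' x0 x1 x2 x3 y0 y1 y2 y3 e1 e2 e3 e4.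
  have a0' : 0 < - a by rewrite oppr_gt0 lt_neqAle an.
  apply: (W (- a) (- b) (- C) a0'); rewrite ?oppr_eq0 ?mulNr -?opprD ?e1 ?e2 ?e3 ?e4 //.
move=> an bn Cn hk hk' x0 x1 x2 x3 y0 y1 y2 y3 e1 e2 e3 e4.
have nz z w g : 0 < w -> 0 < w + g -> a * z ^+ d + b * w ^+ d = C ->
    a * (z + 0) ^+ d + b * (w + g) ^+ d = C -> g = 0.
  move=> w0 wg f1 f2; apply/eqP; have : (w + g) ^+ d = w ^+ d.
    by apply: (mulfI bn); rewrite addr0 in f2; lra.
  by move=> /eqP; rewrite eqrXn2 ?ltW // => /eqP; lra.
have hn : h != 0.
  apply: contraNneq hk => h0; rewrite h0 in e2 *; rewrite (nz _ _ _ y0 y1 e1 e2) //.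
have hn' : h' != 0.
  apply: contraNneq hk' => h0; rewrite h0 in e3 *; rewrite (nz _ _ _ y0 y2 e1 e3) //.
(* Start from the vertex from which both horizontal steps are positive. *)
move: hn hn'; rewrite !neq_lt => /orP [] h0 /orP [] h0'.
- apply: (@no_para_pos a b C (x + h + h') (y + k + k') (- h) (- k) (- h') (- k')) => //; rewrite ?oppr_gt0 //.
  + by have -> : y + k + k' - k = y + k' by ring.
  + by have -> : y + k + k' - k' = y + k by ring.
  + by have -> : y + k + k' - k - k' = y by ring.
  + have -> : x + h + h' - h = x + h' by ring. by have -> : y + k + k' - k = y + k' by ring.
  + have -> : x + h + h' - h' = x + h by ring. by have -> : y + k + k' - k' = y + k by ring.
  + have -> : x + h + h' - h - h' = x by ring. by have -> : y + k + k' - k - k' = y by ring.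
- apply: (@no_para_pos a b C (x + h) (y + k) (- h) (- k) h' k') => //; rewrite ?oppr_gt0 ?addrK //.
- rewrite (addrAC x) (addrAC y) in e4; rewrite (addrAC y) in y3.
  apply: (@no_para_pos a b C (x + h') (y + k') (- h') (- k') h k) => //; rewrite ?oppr_gt0 ?addrK //.
- exact: (@no_para_pos a b C x y h k h' k').
Qed.
End Parallelogram.

Definition curve_pts d (a b C : int) N : {set 'I_N * 'I_N} :=
  [set v : 'I_N * 'I_N | a * (v.1.+1)%:Z ^+ d + b * (v.2.+1)%:Z ^+ d == C].

Lemma curve_sidon d (a b C : int) N (v v' w w' : 'I_N * 'I_N) : (1 < d)%N ->
  a != 0 -> b != 0 -> C != 0 ->
  v \in curve_pts d a b C N -> v' \in curve_pts d a b C N ->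
  w \in curve_pts d a b C N -> w' \in curve_pts d a b C N -> v != v' ->
  (v'.1 + w.1 = w'.1 + v.1)%N -> (v'.2 + w.2 = w'.2 + v.2)%N -> v = w.
Proof.
move=> d2 an bn Cn; rewrite !inE => /eqP ev /eqP ev' /eqP ew /eqP ew' vv' e1 e2.
apply/eqP/negPn/negP => vw.
have q (u : 'I_N * 'I_N) : a * (u.1.+1)%:Z ^+ d + b * (u.2.+1)%:Z ^+ d = C ->
   a%:~R * (u.1.+1)%:R ^+ d + b%:~R * (u.2.+1)%:R ^+ d = C%:~R :> rat.
  by move=> <-; rewrite rmorphD !rmorphM !rmorphXn.
have inj (u u' : 'I_N * 'I_N) : u != u' -> ((u'.1.+1)%:R - (u.1.+1)%:R, (u'.2.+1)%:R - (u.2.+1)%:R) != 0 :> rat * rat.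
  apply: contraNneq => -[/eqP]; rewrite subr_eq0 eqr_nat eqSS => /eqP f1 /eqP.
  rewrite subr_eq0 eqr_nat eqSS => /eqP f2.
  by case: u u' f1 f2 => [i j] [i' j'] /= /val_inj -> /val_inj ->.
have g1 : (v.1.+1)%:R + ((v'.1.+1)%:R - (v.1.+1)%:R) + ((w.1.+1)%:R - (v.1.+1)%:R) = (w'.1.+1)%:R :> rat.
  have : (v'.1.+1 + w.1.+1)%N%:R = (w'.1.+1 + v.1.+1)%N%:R :> rat by congr (_%:R); lia.
  by rewrite !natrD; lra.
have g2 : (v.2.+1)%:R + ((v'.2.+1)%:R - (v.2.+1)%:R) + ((w.2.+1)%:R - (v.2.+1)%:R) = (w'.2.+1)%:R :> rat.
  have : (v'.2.+1 + w.2.+1)%N%:R = (w'.2.+1 + v.2.+1)%N%:R :> rat by congr (_%:R); lia.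
  by rewrite !natrD; lra.
have pos n : 0 < (n.+1)%:R :> rat by rewrite ltr0n.
have c1 n m : (n.+1)%:R + ((m.+1)%:R - (n.+1)%:R) = (m.+1)%:R :> rat by rewrite addrC subrK.
apply: (no_parallelogram (a := a%:~R) (b := b%:~R) (C := C%:~R) d2 _ _ _ (inj _ _ vv') (inj _ _ vw)
  (x := (v.1.+1)%:R) (y := (v.2.+1)%:R)); rewrite ?intr_eq0 ?g1 ?g2 ?c1 //; exact: q.
Qed.

Lemma curve_mono d (a b C : int) N (v v' : 'I_N * 'I_N) : (0 < d)%N -> a != 0 -> b != 0 ->
  v \in curve_pts d a b C N -> v' \in curve_pts d a b C N -> (v.1 < v'.1)%N ->
  if 0 < a * b then (v'.2 < v.2)%N else (v.2 < v'.2)%N.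
Proof.
move=> d0 an bn; rewrite !inE => /eqP e1 /eqP e2 lt.
have pw (n m : nat) : (n < m)%N = ((n.+1)%:Z ^+ d < (m.+1)%:Z ^+ d).
  by rewrite ltr_pXn2r ?nnegrE // ltz_nat.
rewrite pw in lt; rewrite !pw.
move: e1 e2 lt; set x1 := _ ^+ d; set y1 := _ ^+ d; set x2 := _ ^+ d; set y2 := _ ^+ d.
move=> e1 e2 lt; have e : a * (x2 - x1) = b * (y1 - y2) by lra.
have {}lt : 0 < x2 - x1 by rewrite subr_gt0.
have : 0 < a * b * (y1 - y2).
  by rewrite -mulrA -e mulrA mulr_gt0 // -expr2 exprn_even_gt0.
case: ifP => ab; first by rewrite pmulr_rgt0 // subr_gt0.
have ab' : a * b < 0 by rewrite lt_neqAle mulf_neq0 // leNgt ab.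
by rewrite nmulr_rgt0 // subr_lt0.
Qed.

Lemma curve_inj1 d (a b C : int) N (v v' : 'I_N * 'I_N) : (0 < d)%N -> b != 0 ->
  v \in curve_pts d a b C N -> v' \in curve_pts d a b C N -> v.1 = v'.1 -> v = v'.
Proof.
move=> d0 bn; rewrite !inE => /eqP e1 /eqP e2 e; rewrite e in e1.
suff : v.2 = v'.2 :> nat by case: v v' {e1 e2} e => [i j] [i' j'] /= -> /val_inj ->.
apply/eqP; have : ((v.2.+1)%:Z ^+ d == (v'.2.+1)%:Z ^+ d).
  apply/eqP; apply: (mulfI bn); lra.
by rewrite eqrXn2.
Qed.

(** The monotone arc meets at most [2 * L ^ 2] cells of side [L]. A point that is not the
    representative of its cell is encoded by its difference from it; by [curve_sidon] a nonzero
    difference belongs to one pair only, so there are at most [(2 * L) ^ 2] such points. *)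
Lemma jarnik d (a b C : int) L N : N = (L ^ 3)%N -> (1 < d)%N -> a != 0 -> b != 0 -> C != 0 -> (0 < L)%N ->
  (#|curve_pts d a b C N| <= 6 * L ^ 2)%N.
Proof.
move=> NL d2 an bn Cn L0; set T := curve_pts d a b C N.
have d0 : (0 < d)%N by exact: ltnW.
have NE : N = (L ^ 2 * L)%N by rewrite NL -expnSr.
(* The second coordinate is reflected when the arc decreases. Both cell indices then grow along the
   arc, so their sum identifies the cell. *)
pose ry (v : 'I_N * 'I_N) := if 0 < a * b then (N.-1 - v.2)%N else v.2.
have ryN v : (ry v < N)%N by rewrite /ry; case: ifP => _; have := ltn_ord v.2; lia.
have mono v v' : v \in T -> v' \in T -> (v.1 < v'.1)%N -> (ry v < ry v')%N.
  move=> vT vT' lt; have := curve_mono d0 an bn vT vT' lt; rewrite /ry.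
  case: ifP => // _; have := ltn_ord v.2; have := ltn_ord v'.2; clear.
  by move: (v.2 : nat) (v'.2 : nat) => m m'; lia.
have keylt (v : 'I_N * 'I_N) : (v.1 %/ L + ry v %/ L < 2 * L ^ 2)%N.
  rewrite mul2n -addnn -addSn; apply: leq_add; last by apply: ltnW; rewrite ltn_divLR // -NE.
  by rewrite ltn_divLR // -NE.
pose key (v : 'I_N * 'I_N) : 'I_(2 * L ^ 2) := Ordinal (keylt v).
have cell (v v' : 'I_N * 'I_N) : v \in T -> v' \in T -> key v = key v' ->
    (v.1 %/ L = v'.1 %/ L)%N /\ (ry v %/ L = ry v' %/ L)%N.
  move=> vT vT' /(congr1 val) /= e.
  have [lt|lt|e1] := ltngtP v.1 v'.1.
  - have h1 := leq_div2r L (ltnW lt); have h2 := leq_div2r L (ltnW (mono _ _ vT vT' lt)).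
    move: h1 h2 e; clear; move: (_ %/ _)%N (_ %/ _)%N (_ %/ _)%N (_ %/ _)%N => *; lia.
  - have h1 := leq_div2r L (ltnW lt); have h2 := leq_div2r L (ltnW (mono _ _ vT' vT lt)).
    move: h1 h2 e; clear; move: (_ %/ _)%N (_ %/ _)%N (_ %/ _)%N (_ %/ _)%N => *; lia.
  - by rewrite (curve_inj1 d0 bn vT vT' (val_inj e1)).
pose rep v := odflt v [pick u in T | key u == key v].
have repT v : v \in T -> rep v \in T /\ key (rep v) = key v.
  move=> vT; rewrite /rep; case: pickP => [u /andP [uT /eqP e] //|/(_ v)].
  by rewrite vT eqxx.
have rep_eq v w : v \in T -> w \in T -> key v = key w -> rep v = rep w.
  move=> vT wT e; rewrite /rep e; case: pickP => //= /(_ w).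
  by rewrite wT eqxx.
have near (m n : nat) : (m %/ L = n %/ L)%N -> (m < n + L)%N.
  move=> e; rewrite (divn_eq n L) [X in (X < _)%N](divn_eq m L) e -addnA ltn_add2l.
  by apply: leq_trans (ltn_pmod _ L0) _; rewrite leq_addl.
have near2 (v w : 'I_N * 'I_N) : v \in T -> w \in T -> key v = key w ->
   (v.1 + L - w.1 < 2 * L)%N /\ (v.2 + L - w.2 < 2 * L)%N /\ (w.1 < v.1 + L)%N /\ (w.2 < v.2 + L)%N.
  move=> vT wT e; have [c1 c2] := cell _ _ vT wT e.
  have a1 := near _ _ c1; have a2 := near _ _ (esym c1).
  have a3 := near _ _ c2; have a4 := near _ _ (esym c2).
  move: a1 a2 a3 a4; rewrite /ry; have := ltn_ord v.2; have := ltn_ord w.2.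
  by case: ifP => _; clear; lia.
pose f (v : 'I_N * 'I_N) : 'I_(2 * L ^ 2) + ('I_(2 * L).-1.+1 * 'I_(2 * L).-1.+1) :=
  if v == rep v then inl (key v) else inr (inord (v.1 + L - (rep v).1), inord (v.2 + L - (rep v).2)).
have L20 : (0 < 2 * L)%N by rewrite muln_gt0.
have finj : {in T &, injective f}.
  move=> v w vT wT; rewrite /f.
  have [rvT krv] := repT _ vT; have [rwT krw] := repT _ wT.
  case: eqVneq => [rv|rv]; case: eqVneq => [rw|rw] //.
    by case=> e; rewrite rv rw (rep_eq v w) //; apply: val_inj.
  case=> /(congr1 val) /= e1 /(congr1 val) /= e2.
  have [n1 [n2 [n3 n4]]] := near2 _ _ vT rvT (esym krv).
  have [m1 [m2 [m3 m4]]] := near2 _ _ wT rwT (esym krw).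
  rewrite !inordK ?prednK // in e1 e2.
  have e : rep v = rep w.
    apply: (curve_sidon d2 an bn Cn rvT vT rwT wT); rewrite 1?eq_sym //.
      by move: e1 n3 m3; clear; lia.
    by move: e2 n4 m4; clear; lia.
  rewrite e in e1 e2 n3 n4; case: v w {vT wT rv rw rvT rwT krv krw n1 n2 m1 m2 e} e1 e2 n3 n4 m3 m4 => [i j] [i' j'] /=.
  by move=> e1 e2 n3 n4 m3 m4; congr (_, _); apply: val_inj => /=; move: e1 e2 n3 n4 m3 m4; clear; lia.
rewrite -/T -(card_in_imset finj); apply: (leq_trans (max_card _)).
rewrite card_sum card_prod !card_ord prednK //.
by rewrite -mulnn; clear; lia.
Qed.

(** * Counting linear relations between powers *)

Lemma adj_mul_bound r n (X : 'M[int]_r) (G : 'M[int]_(r, n)) (W : nat) :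
  (forall i j, `|X i j| <= W%:Z) -> (forall i j, `|G i j| <= W%:Z) ->
  forall i j, `|(\adj X *m G) i j| <= (r`! * W ^ r)%N%:Z.
Proof.
case: r X G => [|r] X G XW GW i j; first by case: i.
rewrite mxE; apply: (le_trans (ler_norm_sum _ _ _)).
apply: (@le_trans _ _ (\sum_(l < r.+1) (r`! * W ^ r * W)%N%:Z)); last first.
  by rewrite sumr_const card_ord -mulr_natl natz -PoszM factS expnSr !mulnA.
apply: ler_sum => l _; rewrite normrM PoszM; apply: ler_pM => //.
rewrite mxE /cofactor normrM normrX normrN1 expr1n mul1r.
by apply: det_bound => i' j'; rewrite !mxE.
Qed.

(** The reduced echelon basis of the row space, multiplied by the pivot minor [D] to stay integral.
    The adjugate gives the size bounds, and [rank_minor] with [q = 0] gives the last identity. *)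
Lemma pivot_basis a n (G : 'M[int]_(a, n)) (W : nat) : (forall i j, `|G i j| <= W%:Z) ->
  exists (r : nat) (s : 'I_r -> 'I_n) (D : int) (w : 'M[int]_(r, n)) (U : 'M[int]_(r, a)),
   [/\ D != 0, w = U *m G, forall i j, w i (s j) = if i == j then D else 0 &
     [/\ `|D| <= (r`! * W ^ r)%N%:Z, forall i j, `|w i j| <= (r`! * W ^ r)%N%:Z
     & forall k j, D * G k j = \sum_i G k (s i) * w i j]].
Proof.
move=> GW; have [f [s [_ D0 H]]] := rank_minor G setT.
set X := mxsub f s G in D0 H; set r := mrank G setT in f s X D0 H.
pose U : 'M[int]_(r, a) := \adj X *m rowsub f 1%:M.
have UG : U *m G = \adj X *m rowsub f G by rewrite -mulmxA -rowsubE.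
have ws i j : (U *m G) i (s j) = if i == j then \det X else 0.
  have -> : (U *m G) i (s j) = (\adj X *m X) i j.
    by rewrite UG !mxE; apply: eq_bigr => l _; rewrite !mxE.
  by rewrite mul_adj_mx mxE; case: eqP => //= _; rewrite mulr0n.
have XW i j : `|X i j| <= W%:Z by rewrite mxE.
exists r, s, (\det X), (U *m G), U; split => //; split.
- exact: det_bound.
- by move=> i j; rewrite UG; apply: adj_mul_bound => // i' j'; rewrite mxE.
- move=> k j.
  pose u : 'rV[int]_a := \det X *: delta_mx 0 k - (\row_i G k (s i)) *m U.
  have uE x : (u *m G) 0 x = \det X * G k x - \sum_i G k (s i) * (U *m G) i x.
    rewrite /u mulmxBl mxE -scalemxAl -rowE mxE [row k G 0 x]mxE; congr (_ + _).
    by rewrite -mulmxA [LHS]mxE [X in - X]mxE; congr (- _); apply: eq_bigr => i _; rewrite mxE.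
  have z j' : (u *m G) 0 (s j') \in dvdz 0.
    rewrite uE (bigD1 j') //= ws eqxx big1 => [|i /negPf ij]; last by rewrite ws ij mulr0.
    by rewrite addr0 mulrC subrr dvdz0.
  have := H u 0 z j (in_setT _); rewrite dvd0z mulf_eq0 (negPf D0) /= uE subr_eq0.
  by move/eqP.
Qed.

Section Structure.
Variables (J : finType) (side : pred J) (N W d : nat).
Hypothesis d0 : (0 < d)%N.
Implicit Types (n : {ffun J -> 'I_N}) (z : {ffun J -> 'I_(2 * W).+1}).

Definition zval z j : int := (z j)%:Z - W%:Z.
Definition sgn_side j : int := if side j then 1 else -1.
Definition nu n j : int := sgn_side j * ((n j).+1)%:Z ^+ d.

(** The coefficients [wdiff] to be inserted sum to 0 on each side, whence the two side conditions;
    [two_nonzero] exploits them. *)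
Definition sols n : {set {ffun J -> 'I_(2 * W).+1}} :=
  [set z | [&& \sum_j zval z j * nu n j == 0, \sum_(j | side j) zval z j == 0 &
               \sum_(j | ~~ side j) zval z j == 0]].

Definition inj_sides n := [forall i, forall j, (side i == side j) && (n i == n j) ==> (i == j)].

(** The coordinates in [P] determine each solution. The last clause is the dual statement: whatever
    is orthogonal to all solutions, such as [nu n] or the indicator of a side, obeys one relation
    for each pivot. *)
Definition pivots n (P : {set J}) (D : int) (K : J -> J -> int) :=
  [/\ P != set0, D != 0, `|D| <= (#|P|`! * W ^ #|P|)%N%:Z,
      forall i j, `|K i j| <= (#|P|`! * W ^ #|P|)%N%:Z &
    (forall z j, z \in sols n -> D * zval z j = \sum_(i in P) K i j * zval z i) /\
    (forall phi : J -> int, (forall z, z \in sols n -> \sum_j zval z j * phi j = 0) ->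
      forall i, i \in P -> D * phi i + \sum_(j | j \notin P) K i j * phi j = 0)].

Lemma zval_le z j : `|zval z j| <= W%:Z.
Proof. by rewrite /zval; have := ltn_ord (z j); lia. Qed.

Lemma pivots_exist n z0 j0 : z0 \in sols n -> zval z0 j0 != 0 -> exists P D K, pivots n P D K.
Proof.
move=> z0s z0n.
pose G : 'M[int]_(#|sols n|, #|J|) := \matrix_(k, j) zval (enum_val k) (enum_val j).
have [|r [s [D [w [U [D0 wU ws [DB wB Gw]]]]]]] := @pivot_basis _ _ G W.
  by move=> i j; rewrite mxE zval_le.
have s_inj : injective s.
  by move=> i i' e; have := ws i i'; rewrite -e ws eqxx; case: eqP => // _ /eqP; rewrite (negPf D0).
pose e i : J := enum_val (s i).
have e_inj : injective e by move=> i i' /enum_val_inj /s_inj.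
pose P := [set e i | i : 'I_r].
have cP : #|P| = r by rewrite card_imset // card_ord.
pose K i j : int := if [pick l | e l == i] is Some l then w l (enum_rank j) else 0.
have Ke l j : K (e l) j = w l (enum_rank j).
  by rewrite /K; case: pickP => [l' /eqP /e_inj -> //|/(_ l)]; rewrite eqxx.
have Gz z j : z \in sols n -> D * zval z j = \sum_(i in P) K i j * zval z i.
  move=> zs; rewrite big_imset /=; last by move=> ? ? _ _; exact: e_inj.
  have := Gw (enum_rank_in zs z) (enum_rank j).
  rewrite mxE enum_rankK_in // enum_rankK => ->; apply: eq_big => // l _.
  by rewrite mxE enum_rankK_in // Ke mulrC.
exists P, D, K; split; rewrite ?cP //.
- apply: contraNneq z0n => P0; have := Gz _ j0 z0s; rewrite P0 big_set0 => /eqP.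
  by rewrite mulf_eq0 (negPf D0).
- move=> i j; rewrite /K; case: pickP => [l _|_]; first exact: wB.
  by rewrite normr0.
split=> // phi hphi _ /imsetP [l _ ->].
have : \sum_j w l (enum_rank j) * phi j = 0.
  transitivity (\sum_(k < #|sols n|) U l k * \sum_j zval (enum_val k) j * phi j); last first.
    by rewrite big1 // => k _; rewrite hphi ?mulr0 // enum_valP.
  under [RHS]eq_bigr => k _ do rewrite mulr_sumr.
  rewrite exchange_big /=; apply: eq_bigr => j _; rewrite wU mxE mulr_suml.
  by apply: eq_bigr => k _; rewrite mxE enum_rankK mulrA.
move=> h0; transitivity (\sum_j w l (enum_rank j) * phi j) => //.
rewrite [RHS](bigID (mem P)) /=; congr (_ + _); last by apply: eq_bigr => j _; rewrite Ke.
rewrite big_imset /=; last by move=> ? ? _ _; exact: e_inj.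
rewrite (bigD1 l) //= enum_valK ws eqxx big1 ?addr0 // => l' ll'.
by rewrite enum_valK ws eq_sym (negPf ll') mul0r.
Qed.

Section Pivots.
Variables (n : {ffun J -> 'I_N}) (P : {set J}) (D : int) (K : J -> J -> int).
Hypothesis nv : inj_sides n.
Hypothesis pv : pivots n P D K.

Lemma pivot_nu i : i \in P -> D * nu n i + \sum_(j | j \notin P) K i j * nu n j = 0.
Proof.
case: pv => _ _ _ _ [_ h] iP; apply: h iP => z; by rewrite inE => /and3P [/eqP].
Qed.

Lemma pivot_side b i : i \in P ->
  D * (side i == b)%:R + \sum_(j | j \notin P) K i j * (side j == b)%:R = 0.
Proof.
case: pv => _ _ _ _ [_ h] iP; apply: (h (fun j => (side j == b)%:R)) iP => z.
rewrite inE => /and3P [_ /eqP h1 /eqP h2].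
transitivity (\sum_(j | side j == b) zval z j).
  rewrite [RHS]big_mkcond; apply: eq_bigr => j _.
  by case: eqP => _; rewrite ?mulr1 ?mulr0.
by case: b; [rewrite -[RHS]h1|rewrite -[RHS]h2]; apply: eq_bigl => j; case: (side j).
Qed.

(** With a single nonzero [K i j1], testing on the sides puts [j1] on the side of [i] and forces
    [K i j1 = - D]; then [nu n i = nu n j1], against distinctness within a side. Two nonzero
    coefficients provide the three-variable equation needed for Jarnik's bound. *)
Lemma two_nonzero i : i \in P -> exists j1 j2,
  [/\ j1 \notin P, j2 \notin P, j1 != j2, K i j1 != 0 & K i j2 != 0].
Proof.
move=> iP; have [_ D0 _ _ _] := pv.
have nu0 j : nu n j != 0.
  by rewrite /nu mulf_neq0 ?expf_neq0 // /sgn_side; case: (side j).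
have [j1 j1P] : exists j1, (j1 \notin P) && (K i j1 != 0).
  case: (boolP [exists j1, (j1 \notin P) && (K i j1 != 0)]) => [/existsP //|].
  rewrite negb_exists => /forallP h.
  have := pivot_nu iP; rewrite big1 ?addr0 => [/eqP|j jP].
    by rewrite mulf_eq0 (negPf D0) (negPf (nu0 i)).
  by have := h j; rewrite jP /= negbK => /eqP ->; rewrite mul0r.
case/andP: j1P => j1P K1.
suff [j2 /and3P [j2P j12 K2]] : exists j2, [&& j2 \notin P, j1 != j2 & K i j2 != 0].
  by exists j1, j2.
case: (boolP [exists j2, [&& j2 \notin P, j1 != j2 & K i j2 != 0]]) => [/existsP //|].
rewrite negb_exists => /forallP h; exfalso.
have one (phi : J -> int) : \sum_(j | j \notin P) K i j * phi j = K i j1 * phi j1.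
  rewrite (bigD1 j1) //= big1 ?addr0 // => j /andP [jP jj1].
  by have := h j; rewrite jP eq_sym jj1 /= negbK => /eqP ->; rewrite mul0r.
have e1 := pivot_nu iP; rewrite one in e1.
have e2 := pivot_side (side i) iP; rewrite one eqxx mulr1 in e2.
have ss : side j1 = side i.
  by apply/eqP; apply: contraNT D0 => /negPf s; rewrite s mulr0 addr0 in e2; rewrite e2.
rewrite ss eqxx mulr1 in e2.
have KD : K i j1 = - D by lra.
have : nu n i = nu n j1 by apply: (mulfI D0); rewrite KD in e1; lra.
rewrite /nu /sgn_side ss => /mulfI; case: (side i) => /(_ isT) /eqP; rewrite eqrXn2 // => /eqP [] /val_inj e.
all: move/forallP: nv => /(_ i) /forallP /(_ j1); rewrite ss e !eqxx /= => /eqP ij.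
all: by move: j1P; rewrite -ij iP.
Qed.
End Pivots.
End Structure.

Lemma card_family_prod (aT rT : finType) (F : aT -> {pred rT}) :
  #|family F| = (\prod_x #|F x|)%N.
Proof. by rewrite card_family foldrE big_map big_enum. Qed.

Lemma fiber_count (A B : finType) (T : {set A}) (g : A -> B) (c : nat) :
  (forall b, #|[set a in T | g a == b]| <= c)%N -> (#|T| <= #|g @: T| * c)%N.
Proof.
move=> h; rewrite -sum1_card (partition_big g [in g @: T]) /=; last first.
  by move=> a aT; apply: imset_f.
rewrite -sum_nat_const; apply: leq_sum => b _.
by rewrite sum1dep_card; apply: leq_trans (h b).
Qed.

Definition restr (J : finType) (T : Type) (x0 : T) (B : {set J}) (n : {ffun J -> T}) :=
  [ffun j => if j \in B then n j else x0].

Lemma card_restr (J T : finType) (x0 : T) (B : {set J}) (S : {set {ffun J -> T}}) :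
  (#|restr x0 B @: S| <= #|T| ^ #|B|)%N.
Proof.
rewrite -(card_pffun_on x0 (mem B) (mem T)); apply: subset_leq_card.
apply/subsetP => _ /imsetP [n _ ->]; apply/pffun_onP; split=> //.
by apply/subsetP => j; rewrite inE ffunE; case: ifP => //; rewrite eqxx.
Qed.

(** The set allowed to a coordinate in [Q] depends only on the coordinates off [P], so it is
    constant on each fibre of the restriction to the complement of [Q]. *)
Lemma fiber_family (J T : finType) (x0 : T) (P Q : {set J}) (S : {set {ffun J -> T}})
   (Sel : {ffun J -> T} -> {set T}) (s : nat) :
  (forall n n' : {ffun J -> T}, (forall j, j \notin P -> n j = n' j) -> Sel n = Sel n') ->
  Q \subset P ->
  (forall (n : {ffun J -> T}) i, n \in S -> i \in Q -> n i \in Sel n) -> (forall n, #|Sel n| <= s)%N ->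
  (#|S| <= #|restr x0 (~: Q) @: S| * s ^ #|Q|)%N.
Proof.
move=> SelE QP hS hs; apply: fiber_count => b.
have [n0 n0S|none] := pickP [pred n in S | restr x0 (~: Q) n == b]; last first.
  rewrite (_ : [set _ in _ | _] = set0) ?cards0 //.
  by apply/setP => n; rewrite !inE; apply: none.
case/andP: n0S => n0S /eqP n0b.
pose F j : {pred T} := [pred x | if j \in Q then x \in Sel n0 else x == b j].
have sub : [set n in S | restr x0 (~: Q) n == b] \subset family F.
  apply/subsetP => n; rewrite inE => /andP [nS /eqP nb].
  have bj j : j \notin Q -> n j = b j by move=> jQ; rewrite -nb ffunE inE jQ.
  have bj0 j : j \notin Q -> n0 j = b j by move=> jQ; rewrite -n0b ffunE inE jQ.
  apply/familyP => j; rewrite inE; case: ifP => jQ; last by rewrite bj ?jQ.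
  rewrite (SelE n0 n) ?hS // => j' jP.
  have jQ' : j' \notin Q by apply: contra jP; apply: (subsetP QP).
  by rewrite bj // bj0.
apply: (leq_trans (subset_leq_card sub)); rewrite card_family_prod.
rewrite (bigID (mem Q)) /= [X in (_ * X)%N]big1 ?muln1; last first.
  by move=> j jQ; rewrite -(card1 (b j)); apply: eq_card => x; rewrite !inE (negPf jQ).
rewrite -prod_nat_const; apply: leq_prod => j jQ; apply: leq_trans (hs n0).
by apply: subset_leq_card; apply/subsetP => x; rewrite inE jQ.
Qed.

Lemma jarnik_rat d (a b C : rat) L N : N = (L ^ 3)%N -> (1 < d)%N ->
  a != 0 -> b != 0 -> C != 0 -> (0 < L)%N ->
  (#|[set v : 'I_N * 'I_N | (a * (v.1.+1)%:R ^+ d + b * (v.2.+1)%:R ^+ d == C)%R]| <= 6 * L ^ 2)%N.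
Proof.
move=> NL d2 an bn Cn L0.
pose D : int := denq a * denq b * denq C.
pose a' := numq a * (denq b * denq C); pose b' := numq b * (denq a * denq C).
pose C' := numq C * (denq a * denq b).
have Dn : D%:~R != 0 :> rat by rewrite intr_eq0 !mulf_neq0 ?denq_eq0.
have aE : a'%:~R = D%:~R * a.
  by rewrite -[in RHS](divq_num_den a) /a' /D !rmorphM /=; field; rewrite intr_eq0 denq_eq0.
have bE : b'%:~R = D%:~R * b.
  by rewrite -[in RHS](divq_num_den b) /b' /D !rmorphM /=; field; rewrite intr_eq0 denq_eq0.
have CE : C'%:~R = D%:~R * C.
  by rewrite -[in RHS](divq_num_den C) /C' /D !rmorphM /=; field; rewrite intr_eq0 denq_eq0.
clearbody a' b' C' D.
have nz (u : int) (v : rat) : u%:~R = D%:~R * v -> v != 0 -> u != 0.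
  by move=> e vn; rewrite -(intr_eq0 rat) e mulf_neq0.
have an' := nz _ _ aE an; have bn' := nz _ _ bE bn; have Cn' := nz _ _ CE Cn.
apply: leq_trans (jarnik NL d2 an' bn' Cn' L0); apply: subset_leq_card.
apply/subsetP => v; rewrite !inE => /eqP e.
rewrite -(eqr_int rat) rmorphD !rmorphM !rmorphXn /= aE bE CE -e.
by rewrite mulrDr !mulrA.
Qed.

(** Fixing the third variable leaves a curve as in [jarnik_rat], unless the remaining constant [h]
    is 0. That happens for at most one value of the third variable, and then the first determines
    the second. *)
Lemma triple_count d (a b c e : rat) L N : N = (L ^ 3)%N -> (1 < d)%N ->
  a != 0 -> b != 0 -> c != 0 -> (0 < L)%N ->
  (#|[set v : 'I_N * 'I_N * 'I_N | (a * (v.1.1.+1)%:R ^+ d + b * (v.1.2.+1)%:R ^+ d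
       + c * (v.2.+1)%:R ^+ d == e)%R]| <= 7 * (N * L ^ 2))%N.
Proof.
move=> NL d2 an bn cn L0; set T := [set _ | _].
have d0 : (0 < d)%N by exact: ltnW.
pose h (y : 'I_N) := e - c * (y.+1)%:R ^+ d.
pose T0 := [set v in T | h v.2 == 0]; pose T1 := [set v in T | h v.2 != 0].
have inj (u : rat) (y y' : 'I_N) : u != 0 -> u * (y.+1)%:R ^+ d = u * (y'.+1)%:R ^+ d -> y = y'.
  move=> un /(mulfI un) /eqP; rewrite eqrXn2 ?ler0n // eqr_nat eqSS => /eqP; exact: val_inj.
have c0 : (#|T0| <= N)%N.
  pose g (v : 'I_N * 'I_N * 'I_N) := v.1.1.
  rewrite -[X in (_ <= X)%N]card_ord; apply: (@leq_card_in _ _ g) => -[[x y] z] [[x' y'] z'].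
  rewrite !inE /= /g /= => /andP [/eqP e1 /eqP h1] /andP [/eqP e2 /eqP h2] xx.
  have zz : z = z' by apply: (inj c) => //; move: h1 h2; rewrite /h /=; lra.
  rewrite xx zz in e1 *; congr (_, _, _); apply: (inj b) => //; lra.
have c1 : (#|T1| <= N * (6 * L ^ 2))%N.
  apply: (@leq_trans (#|[set v.2 | v in T1]| * (6 * L ^ 2))%N); last first.
    by rewrite leq_mul2r (leq_trans (max_card _)) ?card_ord ?orbT.
  apply: fiber_count => y.
  have [hy|hy] := eqVneq (h y) 0.
    rewrite (_ : [set _ in _ | _] = set0) ?cards0 //; apply/setP => v; rewrite !inE.
    by have [->|] := eqVneq v.2 y; rewrite ?andbF // hy eqxx !andbF.
  apply: leq_trans (jarnik_rat NL d2 an bn hy L0).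
  rewrite -(@card_in_imset _ _ fst); last first.
    move=> [v y1] [v' y2]; rewrite !inE /= => /andP [_ /eqP ->] /andP [_ /eqP ->] ->.
    by [].
  apply: subset_leq_card; apply/subsetP => _ /imsetP [v vT ->]; move: vT.
  rewrite !inE => /andP [/andP [/eqP e1 _] /eqP <-]; apply/eqP; rewrite /h; lra.
have -> : #|T| = (#|T0| + #|T1|)%N.
  rewrite -(cardsID [set v | h v.2 == 0]); congr (_ + _)%N; apply: eq_card => v; rewrite !inE //.
  by rewrite andbC.
apply: (leq_trans (leq_add c0 c1)).
by have : (1 <= L ^ 2)%N; [rewrite expn_gt0 L0|clear; nia].
Qed.

Lemma same_cell_lt (G m n : nat) : (0 < G)%N -> (m %/ G = n %/ G)%N -> `|m%:Z - n%:Z| < G%:Z.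
Proof.
move=> G0 e; rewrite (divn_eq m G) (divn_eq n G) e.
by have := ltn_pmod m G0; have := ltn_pmod n G0; move: (_ * G)%N => u; lia.
Qed.

Section Counting.
Variables (J : finType) (side : pred J) (N W d : nat).
Hypothesis d2 : (1 < d)%N.
Implicit Types (n : {ffun J -> 'I_N}) (z : {ffun J -> 'I_(2 * W).+1}).
Notation sols n := (sols side W d n).
Notation nu := (nu side d).
Notation pivots := (pivots side W d).

Section SolCount.
Variables (n : {ffun J -> 'I_N}) (P : {set J}) (D : int) (K : J -> J -> int).
Hypothesis pv : pivots n P D K.

Lemma sols_eq z z' : z \in sols n -> z' \in sols n -> (forall i, i \in P -> z i = z' i) -> z = z'.
Proof.
case: pv => _ D0 _ _ [h _] zs zs' e; apply/ffunP => j.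
have [jP|jP] := boolP (j \in P); first exact: e.
have : D * zval z j = D * zval z' j.
  by rewrite !h //; apply: eq_bigr => i iP; rewrite /zval e.
by move/(mulfI D0); rewrite /zval => /addIr [] /val_inj.
Qed.

Lemma card_sols : (#|sols n| <= (2 * W).+1 ^ #|P|)%N.
Proof.
rewrite -(@card_in_imset _ _ (restr ord0 P)); last first.
  move=> z z' zs zs' /ffunP e; apply: sols_eq => // i iP.
  by have := e i; rewrite !ffunE iP.
by apply: (leq_trans (card_restr _ _ _)); rewrite card_ord.
Qed.

(** For two solutions agreeing on the other pivots, [denq q] times the difference at [j] is [numq q]
    times the difference at [i0]. A large denominator divides the latter difference, a large
    numerator the former. So fixing one of the two coordinates up to a cell of length [G] fixes the
    solution, and a factor [G] is saved. *)
Lemma card_sols_sparse i0 j (G : nat) (q := (K i0 j)%:~R / D%:~R : rat) : (0 < G)%N ->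
  i0 \in P -> j \notin P -> (G%:Z < denq q) || (G%:Z < `|numq q|) ->
  (#|sols n| <= (2 * W).+1 ^ #|P|.-1 * ((2 * W) %/ G).+1)%N.
Proof.
move=> G0 iP jP qG; have [_ D0 _ _ [h _]] := pv.
pose c z := if (G%:Z < denq q) then z i0 else z j.
pose phi z := (restr ord0 (P :\ i0) z, inord (c z %/ G) : 'I_((2 * W) %/ G).+1).
have phi_inj : {in sols n &, injective phi}.
  move=> z z' zs zs' [] /ffunP e.
  have e' i : i \in P -> i != i0 -> z i = z' i.
    by move=> iP' ii0; have := e i; rewrite !ffunE !inE ii0 iP'.
  have clt y : (c y %/ G < ((2 * W) %/ G).+1)%N by rewrite ltnS leq_div2r // -ltnS.
  move=> /(congr1 val) /=; rewrite !inordK // => /(same_cell_lt G0) cc.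
  apply: sols_eq => // i iP'; have [->|] := eqVneq i i0; last exact: e'.
  apply: val_inj; apply/eqP; rewrite -eqz_nat -subr_eq0; apply/negPn/negP => Dz.
  have key : denq q * (zval z j - zval z' j) = numq q * ((z i0)%:Z - (z' i0)%:Z).
    have : D * (zval z j - zval z' j) = K i0 j * ((z i0)%:Z - (z' i0)%:Z).
      rewrite mulrBr !h // (bigD1 i0) //= [in X in _ - X](bigD1 i0) //=.
      rewrite [X in _ + X - _](eq_bigr (fun i => K i j * zval z' i)); last first.
        by move=> k /andP [kP ki]; rewrite /zval e'.
      by rewrite /zval; ring.
    move=> /(congr1 (intr : int -> rat)); rewrite !rmorphM /= => kk.
    apply/eqP; rewrite -(eqr_int rat) !rmorphM /=; apply/eqP.
    have -> : (numq q)%:~R = q * (denq q)%:~R by rewrite numqE.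
    rewrite mulrAC; apply: (mulfI (_ : D%:~R != 0)); first by rewrite intr_eq0.
    by rewrite mulrCA kk /q; field; rewrite intr_eq0.
  have dz : zval z j - zval z' j = (z j)%:Z - (z' j)%:Z by rewrite /zval; ring.
  have cop : coprimez (denq q) (numq q) by rewrite coprimezE coprime_sym coprime_num_den.
  rewrite dz in key; case: (ltP G%:Z (denq q)) => dG; rewrite /c in cc.
    rewrite dG in cc; have d1 : (z i0)%:Z - (z' i0)%:Z \in dvdz `|denq q|%N.
      by rewrite gez0_abs ?denq_ge0 // -(Gauss_dvdzr _ cop) -key dvdz_mulr.
    case/negP: Dz; apply/eqP; apply: (dvdz_small d1).
    by rewrite gez0_abs ?denq_ge0 //; apply: lt_trans cc dG.
  have dGf : (G%:Z < denq q) = false by rewrite ltNge dG.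
  rewrite dGf /= in cc qG.
  have d1 : (z j)%:Z - (z' j)%:Z \in dvdz `|numq q|%N.
    by rewrite abszE dvdzE absz_id -dvdzE -(Gauss_dvdzr _ (_ : coprimez _ (denq q))) 1?coprimez_sym // key dvdz_mulr.
  have z0 : (z j)%:Z - (z' j)%:Z = 0 by apply: (dvdz_small d1); rewrite abszE; apply: lt_trans cc qG.
  move: key; rewrite z0 mulr0 => /esym /eqP; rewrite mulf_eq0 (negPf Dz) orbF => /eqP n0.
  by move: qG; rewrite n0 normr0 ltz_nat ltn0.
rewrite -(card_in_imset phi_inj).
apply: (@leq_trans #|setX (restr ord0 (P :\ i0) @: sols n) [set: 'I_((2 * W) %/ G).+1]|).
  apply: subset_leq_card; apply/subsetP => _ /imsetP [z zs ->]; rewrite !inE andbT.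
  exact: imset_f.
rewrite cardsX cardsT card_ord leq_mul2r; apply/orP; right.
apply: (leq_trans (card_restr _ _ _)); rewrite card_ord.
by rewrite (cardsD1 i0 P) iP.
Qed.
End SolCount.
End Counting.

Section Counting.
Variables (J : finType) (side : pred J) (N d : nat).
Hypothesis d2 : (1 < d)%N.
Implicit Types (n : {ffun J -> 'I_N}).
Notation nu := (nu side d).

Definition dep_rel (H : nat) (P : {set J}) n (x : 'I_N) : Prop :=
  exists (c0 : int) (c : J -> int), [/\ c0 != 0, `|c0| <= H%:Z, forall j, `|c j| <= H%:Z &
    c0 * (x.+1)%:Z ^+ d = \sum_(j | j \notin P) c j * nu n j].

Definition dep_set H P n : {set 'I_N} := [set x | `[< dep_rel H P n x >]].

Lemma dep_set_ext H (P : {set J}) n n' : (forall j, j \notin P -> n j = n' j) -> dep_set H P n = dep_set H P n'.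
Proof.
move=> e; apply/setP => x; rewrite !inE; apply: asbool_equiv_eq; rewrite /dep_rel.
have sE (c : J -> int) : \sum_(j | j \notin P) c j * nu n j = \sum_(j | j \notin P) c j * nu n' j.
  by apply: eq_bigr => j jP; rewrite /nu e.
by split=> -[c0 [c [h1 h2 h3 h4]]]; exists c0, c; split=> //; rewrite h4 sE.
Qed.

Lemma dep_set_pivot W H n P D K : pivots side W d n P D K -> (#|P|`! * W ^ #|P| <= H)%N ->
  forall i, i \in P -> n i \in dep_set H P n.
Proof.
move=> pv WH i iP; have [_ D0 DH KH _] := pv.
have le (u : int) : `|u| <= (#|P|`! * W ^ #|P|)%N%:Z -> `|u| <= H%:Z.
  by move/le_trans; apply; rewrite lez_nat.
rewrite inE; apply/asboolP; exists (D * sgn_side side i), (fun j => - K i j); split.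
- by rewrite mulf_neq0 // /sgn_side; case: (side i).
- by rewrite normrM /sgn_side; case: (side i); rewrite ?normrN normr1 mulr1 le.
- by move=> j; rewrite normrN le.
have := pivot_nu pv iP; rewrite {1}/nu mulrA => e.
rewrite (eq_bigr (fun j => - (K i j * nu n j))) ?sumrN => [|j _]; last by rewrite mulNr.
by apply/eqP; rewrite -addr_eq0 e.
Qed.

Lemma card_dep_set H (P : {set J}) n (s : nat) :
  (forall (Y : 'I_#|~: P| -> int) (S : seq nat), uniq S ->
   (forall x, x \in S -> (x <= N)%N /\ exists (c0 : int) (c : 'I_#|~: P| -> int),
     [/\ c0 != 0, `|c0| <= H%:Z, forall i, `|c i| <= H%:Z &
         c0 * x%:Z ^+ d = \sum_i Y i * c i]) -> (size S <= s)%N) ->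
  (#|dep_set H P n| <= s)%N.
Proof.
move=> hS.
have := hS (fun i => nu n (enum_val i)) [seq (nat_of_ord x).+1 | x <- enum (dep_set H P n)].
rewrite size_map -cardE; apply.
  by rewrite map_inj_uniq ?enum_uniq // => x y [] /val_inj.
move=> _ /mapP [x + ->]; rewrite mem_enum inE => /asboolP [c0 [c [h1 h2 h3 h4]]].
split=> //; exists c0, (fun i => c (enum_val i)); split=> //; rewrite h4.
rewrite (eq_bigl (mem (~: P))) => [|j]; last by rewrite !inE.
by rewrite big_enum_val; apply: eq_bigr => i _; rewrite mulrC.
Qed.

Section TypeCount.
Variables (H : nat) (P : {set J}) (s : nat).
Hypothesis hs : forall n, (#|dep_set H P n| <= s)%N.
Hypothesis N0 : (0 < N)%N.

(* Every pivot of [n] is confined to a sparse set determined by the other coordinates. *)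
Definition typeA : {set {ffun J -> 'I_N}} := [set n : {ffun J -> 'I_N} | [forall i in P, n i \in dep_set H P n]].

Lemma card_typeA : (#|typeA| <= N ^ #|~: P| * s ^ #|P|)%N.
Proof.
have h := @fiber_family _ _ (Ordinal N0) P P typeA (dep_set H P) s (dep_set_ext H (P := P)) (subxx _).
apply: leq_trans (h _ hs) _.
  by move=> n i; rewrite inE => /forall_inP h'; exact: h'.
rewrite leq_mul2r (leq_trans (card_restr _ _ _)) ?card_ord ?orbT //.
Qed.

Definition typeB i0 (q : J -> rat) : {set {ffun J -> 'I_N}} :=
  [set n : {ffun J -> 'I_N} in typeA | ((nu n i0)%:~R + \sum_(j | j \notin P) q j * (nu n j)%:~R == 0)%R].

(** The coordinates [i0], [j1], [j2] are counted together: [N * L ^ 2] triples replace the [N ^ 2]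
    choices for the two non-pivots, a saving of [L], and [i0] costs no factor [s]. *)
Lemma card_typeB L i0 (q : J -> rat) j1 j2 : N = (L ^ 3)%N -> (0 < L)%N -> i0 \in P ->
  j1 \notin P -> j2 \notin P -> j1 != j2 -> q j1 != 0 -> q j2 != 0 ->
  (#|typeB i0 q| <= N ^ (#|~: P| - 2) * (7 * (N * L ^ 2)) * s ^ #|P|.-1)%N.
Proof.
move=> NL L0 iP j1P j2P j12 q1 q2.
have h := @fiber_family _ _ (Ordinal N0) P (P :\ i0) (typeB i0 q) (dep_set H P) s
  (dep_set_ext H (P := P)) (subD1set _ _).
apply: leq_trans (h _ hs) _.
  move=> n i; rewrite inE => /andP [nA _] iP'; move: nA; rewrite inE => /forall_inP; apply.
  by move: iP'; rewrite inE => /andP [].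
have -> : #|P :\ i0| = #|P|.-1 by rewrite (cardsD1 i0 P) iP.
rewrite leq_mul2r; apply/orP; right.
set x0 := Ordinal N0; set T := restr _ _ @: _.
pose B := ~: P :\ j1 :\ j2.
have cB : #|B| = (#|~: P| - 2)%N.
  rewrite (cardsD1 j1 (~: P)) (cardsD1 j2 (~: P :\ j1)) !inE j1P j2P eq_sym j12 /=.
  by rewrite addnA addKn.
have TE n : n \in T -> (nu n i0)%:~R + \sum_(j | j \notin P) q j * (nu n j)%:~R = 0 :> rat.
  case/imsetP => n'; rewrite inE => /andP [_ /eqP e] ->; apply: etrans e; congr (_ + _).
    by congr (_%:~R); rewrite /nu ffunE !inE eqxx.
  by apply: eq_bigr => j jP; rewrite /nu ffunE !inE (negPf jP) andbF.
apply: leq_trans (fiber_count (T := T) (g := restr x0 B) (c := 7 * (N * L ^ 2)) _) _; last first.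
  by rewrite leq_mul2r (leq_trans (card_restr _ _ _)) ?card_ord ?cB ?orbT.
move=> b.
pose sg j : rat := (sgn_side side j)%:~R.
have sg0 j : sg j != 0 by rewrite /sg intr_eq0 /sgn_side; case: (side j).
pose e : rat := - \sum_(j in B) q j * (sg j * (b j).+1%:R ^+ d).
apply: leq_trans (triple_count (a := sg i0) (b := q j1 * sg j1) (c := q j2 * sg j2) e NL d2 _ _ _ L0);
  rewrite ?mulf_neq0 //.
rewrite -(@card_in_imset _ _ (fun n : {ffun J -> 'I_N} => (n i0, n j1, n j2))); last first.
  move=> n n'; rewrite !inE => /andP [nT /eqP nb] /andP [nT' /eqP nb'] [e1 e2 e3].
  apply/ffunP => j; have [->|ji0] := eqVneq j i0; first exact: e1.
  have [->|jj1] := eqVneq j j1; first exact: e2.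
  have [->|jj2] := eqVneq j j2; first exact: e3.
  have [jP|jP] := boolP (j \in P).
    by case/imsetP: nT => u _ ->; case/imsetP: nT' => u' _ ->; rewrite !ffunE !inE ji0 jP.
  have jB : j \in B by rewrite !inE jj1 jj2 jP.
  have := congr1 (fun f : {ffun _} => f j) nb; rewrite -nb' !ffunE jB.
  by [].
apply: subset_leq_card; apply/subsetP => _ /imsetP [n + ->]; rewrite !inE => /andP [nT /eqP nb].
apply/eqP; have := TE n nT; rewrite (bigD1 j1) //= (bigD1 j2) /=; last by rewrite j2P eq_sym.
rewrite (eq_bigl (fun j => j \in B)) => [|j]; last by rewrite !inE; case: (j \in P); rewrite ?andbF // andbT andbC.
have nuE j : (nu n j)%:~R = sg j * (n j).+1%:R ^+ d :> rat.
  by rewrite /nu rmorphM rmorphXn.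
rewrite (eq_bigr (fun j => q j * (sg j * (b j).+1%:R ^+ d))) => [|j jB]; last first.
  by rewrite nuE -nb ffunE jB.
rewrite !nuE /e => E.
apply/eqP; rewrite eq_sym eqr_oppLR; apply/eqP.
move: E; set S := \sum_(_ in _) _ => E; lra.
Qed.
End TypeCount.
End Counting.

Section PerPoint.
Variables (J : finType) (side : pred J) (N W d G H : nat).
Hypothesis d2 : (1 < d)%N.
Hypothesis G0 : (0 < G)%N.
Implicit Types (n : {ffun J -> 'I_N}).

Definition nzsols n := [set z in sols side W d n | [exists j, zval z j != 0]].

(** Numerators are stored shifted by [G]. Below, [ratfun] pins the entries on [P] to a default, so
    that only choices at the non-pivots are counted. *)
Definition ratix := ('I_(2 * G).+1 * 'I_G.+1)%type.
Definition ratval (q : {ffun J -> ratix}) j : rat := ((q j).1%:R - G%:R) / (q j).2%:R.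
Definition ratfun (P : {set J}) : {set {ffun J -> ratix}} :=
  restr ((ord0, ord0) : ratix) (~: P) @: setT.
Definition two_nz (P : {set J}) (q : J -> rat) :=
  [exists j1, exists j2, [&& j1 \notin P, j2 \notin P, j1 != j2, q j1 != 0 & q j2 != 0]].

(* Either some dependence coefficient [K i0 j / D] has height above [G], which thins out the [z], or
   all of them lie in the finite set [ratfun P] and [n] satisfies the equation defining [typeB]. *)
Lemma nzsols_le n : inj_sides side n -> (forall P : {set J}, #|P|`! * W ^ #|P| <= H)%N ->
  (#|nzsols n| <= \sum_(P : {set J} | P != set0)
    ((n \in typeA side N d H P) * ((2 * W).+1 ^ #|P|.-1 * ((2 * W) %/ G).+1)
     + \sum_(i0 in P) \sum_(q in ratfun P | two_nz P (ratval q))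
         (n \in typeB side N d H P i0 (ratval q)) * (2 * W).+1 ^ #|P|))%N.
Proof.
move=> nv HP.
have [->|[z]] := set_0Vmem (nzsols n); first by rewrite cards0.
rewrite inE => /andP [zs /existsP [j0 zj]].
have [P [D [K pv]]] := pivots_exist (ltnW d2) zs zj.
have [Pn D0 _ _ _] := pv.
rewrite (bigD1 P) //=; apply: leq_trans (leq_addr _ _).
have sub : (#|nzsols n| <= #|sols side W d n|)%N.
  by apply: subset_leq_card; apply/subsetP => u; rewrite inE => /andP [].
apply: (leq_trans sub).
have nA : n \in typeA side N d H P.
  by rewrite inE; apply/forall_inP => i; apply: (dep_set_pivot pv (HP P)).
have [i0 iP] := set0Pn _ Pn.
pose q j : rat := (K i0 j)%:~R / D%:~R.
case: (boolP [exists j, (j \notin P) && ((G%:Z < denq (q j)) || (G%:Z < `|numq (q j)|))]).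
  case/existsP=> j /andP [jP big].
  by apply: leq_trans (leq_addr _ _); rewrite nA mul1n (card_sols_sparse pv G0 iP jP big).
rewrite negb_exists => /forallP sm.
have smd j : j \notin P -> (denq (q j) <= G%:Z) /\ `|numq (q j)| <= G%:Z.
  by move=> jP; have := sm j; rewrite jP negb_or -!leNgt => /andP [].
apply: leq_trans (leq_addl _ _).
pose r0 : {ffun J -> ratix} := [ffun j => (inord (absz (numq (q j) + G%:Z)), inord (absz (denq (q j))))].
pose r := restr ((ord0, ord0) : ratix) (~: P) r0.
have rP : r \in ratfun P by apply: imset_f; rewrite inE.
have rq j : j \notin P -> ratval r j = q j.
  move=> jP; have [s1 s2] := smd j jP; rewrite /ratval /r !ffunE inE jP /=.
  have dp : 0 < denq (q j) by exact: denq_gt0.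
  rewrite !inordK; [|by lia..].
  have -> : (absz (numq (q j) + G%:Z))%:R - G%:R = (numq (q j))%:~R :> rat.
    have -> : (absz (numq (q j) + G%:Z))%:R = (numq (q j) + G%:Z)%:~R :> rat.
      by rewrite -[in RHS](@gez0_abs (numq (q j) + G%:Z)) //; lia.
    by rewrite rmorphD /= addrK.
  have -> : (absz (denq (q j)))%:R = (denq (q j))%:~R :> rat.
    by rewrite -[in RHS](@gez0_abs (denq (q j))) // ltW.
  exact: divq_num_den.
have r2 : two_nz P (ratval r).
  have [j1 [j2 [j1P j2P j12 K1 K2]]] := two_nonzero (ltnW d2) nv pv iP.
  apply/existsP; exists j1; apply/existsP; exists j2; rewrite j1P j2P j12 !rq //.
  by rewrite /q !mulf_neq0 ?invr_eq0 ?intr_eq0.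
rewrite (bigD1 i0) //=; apply: leq_trans (leq_addr _ _).
rewrite (bigD1 r) /=; last by rewrite rP.
apply: leq_trans (leq_addr _ _).
suff -> : n \in typeB side N d H P i0 (ratval r) by rewrite mul1n (card_sols pv).
rewrite inE nA /=; apply/eqP.
have := congr1 (intr : int -> rat) (pivot_nu pv iP).
rewrite rmorphD rmorphM rmorph_sum /= => e.
apply: (mulfI (_ : D%:~R != 0)); first by rewrite intr_eq0.
rewrite mulr0 mulrDr -[RHS]e; congr (_ + _); rewrite mulr_sumr; apply: eq_bigr => j jP.
by rewrite rq // /q [RHS]rmorphM /=; move: (nu side d n j) => v; field; rewrite intr_eq0.
Qed.
End PerPoint.

Local Close Scope ring_scope.

(** * Numerical estimates and the choice of parameters *)

Section Numeric.
Variables (j rho k M N L W G s C2 w0 g t : nat).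
Hypothesis M0 : 0 < M.
Hypothesis C20 : 0 < C2.
Hypothesis w00 : 0 < w0.
Hypothesis rk : rho + k = j.
Hypothesis rho0 : 0 < rho.
Hypothesis NL : N = L ^ 3.
Hypothesis WN : W = w0 * N.
Hypothesis GM : G = M ^ g.
Hypothesis sM : s = C2 * M ^ (2 * t).
Hypothesis gE : 2 + 2 * t * j <= g.
Hypothesis GN : G <= N.
Hypothesis ML : M ^ (2 + 2 * g * j + 2 * t * j) <= L.

Let G0 : 0 < G. Proof. by rewrite GM expn_gt0 M0. Qed.
Let N0 : 0 < N. Proof. exact: leq_trans GN. Qed.
Let W0 : 0 < W. Proof. by rewrite WN muln_gt0 w00. Qed.
Let W3 : (2 * W).+1 <= 3 * W. Proof. by move: W0; clear; lia. Qed.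
Let rj : rho <= j. Proof. by rewrite -rk leq_addr. Qed.
Let kj : k <= j. Proof. by rewrite -rk leq_addl. Qed.

Let sX e : e <= j -> s ^ e <= C2 ^ j * M ^ (2 * t * j).
Proof.
move=> ej; rewrite sM expnMn -expnM; apply: leq_mul; first exact: leq_pexp2l.
by rewrite leq_pexp2l // leq_mul2l ej orbT.
Qed.

Let WX : (3 * W) ^ rho <= (3 * w0) ^ j * N ^ rho.
Proof. by rewrite WN mulnA expnMn leq_mul2r leq_pexp2l ?orbT // muln_gt0. Qed.

(** The factor [G = M ^ g] saved in the count of [z] pays for the sparse pivots [s ^ rho] and leaves
    [M ^ 2]; this dictates [g]. *)
Lemma termA_le : M ^ 2 * (N ^ k * s ^ rho * ((2 * W).+1 ^ rho.-1 * ((2 * W) %/ G).+1))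
  <= (C2 * (3 * w0)) ^ j * N ^ j.
Proof.
have h1 : M ^ 2 * s ^ rho <= C2 ^ j * G.
  apply: (@leq_trans (M ^ 2 * (C2 ^ j * M ^ (2 * t * j)))).
    by rewrite leq_mul2l sX ?orbT.
  by rewrite mulnCA leq_mul2l -expnD GM leq_pexp2l ?orbT.
have h2 : G * ((2 * W) %/ G).+1 <= 3 * W.
  have := leq_trunc_div (2 * W) G; have : N <= W by rewrite WN leq_pmull.
  rewrite mulnS mulnC => a b; rewrite (_ : 3 * W = W + 2 * W); last by rewrite -mulSn.
  by apply: leq_add => //; apply: leq_trans a.
have h3 : (2 * W).+1 ^ rho.-1 <= (3 * W) ^ rho.-1 by exact: leq_expl.
apply: (@leq_trans (N ^ k * (C2 ^ j * ((3 * W) ^ rho.-1 * (3 * W))))).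
  rewrite -mulnA mulnCA leq_mul2l; apply/orP; right.
  rewrite mulnA; apply: (leq_trans (leq_mul h1 (leqnn _))).
  rewrite -mulnA leq_mul2l; apply/orP; right.
  by rewrite mulnCA; apply: leq_mul.
rewrite -expnSr prednK // mulnCA [X in _ <= X * _]expnMn -mulnA leq_mul2l; apply/orP; right.
apply: (leq_trans (leq_mul (leqnn _) WX)).
by rewrite mulnCA leq_mul2l -expnD addnC rk leqnn orbT.
Qed.

(** The factor [L] saved by Jarnik's bound pays for the choices of rational coefficients, about
    [G ^ (2 * k)], for the sparse pivots and for [M ^ 2]; this dictates the size of [L] and so of
    [A]. *)
Lemma termB_le : 2 <= k -> M ^ 2 * (rho * (((2 * G).+1 * G.+1) ^ k *
   (N ^ (k - 2) * (7 * (N * L ^ 2)) * s ^ rho.-1 * (2 * W).+1 ^ rho)))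
  <= 7 * j * 6 ^ j * (C2 * (3 * w0)) ^ j * N ^ j.
Proof.
move=> k2.
have h1 : ((2 * G).+1 * G.+1) ^ k <= 6 ^ j * M ^ (2 * g * j).
  apply: (@leq_trans ((6 * G ^ 2) ^ k)).
    apply: leq_expl; rewrite -mulnn; move: G0; clear; nia.
  rewrite expnMn GM -!expnM; apply: leq_mul; first exact: leq_pexp2l.
  by rewrite leq_pexp2l // [2 * g]mulnC -?mulnA !leq_mul2l kj !orbT.
have h2 : s ^ rho.-1 <= C2 ^ j * M ^ (2 * t * j).
  by apply: sX; apply: leq_trans rj; rewrite leq_pred.
have h3 : (2 * W).+1 ^ rho <= (3 * w0) ^ j * N ^ rho.
  by apply: leq_trans WX; exact: leq_expl.
have h4 : N ^ (k - 2) * (N * L ^ 2) * L = N ^ k.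
  rewrite -mulnA -(mulnA N) -expnSr -NL mulnn -expnD subnK //.
apply: (@leq_trans (M ^ 2 * (j * (6 ^ j * M ^ (2 * g * j) *
   (N ^ (k - 2) * (7 * (N * L ^ 2)) * (C2 ^ j * M ^ (2 * t * j)) * ((3 * w0) ^ j * N ^ rho)))))).
  by rewrite leq_mul2l; apply/orP; right; apply: leq_mul => //; apply: leq_mul => //;
    apply: leq_mul => //; apply: leq_mul.
rewrite [X in X <= _](_ : _ = 7 * j * 6 ^ j * (C2 * (3 * w0)) ^ j * (N ^ rho *
   (N ^ (k - 2) * (N * L ^ 2) * M ^ (2 + 2 * g * j + 2 * t * j)))); last first.
  move: (3 * w0) => w; rewrite !expnD expnMn.
  move: (M ^ (2 * g * j)) (M ^ (2 * t * j)) (M ^ 2) (N ^ rho) (N ^ (k - 2)) (6 ^ j) (C2 ^ j) (w ^ j) (N * L ^ 2).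
  by clear => *; ring.
rewrite leq_mul2l; apply/orP; right.
have -> : N ^ j = N ^ rho * N ^ k by rewrite -expnD rk.
by rewrite leq_mul2l -h4 leq_mul2l ML !orbT.
Qed.
End Numeric.

Lemma count_solutions (J : finType) (side : pred J) (d t mm A A' w0 : nat)
   (j := #|J|) (g := 2 + 2 * t * j) (b := 4 * A.+1) :
  1 < d -> A = 3 * A' -> 2 + 2 * g * j + 2 * t * j <= A' -> 0 < w0 ->
  4 * (A * j) * (mm * t) <= d -> 2 ^ t * ((mm * t * b).+1 ^ j * d) < mm ^ t ->
  exists C, forall M N W, 0 < M -> N = M ^ A -> W = w0 * N ->
    M ^ 2 * \sum_(n : {ffun J -> 'I_N} | inj_sides side n) #|nzsols side W d n| <= C * N ^ j.
Proof.
move=> d2 AA A'g w00 cond1 cond2.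
pose C1 := j`! * w0 ^ j.
have C10 : 0 < C1 by rewrite muln_gt0 fact_gt0 expn_gt0 w00.
have /fin_all_exists [C2f C2P] : forall k : 'I_j.+1, exists C2 : nat,
   forall (M : nat) (Y : 'I_k -> int) (S : seq nat), (0 < M)%N -> uniq S ->
   (forall x, x \in S -> (x <= M ^ A)%N /\ exists (c0 : int) (c : 'I_k -> int),
     [/\ c0 != 0, `|c0| <= (C1 * M ^ (A * j))%N%:Z,
         forall i, `|c i| <= (C1 * M ^ (A * j))%N%:Z &
         c0 * x%:Z ^+ d = \sum_i Y i * c i])%R ->
   (size S <= C2 * M ^ (2 * t))%N.
  move=> k; apply: (@sparse_powers k d A t mm C1 j (ltnW d2) C10 cond1).
  apply: leq_ltn_trans cond2; rewrite leq_mul2l leq_mul2r leq_pexp2l ?orbT //.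
  by rewrite -ltnS.
pose C2 := (\sum_k C2f k).+1.
have C20 : 0 < C2 by [].
exists (2 ^ j * ((C2 * (3 * w0)) ^ j + 7 * j * 6 ^ j * (C2 * (3 * w0)) ^ j)) => M N W M0 NE WE.
pose H := C1 * M ^ (A * j); pose s := C2 * M ^ (2 * t); pose G := M ^ g.
pose L := M ^ A'.
have NL : N = L ^ 3 by rewrite NE AA /L -expnM mulnC.
have L0 : 0 < L by rewrite expn_gt0 M0.
have N0 : 0 < N by rewrite NL expn_gt0 L0.
have G0 : 0 < G by rewrite expn_gt0 M0.
have hs (P : {set J}) (n : {ffun J -> 'I_N}) : #|dep_set side d H P n| <= s.
  apply: card_dep_set => Y S uS hS.
  have kj : #|~: P| < j.+1 by rewrite ltnS max_card.
  apply: leq_trans (C2P (Ordinal kj) M Y S M0 uS _) _; first by rewrite -NE.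
  by rewrite leq_mul2r /C2 (bigD1 (Ordinal kj)) //= ltnW ?orbT // ltnS leq_addr.
have HP (P : {set J}) : #|P|`! * W ^ #|P| <= H.
  have Pj : #|P| <= j by exact: max_card.
  rewrite /H /C1 -mulnA; apply: leq_mul; first exact: leq_fact.
  rewrite WE NE expnMn -expnM; apply: leq_mul; first exact: leq_pexp2l.
  by rewrite leq_pexp2l // leq_mul2l Pj orbT.
apply: (@leq_trans (M ^ 2 * \sum_(P : {set J} | P != set0)
    (#|typeA side N d H P| * ((2 * W).+1 ^ #|P|.-1 * ((2 * W) %/ G).+1)
     + \sum_(i0 in P) \sum_(q in ratfun G P | two_nz P (ratval q))
         #|typeB side N d H P i0 (ratval q)| * (2 * W).+1 ^ #|P|))).
  rewrite leq_mul2l; apply/orP; right.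
  apply: (@leq_trans (\sum_(n : {ffun J -> 'I_N}) \sum_(P : {set J} | P != set0)
    ((n \in typeA side N d H P) * ((2 * W).+1 ^ #|P|.-1 * ((2 * W) %/ G).+1)
     + \sum_(i0 in P) \sum_(q in ratfun G P | two_nz P (ratval q))
         (n \in typeB side N d H P i0 (ratval q)) * (2 * W).+1 ^ #|P|))).
    rewrite big_mkcond; apply: leq_sum => n _; case: ifP => // nv.
    exact: nzsols_le.
  have cnt (T : {set {ffun J -> 'I_N}}) u : \sum_n (n \in T) * u = #|T| * u.
    by rewrite -big_distrl /= -sum1_card [in RHS]big_mkcond; congr (_ * _); apply: eq_bigr => n _; case: (n \in T).
  rewrite exchange_big; apply: leq_sum => P _; rewrite big_split /= cnt leq_add2l.
  rewrite exchange_big; apply: leq_sum => i0 _; rewrite exchange_big; apply: leq_sum => q _.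
  by rewrite cnt.
rewrite big_distrr /=.
apply: (@leq_trans (\sum_(P : {set J}) ((C2 * (3 * w0)) ^ j + 7 * j * 6 ^ j * (C2 * (3 * w0)) ^ j) * N ^ j)); last first.
  by rewrite sum_nat_const -cardsT -powersetT card_powerset cardsT mulnA.
rewrite big_mkcond; apply: leq_sum => P _; case: ifP => // Pn; rewrite mulnDr mulnDl.
have rho0 : 0 < #|P| by rewrite card_gt0.
have rk : #|P| + #|~: P| = j by rewrite cardsC.
have MLe : M ^ (2 + 2 * g * j + 2 * t * j) <= L by rewrite leq_pexp2l.
have GN : G <= N.
  rewrite /G NE leq_pexp2l // AA; apply: leq_trans (leq_trans _ A'g) _; last by rewrite leq_pmull.
  have j0 : 0 < j by rewrite -rk addn_gt0 rho0.
  by move: j0; clearbody g; clear; nia.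
apply: leq_add.
  apply: leq_trans (@termA_le j #|P| #|~: P| M N W G s C2 w0 g t M0 C20 w00 rk rho0 WE (erefl _) (erefl _) (leqnn _) GN).
  rewrite leq_mul2l leq_mul2r; apply/orP; right; apply/orP; right.
  exact: (card_typeA (hs P) N0).
have [k2|k2] := leqP 2 #|~: P|; last first.
  rewrite big1 ?muln0 // => i0 iP; rewrite big1 // => q /andP [_ /existsP [j1 /existsP [j2]]].
  case/and4P => j1P j2P j12 _; move: k2; rewrite (cardsD1 j1) (cardsD1 j2 (_ :\ j1)) !inE j1P j2P.
  by rewrite eq_sym j12.
apply: leq_trans (@termB_le j #|P| #|~: P| M N L W G s C2 w0 g t M0 C20 w00 rk NL WE (erefl _) (erefl _) GN MLe k2).
  rewrite leq_mul2l; apply/orP; right.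
  rewrite -sum_nat_const; apply: leq_sum => i0 iP.
  apply: (@leq_trans (\sum_(q in ratfun G P) N ^ (#|~: P| - 2) * (7 * (N * L ^ 2)) * s ^ #|P|.-1 * (2 * W).+1 ^ #|P|)).
    rewrite big_mkcondr; apply: leq_sum => q _; case: ifP => // /existsP [j1 /existsP [j2]].
    case/and5P => j1P j2P j12 q1 q2; rewrite leq_mul2r; apply/orP; right.
    exact: (card_typeB d2 (hs P) N0 NL L0 iP j1P j2P j12 q1 q2).
  rewrite sum_nat_const leq_mul2r; apply/orP; right.
  by apply: leq_trans (card_restr _ _ _) _; rewrite card_prod !card_ord.
Qed.

(* The length of the subsequence step: [N = M ^ exponent l]. *)
Definition exponent (l : nat) :=
  let j := 2 * l in let t := 8 * j in let g := 2 + 2 * t * j in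
  3 * (2 + 2 * g * j + 2 * t * j).

(** [mm] is as large as the first condition allows. The lower bound on [d] yields [E <= mm ^ 4], so
    that [d <= mm ^ 6 <= mm ^ j] and the base of the [j]-th power is at most [mm ^ 5]. The left side
    is then at most [2 ^ (8 * j) * mm ^ (6 * j)], and [t = 8 * j] leaves [mm ^ (2 * j)] to beat the
    power of 2. *)
Lemma parameters l d : 3 <= l -> (2 * l) ^ (4 * l) < d ->
  let j := 2 * l in let t := 8 * j in let A := exponent l in
  exists mm, 4 * (A * j) * (mm * t) <= d /\
     2 ^ t * ((mm * t * (4 * A.+1)).+1 ^ j * d) < mm ^ t.
Proof.
move=> l3 dl j t A; pose E := 4 * (A * j) * t; pose mm := d %/ E.
have l0 : 0 < l by apply: leq_trans l3.
have j6 : 6 <= j by rewrite /j (leq_mul2l 2 3).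
have A0 : 0 < A by [].
have E0 : 0 < E by rewrite !muln_gt0 l0.
have AE : A = 768 * l ^ 3 + 192 * l ^ 2 + 24 * l + 6 by rewrite /A /exponent; ring.
(* As [3 <= l], the lower terms add at most [192 / 3 + 24 / 9 + 6 / 27 < 67] to 768. In the next
   bound, [334 * 320] is [128 * 835]. *)
have A835 : A <= 835 * l ^ 3.
  have h2 : 3 * l ^ 2 <= l ^ 3 by rewrite [l ^ 3]expnS leq_mul2r l3 orbT.
  have h1 : 3 * l <= l ^ 2 by rewrite -mulnn leq_mul2r l3 orbT.
  rewrite AE; move: (l ^ 3) (l ^ 2) h1 h2 l3 => u v; clear; lia.
have EE : E <= (334 * 320) * l ^ 5.
  have -> : E = 128 * l ^ 2 * A by rewrite /E /t /j; ring.
  have -> : (334 * 320) * l ^ 5 = 128 * l ^ 2 * (835 * l ^ 3) by ring.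
  by rewrite leq_mul2l A835 orbT.
have d12 : 4096 * l ^ 12 <= d.
  apply: leq_trans (ltnW dl); have -> : 4096 * l ^ 12 = (2 * l) ^ 12 by rewrite expnMn.
  by rewrite leq_pexp2l ?muln_gt0 // (leq_mul2l 4 3).
have mml : l ^ 4 <= mm.
  rewrite /mm leq_divRL //; apply: leq_trans d12.
  have l27 : 27 <= l ^ 3 by exact: (leq_expl 3 l3).
  apply: (@leq_trans (l ^ 4 * ((334 * 320) * l ^ 5))); first by rewrite leq_mul2l EE orbT.
  have -> : l ^ 4 * ((334 * 320) * l ^ 5) = l ^ 9 * (334 * 320) by ring.
  have -> : 4096 * l ^ 12 = l ^ 9 * (4096 * l ^ 3) by ring.
  rewrite leq_mul2l; apply/orP; right; move: l27; move: (l ^ 3) => u; clear; lia.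
have mm81 : 81 <= mm by apply: leq_trans mml; exact: (leq_expl 4 l3).
have mm0 : 0 < mm by exact: leq_trans mm81.
have Emm : E <= mm ^ 4.
  apply: leq_trans EE _; apply: (@leq_trans ((l ^ 4) ^ 4)); last exact: leq_expl.
  have l11 : 243 * 729 <= l ^ 11.
    have -> : 243 * 729 = 3 ^ 11 by rewrite (expnD 3 5 6).
    exact: leq_expl.
  have -> : (l ^ 4) ^ 4 = l ^ 11 * l ^ 5 by ring.
  rewrite leq_mul2r; apply/orP; right; apply: leq_trans l11; clear; lia.
exists mm; split.
  by apply: leq_trans (leq_trunc_div d E); rewrite -/mm /E; rewrite [mm * t]mulnC mulnA mulnC.
have Tb : (mm * t * (4 * A.+1)).+1 <= E * mm.
  have t0 : 0 < t by rewrite !muln_gt0 l0.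
  apply: (@leq_trans (4 * (A * 6) * t * mm)); last first.
    by rewrite !leq_mul2r !leq_mul2l j6 !orbT.
  have A6 : 6 <= A by rewrite AE leq_addl.
  have : 0 < mm * t by rewrite muln_gt0 mm0.
  have -> : 4 * (A * 6) * t * mm = mm * t * (24 * A) by ring.
  move: (mm * t) => u u0; apply: (@leq_trans (u * (4 * A.+1).+1)).
    by rewrite [X in _ <= X]mulnS addnC -addn1 leq_add2l.
  rewrite leq_mul2l; apply/orP; right; move: A6; clearbody A; clear; lia.
have dm : d <= mm ^ 6.
  have : d < mm.+1 * E by rewrite -ltn_divLR.
  move=> /ltnW h; apply: (leq_trans h).
  apply: (@leq_trans (mm ^ 2 * mm ^ 4)); last by rewrite -expnD.
  by apply: leq_mul => //; rewrite -mulnn; move: mm81; clear; nia.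
have h5 : (mm * t * (4 * A.+1)).+1 <= mm ^ 5.
  by apply: (leq_trans Tb); rewrite expnSr leq_mul2r Emm orbT.
apply: (@leq_ltn_trans (2 ^ t * ((mm ^ 5) ^ j * mm ^ j))).
  rewrite leq_mul2l; apply/orP; right; apply: leq_mul; first exact: leq_expl.
  by apply: (leq_trans dm); rewrite leq_pexp2l.
rewrite /t -expnMn [2 ^ _]expnM [mm ^ (8 * j)]expnM -expnMn ltn_exp2r; last by apply: leq_trans j6.
have : 2 ^ 8 < mm ^ 2 by apply: leq_trans (leq_expl 2 mm81).
have -> : 2 ^ 8 * (mm ^ 5 * mm) = mm ^ 6 * 2 ^ 8 by ring.
have -> : mm ^ 8 = mm ^ 6 * mm ^ 2 by rewrite -expnD.
by rewrite ltn_pmul2l // expn_gt0 mm0.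
Qed.

Lemma count_solutions_large (J : finType) (side : pred J) (l d w0 : nat) :
  3 <= l -> #|J| = 2 * l -> (2 * l) ^ (4 * l) < d -> 0 < w0 ->
  exists C, forall M N W, 0 < M -> N = M ^ exponent l -> W = w0 * N ->
    M ^ 2 * \sum_(n : {ffun J -> 'I_N} | inj_sides side n) #|nzsols side W d n| <= C * N ^ (2 * l).
Proof.
move=> l3 cJ dl w00; have := parameters l3 dl; cbv zeta.
rewrite /exponent; cbv zeta; rewrite -cJ => -[mm [c1 c2]].
have d1 : 1 < d by apply: leq_ltn_trans dl; rewrite expn_gt0 muln_gt0 /= (leq_trans _ l3).
have [C hC] := @count_solutions J side d (8 * #|J|) mm _ _ w0 d1 (erefl _) (leqnn _) w00 c1 c2.
by exists C; exact: hC.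
Qed.

Local Open Scope ring_scope.

(** * Frequencies of the expanded correlation sums *)

Section Frequencies.
Variables (m N Q d : nat).
Implicit Types (n : {ffun 'I_m.+1 -> 'I_N}) (P : {ffun 'I_m -> 'I_Q * 'I_Q}).

Definition gap n (i : 'I_m) : int :=
  ((n (widen_ord (leqnSn m) i)).+1)%:Z ^+ d - ((n (lift ord0 i)).+1)%:Z ^+ d.
Definition udiff P (i : 'I_m) : int := (P i).1%:Z - (P i).2%:Z.
Definition freq n P : int := \sum_i udiff P i * gap n i.
Definition offdiag P := [exists i, (P i).1 != (P i).2].
Definition swapP P : {ffun 'I_m -> 'I_Q * 'I_Q} := [ffun i => ((P i).2, (P i).1)].

Lemma swapPK : involutive swapP.
Proof. by move=> P; apply/ffunP => i; rewrite !ffunE /=; case: (P i). Qed.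

Lemma freq_swap n P : freq n (swapP P) = - freq n P.
Proof.
rewrite /freq -sumrN; apply: eq_bigr => i _.
by rewrite /udiff ffunE /= -mulNr opprB.
Qed.

Lemma offdiag_swap P : offdiag (swapP P) = offdiag P.
Proof. by apply: eq_existsb => i; rewrite ffunE /= eq_sym. Qed.

(* Summation by parts turns the differences [udiff] attached to the gaps into coefficients of the
   individual powers. *)
Definition wdiff P (j : 'I_m.+1) : int :=
  (if unlift ord_max j is Some i then udiff P i else 0) -
  (if unlift ord0 j is Some i then udiff P i else 0).

Lemma sum_wdiff P (f : 'I_m.+1 -> int) :
  \sum_j wdiff P j * f j = \sum_i udiff P i * (f (widen_ord (leqnSn m) i) - f (lift ord0 i)).
Proof.
under eq_bigr => j _ do rewrite mulrBl.
rewrite sumrB big_ord_recr [X in _ - X]big_ord_recl /= !unlift_none !mul0r addr0 add0r -sumrB.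
apply: eq_bigr => i _; rewrite liftK mulrBr; congr (_ * _ - _).
have -> : widen_ord (leqnSn m) i = lift ord_max i by apply: val_inj; exact: esym (lift_max i).
by rewrite liftK.
Qed.

Lemma wdiff_le P j : `|wdiff P j| <= (2 * Q)%N%:Z.
Proof.
have h i : `|udiff P i| <= Q%:Z.
  by rewrite /udiff; have := ltn_ord (P i).1; have := ltn_ord (P i).2; lia.
rewrite /wdiff; case: (unlift ord_max j) => [i|]; case: (unlift ord0 j) => [i'|];
  rewrite ?subr0 ?sub0r ?normrN ?normr0 //.
- by have := h i; have := h i'; lia.
- by have := h i; lia.
by have := h i'; lia.
Qed.

(** Testing against the indicator of [j <= i] telescopes back to [udiff P i]. *)
Lemma wdiff_inj P P' : wdiff P =1 wdiff P' -> udiff P =1 udiff P'.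
Proof.
move=> e i; have key P0 : udiff P0 i = \sum_j wdiff P0 j * (j <= i)%N%:Z.
  rewrite sum_wdiff (bigD1 i) //= leqnn [bump 0 i]/bump leq0n add1n ltnn mulr1 big1 ?addr0 // => i' ii'.
  rewrite /bump leq0n add1n; case: (ltngtP i' i) => [h|h|/val_inj h]; rewrite ?subrr ?mulr0 //.
  by rewrite h eqxx in ii'.
by rewrite !key; apply: eq_bigr => j _; rewrite e.
Qed.

Lemma wdiff_off P : offdiag P -> exists j, wdiff P j != 0.
Proof.
move=> /existsP [i Pi]; apply/existsP; apply: contraT; rewrite negb_exists => /forallP h.
have e : wdiff P =1 wdiff [ffun=> ((P i).1, (P i).1)].
  move=> j; move: (h j); rewrite negbK => /eqP ->.
  rewrite /wdiff; case: (unlift _ _) => [?|]; case: (unlift _ _) => [?|];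
  by rewrite /udiff ?ffunE ?subrr.
have := wdiff_inj e i; rewrite /udiff ffunE /= subrr => /eqP; rewrite subr_eq0 => /eqP -[h']; move/val_inj: h' => h'.
by rewrite h' eqxx in Pi.
Qed.

Definition side2 (j : 'I_m.+1 + 'I_m.+1) := if j is inl _ then true else false.

Definition pts2 n n' : {ffun 'I_m.+1 + 'I_m.+1 -> 'I_N} :=
  [ffun j => match j with inl a => n a | inr a => n' a end].

Definition coef2 P P' : {ffun 'I_m.+1 + 'I_m.+1 -> 'I_(2 * (2 * Q)).+1} :=
  [ffun j => inord (absz (match j with inl a => wdiff P a | inr a => wdiff P' a end + (2 * Q)%N%:Z))].

Lemma zval_coef2 P P' j : zval (coef2 P P') j =
  match j with inl a => wdiff P a | inr a => wdiff P' a end.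
Proof.
by rewrite /zval ffunE; case: j => a; [have := wdiff_le P a|have := wdiff_le P' a]; move: (wdiff _ a) => w h; rewrite inordK; lia.
Qed.

Lemma coef2_nzsols n n' P P' : offdiag P -> freq n P = freq n' P' ->
  coef2 P P' \in nzsols side2 (2 * Q) d (pts2 n n').
Proof.
move=> oP e; have [j wj] := wdiff_off oP.
rewrite !inE; apply/andP; split; last by apply/existsP; exists (inl j); rewrite zval_coef2.
have sw P0 : \sum_j wdiff P0 j = 0.
  rewrite (eq_bigr (fun j => wdiff P0 j * 1)); last by move=> ? _; rewrite mulr1.
  by rewrite (sum_wdiff P0 (fun=> 1)) big1 // => i _; rewrite subrr mulr0.
have fw n0 P0 : freq n0 P0 = \sum_j wdiff P0 j * ((n0 j).+1)%:Z ^+ d.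
  by rewrite (sum_wdiff P0 (fun j => ((n0 j).+1)%:Z ^+ d)).
apply/and3P; split; apply/eqP.
- under eq_bigr => j0 _ do rewrite zval_coef2.
  rewrite big_sumType /= /nu /sgn_side /=.
  under eq_bigr => j0 _ do rewrite ffunE mul1r.
  under [X in _ + X]eq_bigr => j0 _ do rewrite ffunE mulN1r mulrN.
  by rewrite sumrN -!fw e subrr.
- under eq_bigr => j0 _ do rewrite zval_coef2.
  by rewrite big_sumType /= [X in _ + X]big_pred0 // addr0 sw.
under eq_bigr => j0 _ do rewrite zval_coef2.
by rewrite big_sumType /= [X in X + _]big_pred0 // add0r sw.
Qed.

Lemma pts2_inj_sides n n' : injectiveb n -> injectiveb n' -> inj_sides side2 (pts2 n n').
Proof.
move=> /injectiveP ni /injectiveP ni'; apply/forallP => i; apply/forallP => j; apply/implyP.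
by case: i j => i [] j /andP [] //= _; rewrite !ffunE => /eqP e; rewrite ?(ni _ _ e) ?(ni' _ _ e).
Qed.

Lemma card_dep_pairs (X Y : finType) (A : pred X) (B : X -> {set Y}) :
  #|[set p : X * Y | A p.1 && (p.2 \in B p.1)]| = (\sum_(x | A x) #|B x|)%N.
Proof.
rewrite -sum1_card; under [RHS]eq_bigr => x _ do rewrite -sum1_card.
by rewrite pair_big_dep /=; apply: eq_bigl => p; rewrite inE.
Qed.

(** An equality of frequencies is a solution at the combined point [pts2 n n'], nonzero because [P]
    is off the diagonal. The coefficients recover [P] and [P'] only once their second components are
    known, which costs [Q ^ m] for each. *)
Lemma count_freq_eq :
  (\sum_(x : {ffun 'I_m.+1 -> 'I_N} * {ffun 'I_m -> 'I_Q * 'I_Q} | injectiveb x.1 && offdiag x.2)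
   \sum_(y : {ffun 'I_m.+1 -> 'I_N} * {ffun 'I_m -> 'I_Q * 'I_Q} | injectiveb y.1 && offdiag y.2)
     (freq x.1 x.2 - freq y.1 y.2 == 0)%R <=
   (Q ^ m) ^ 2 * \sum_(n : {ffun 'I_m.+1 + 'I_m.+1 -> 'I_N} | inj_sides side2 n) #|nzsols side2 (2 * Q) d n|)%N.
Proof.
pose T := ({ffun 'I_m.+1 -> 'I_N} * {ffun 'I_m -> 'I_Q * 'I_Q})%type.
pose A (x : T) := injectiveb x.1 && offdiag x.2.
pose B := [set p : T * T | [&& A p.1, A p.2 & freq p.1.1 p.1.2 == freq p.2.1 p.2.2]].
have -> : (\sum_(x | A x) \sum_(y | A y) (freq x.1 x.2 - freq y.1 y.2 == 0)%R)%N = #|B|.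
  rewrite pair_big /= -sum1_card [RHS](eq_bigl (fun p : T * T => (A p.1 && A p.2) &&
     (freq p.1.1 p.1.2 == freq p.2.1 p.2.2))); last by move=> p; rewrite inE andbA.
  by rewrite [RHS]big_mkcondr /=; apply: eq_bigr => p _; rewrite subr_eq0; case: (_ == _).
pose snds P : {ffun 'I_m -> 'I_Q} := [ffun i => (P i).2].
pose h (p : T * T) := ((pts2 p.1.1 p.2.1, coef2 p.1.2 p.2.2), (snds p.1.2, snds p.2.2)).
pose D := [set q : {ffun 'I_m.+1 + 'I_m.+1 -> 'I_N} * {ffun 'I_m.+1 + 'I_m.+1 -> 'I_(2 * (2 * Q)).+1} |
  inj_sides side2 q.1 && (q.2 \in nzsols side2 (2 * Q) d q.1)].
have h_inj : injective h.
  have eP P P' (j : 'I_m.+1 + 'I_m.+1) : snds P = snds P' -> wdiff P =1 wdiff P' -> P = P'.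
    move=> e /wdiff_inj e'; apply/ffunP => i; have := e' i; rewrite /udiff.
    move/ffunP/(_ i): e; rewrite !ffunE; case: (P i) (P' i) => a b [a' b'] /= ->.
    by move=> /addIr [] /val_inj ->.
  move=> [[n P] [n' P']] [[n0 P0] [n0' P0']] /= [en ec e1 e2].
  have wE j : zval (coef2 P P') j = zval (coef2 P0 P0') j by rewrite ec.
  have -> : P = P0.
    by apply: (eP _ _ (inl ord0)) e1 _ => a; have := wE (inl a); rewrite !zval_coef2.
  have -> : P' = P0'.
    by apply: (eP _ _ (inl ord0)) e2 _ => a; have := wE (inr a); rewrite !zval_coef2.
  have -> : n = n0 by apply/ffunP => a; have /ffunP/(_ (inl a)) := en; rewrite !ffunE.
  have -> // : n' = n0' by apply/ffunP => a; have /ffunP/(_ (inr a)) := en; rewrite !ffunE.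
have sub : h @: B \subset setX D setT.
  apply/subsetP => q /imsetP [[[n P] [n' P']]]; rewrite inE /= => /and3P [/andP [nj oP] /andP [nj' _] /eqP e] ->.
  by rewrite inE [_ \in setT]inE andbT inE /= pts2_inj_sides ?coef2_nzsols.
rewrite -(card_imset _ h_inj); apply: (leq_trans (subset_leq_card sub)).
by rewrite cardsX cardsT card_prod card_ffun !card_ord /D card_dep_pairs mulnC mulnn.
Qed.

Lemma count_freq_opp :
  (\sum_(x : {ffun 'I_m.+1 -> 'I_N} * {ffun 'I_m -> 'I_Q * 'I_Q} | injectiveb x.1 && offdiag x.2)
   \sum_(y : {ffun 'I_m.+1 -> 'I_N} * {ffun 'I_m -> 'I_Q * 'I_Q} | injectiveb y.1 && offdiag y.2)
     (freq x.1 x.2 + freq y.1 y.2 == 0)%R <=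
   (Q ^ m) ^ 2 * \sum_(n : {ffun 'I_m.+1 + 'I_m.+1 -> 'I_N} | inj_sides side2 n) #|nzsols side2 (2 * Q) d n|)%N.
Proof.
apply: leq_trans count_freq_eq; apply: eq_leq; apply: eq_bigr => x _.
rewrite (reindex_inj (h := fun y : {ffun 'I_m.+1 -> 'I_N} * {ffun 'I_m -> 'I_Q * 'I_Q} => (y.1, swapP y.2))) /=.
  by apply: eq_big => y; rewrite ?offdiag_swap // freq_swap.
by move=> [n P] [n' P'] /= [-> /(can_inj swapPK) ->].
Qed.
End Frequencies.

From mathcomp Require Import all_classical all_reals all_analysis.
From mathcomp Require Import complex measurable_realfun.
Import numFieldNormedType.Exports.
Local Open Scope classical_set_scope.
Local Open Scope ring_scope.

(** * Fejer kernels *)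

Section Circle.
Variable R : realType.
Implicit Types (x y v : R).

Lemma sin_int_pi (k : int) x : `|sin (x + pi * k%:~R)| = `|sin x|.
Proof.
have H n y : `|sin (y + pi * n%:R)| = `|sin y|.
  elim: n => [|n IH] in y *; first by rewrite mulr0 addr0.
  by rewrite -natr1 mulrDr mulr1 addrA sinDpi normrN IH.
case: k => n; first by rewrite -pmulrn H.
by have := H n.+1 (x - pi * n.+1%:R); rewrite subrK NegzE mulrNz mulrN => ->.
Qed.

Lemma cos_int_2pi (k : int) x : cos (x + 2 * pi * k%:~R) = cos x.
Proof.
have H n y : cos (y + 2 * pi * n%:R) = cos y.
  by rewrite mulr_natr mulr_natl (periodicn (@cosD2pi R)).
case: k => n; first by rewrite -pmulrn H.
by have := H n.+1 (x - 2 * pi * n.+1%:R); rewrite subrK NegzE mulrNz mulrN => ->.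
Qed.

Lemma norm_sinD x y : `|sin (x + y)| <= `|sin x| + `|sin y|.
Proof.
rewrite sinD; apply: (le_trans (ler_normD _ _)).
by rewrite !normrM lerD // ?ler_piMr ?ler_piMl ?cos_max.
Qed.

Lemma sin_mean y : 0 <= y -> exists2 c, 0 <= c <= y & sin y = cos c * y.
Proof.
move=> y0; have [|c] := @MVT_segment R sin cos 0 y y0 _.
  by apply: continuous_subspaceT => z; exact: continuous_sin.
by rewrite in_itv /= sin0 !subr0 => cy ->; exists c.
Qed.

Lemma norm_sin_le x : `|sin x| <= `|x|.
Proof.
wlog x0 : x / 0 <= x => [H|].
  case: (leP 0 x) => h; first exact: H.
  by rewrite -normrN -sinN -[leRHS]normrN H // oppr_ge0 ltW.
have [c _ ->] := sin_mean x0; rewrite normrM ler_piMl ?cos_max //.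
Qed.

Lemma sin_ge_half x : 0 <= x <= pi / 2 -> x / 2 <= sin x.
Proof.
move=> /andP [x0 xp]; pose y := x / 2; have xE : x = y *+ 2 by rewrite /y -mulr_natr; field.
have p0 := pi_gt0 R.
have y0 : 0 <= y by rewrite /y; lra.
have yp : y <= pi / 4 by rewrite /y; lra.
have mono z : 0 <= z <= pi / 4 -> cos (pi / 4) <= cos z.
  move=> /andP [z0 zp]; have [->//|zn] := eqVneq z (pi / 4).
  by apply/ltW; rewrite ltr_cos ?in_itv /=; [rewrite lt_neqAle zn | apply/andP; split; lra..].
have a0 : 0 <= cos (pi / 4 : R) by apply: cos_ge0_pihalf; apply/andP; split; lra.
have a2 : cos (pi / 4 : R) ^+ 2 = 2^-1.
  have := cos_mulr2n (pi / 4 : R); have -> : (pi / 4 : R) *+ 2 = pi / 2 by rewrite -mulr_natr; field.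
  rewrite cos_pihalf -mulr_natr => h.
  by apply: (mulIf (_ : (2:R) != 0)) => //; rewrite mulVf //; lra.
rewrite {2}xE sin_mulr2n; have [c cy ->] := sin_mean y0.
have h1 : cos (pi / 4) <= cos c by apply: mono; move: cy => /andP [? ?]; apply/andP; split; lra.
have h2 : cos (pi / 4) <= cos y by apply: mono; rewrite y0 yp.
have h : 2^-1 <= cos y * cos c by rewrite -a2 expr2 ler_pM.
by have := ler_wpM2r y0 h; rewrite -/y -mulr_natr; lra.
Qed.

Definition rnd x : int := Num.floor (x + 2^-1).

Lemma rnd_le x : `|x - (rnd x)%:~R| <= 2^-1.
Proof.
rewrite /rnd; have := ge_floor (x + 2^-1); have := lt_succ_floor (x + 2^-1).
by rewrite rmorphD /= ler_norml; set z := _%:~R; move=> ? ?; apply/andP; split; lra.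
Qed.

(** Comparable to [N] times the distance from [v] to the nearest integer, but given by a formula
    from which periodicity and subadditivity are immediate. *)
Definition wt N v : R := N%:R * `|sin (pi * v)|.

Lemma wt_ge0 N v : 0 <= wt N v. Proof. by rewrite mulr_ge0. Qed.

Lemma wt_int N v (k : int) : wt N (v + k%:~R) = wt N v.
Proof. by rewrite /wt mulrDr sin_int_pi. Qed.

Lemma wtN N v : wt N (- v) = wt N v.
Proof. by rewrite /wt mulrN sinN normrN. Qed.

Lemma wtD N u v : wt N (u + v) <= wt N u + wt N v.
Proof. by rewrite /wt [pi * _]mulrDr -[leRHS]mulrDr; apply: ler_wpM2l; rewrite ?ler0n // norm_sinD. Qed.

Lemma wt_le N v (k : int) : wt N v <= N%:R * (4 * `|v + k%:~R|).
Proof.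
rewrite -(wt_int _ _ k); apply: ler_wpM2l; first exact: ler0n.
apply: (le_trans (norm_sin_le _)).
rewrite normrM ler_wpM2r // gtr0_norm ?pi_gt0 //; have := pihalf_lt2 R; lra.
Qed.

Lemma le_wt N v : N%:R * `|v - (rnd v)%:~R| <= wt N v.
Proof.
rewrite -(wt_int _ _ (- rnd v)) rmorphN /=; have := rnd_le v.
move: (v - _) => u u1; apply: ler_wpM2l; first exact: ler0n.
have -> : `|sin (pi * u)| = `|sin (pi * `|u|)|.
  by case: (ger0P u) => // _; rewrite mulrN sinN normrN.
have p2 := pi_ge2 R; have u0 := normr_ge0 u; move: `|u| u0 u1 => t t0 t1.
have h : pi * t / 2 <= sin (pi * t).
  apply: sin_ge_half; apply/andP; split; [exact: mulr_ge0 (pi_ge0 R) t0|exact: (ler_wpM2l (pi_ge0 R) t1)].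
apply: le_trans (ler_norm _); apply: le_trans h.
have := ler_wpM2r t0 p2; lra.
Qed.
End Circle.

Section Fejer.
Variable R : realType.
Implicit Types (x y v : R).

(** The squared modulus of the mean of the exponentials of frequencies [0, ..., Q - 1]: the Fejer
    kernel normalized to be 1, not [Q], at the integers. *)
Definition fejer (Q : nat) (y : R) : R :=
  (Q%:R ^+ 2)^-1 * \sum_(p : 'I_Q * 'I_Q) cos (2 * pi * ((p.1)%:R - (p.2)%:R) * y).

Let cs Q y : R := \sum_(j < Q) cos (2 * pi * j%:R * y).
Let sn Q y : R := \sum_(j < Q) sin (2 * pi * j%:R * y).

Lemma fejerE Q y : fejer Q y = (Q%:R ^+ 2)^-1 * (cs Q y ^+ 2 + sn Q y ^+ 2).
Proof.
congr (_ * _); rewrite -(pair_bigA _ (fun i j : 'I_Q => cos (2 * pi * (i%:R - j%:R) * y))) /=.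
rewrite !expr2 /cs /sn !mulr_suml -big_split /=; apply: eq_bigr => i _.
rewrite !mulr_sumr -big_split /=; apply: eq_bigr => j _.
by rewrite -cosB; congr cos; ring.
Qed.

Lemma fejer_ge0 Q y : 0 <= fejer Q y.
Proof. by rewrite fejerE mulr_ge0 ?invr_ge0 ?addr_ge0 ?sqr_ge0. Qed.

Lemma sum_telescope Q (F : nat -> R) : \sum_(j < Q) (F j.+1 - F j) = F Q - F 0.
Proof. by rewrite -(big_mkord xpredT (fun j => F j.+1 - F j)) telescope_sumr. Qed.

(** The closed form of the kernel, multiplied out so that it also holds at integers. The sums [cs]
    and [sn] telescope after multiplication by [2 * sin a]. *)
Lemma fejer_sin Q y : (0 < Q)%N ->
  fejer Q y * (Q%:R * sin (pi * y)) ^+ 2 = sin (pi * (Q%:R * y)) ^+ 2.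
Proof.
move=> Q0; have Qn : (Q%:R : R) != 0 by rewrite pnatr_eq0 -lt0n.
pose a := pi * y; pose b := 2 * Q%:R * a - a.
have hc : 2 * sin a * cs Q y = sin b + sin a.
  rewrite /cs mulr_sumr -[RHS]/(sin b + sin a).
  have -> : sin a = - sin (2 * 0%:R * a - a) by rewrite mulr0 mul0r sub0r sinN opprK.
  rewrite -(sum_telescope Q (fun j => sin (2 * j%:R * a - a))).
  rewrite mulr0 mul0r sub0r sinN opprK; apply: eq_bigr => j _.
  have -> : 2 * pi * j%:R * y = 2 * j%:R * a by rewrite /a; ring.
  have -> : 2 * j.+1%:R * a - a = 2 * j%:R * a + a by rewrite -natr1; ring.
  by rewrite sinD sinB; ring.
have hs : 2 * sin a * sn Q y = cos a - cos b.
  have -> : cos a = cos (2 * 0%:R * a - a) by rewrite mulr0 mul0r sub0r cosN.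
  rewrite -[RHS]opprB -(sum_telescope Q (fun j => cos (2 * j%:R * a - a))) /sn mulr_sumr -sumrN.
  apply: eq_bigr => j _.
  have -> : 2 * pi * j%:R * y = 2 * j%:R * a by rewrite /a; ring.
  have -> : 2 * j.+1%:R * a - a = 2 * j%:R * a + a by rewrite -natr1; ring.
  by move: (2 * j%:R * a) => u; rewrite (cosB u a) (cosD u a); ring.
have key : 4 * sin a ^+ 2 * (cs Q y ^+ 2 + sn Q y ^+ 2) = 4 * sin (pi * (Q%:R * y)) ^+ 2.
  have -> : 4 * sin a ^+ 2 * (cs Q y ^+ 2 + sn Q y ^+ 2) =
    (2 * sin a * cs Q y) ^+ 2 + (2 * sin a * sn Q y) ^+ 2 by ring.
  rewrite hc hs; pose c := pi * (Q%:R * y).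
  have -> : b = c + (c - a) by rewrite /b /c /a; ring.
  have h1 := cos2Dsin2 c; have h2 := cos2Dsin2 a.
  rewrite -/c (sinD c (c - a)) (cosD c (c - a)) (sinB c a) (cosB c a); move: (cos c) (sin c) (cos a) (sin a) h1 h2 => C S c' s h1 h2.
  have -> : S * (C * c' + S * s) + C * (S * c' - C * s) + s =
    2 * S * (C * c' + S * s) + s * (1 - (C ^+ 2 + S ^+ 2)) by ring.
  have -> : c' - (C * (C * c' + S * s) - S * (S * c' - C * s)) =
    2 * S * (S * c' - C * s) + c' * (1 - (C ^+ 2 + S ^+ 2)) by ring.
  rewrite h1 subrr !mulr0 !addr0.
  have -> : (2 * S * (C * c' + S * s)) ^+ 2 + (2 * S * (S * c' - C * s)) ^+ 2 =
    4 * S ^+ 2 * ((C ^+ 2 + S ^+ 2) * (c' ^+ 2 + s ^+ 2)) by ring.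
  by rewrite h1 h2 !mulr1.
rewrite fejerE -/a; apply: (mulfI (_ : (4 : R) != 0)); first by rewrite pnatr_eq0.
rewrite -key; field.
by rewrite Qn.
Qed.

Lemma fejer_le1 Q y : (0 < Q)%N -> fejer Q y * wt Q y ^+ 2 <= 1.
Proof.
move=> Q0; rewrite /wt -[Q%:R in X in _ * X](@ger0_norm R) // -normrM real_normK ?num_real //.
by rewrite fejer_sin // -[leRHS](cos2Dsin2 (pi * (Q%:R * y))) lerDr sqr_ge0.
Qed.

(* The zeros of the two kernels interlace, so their sum has none. *)
Definition dblfejer N v : R := fejer N v + fejer N (v - (2 * N%:R)^-1).

(** The shift by [(2 * N)^-1] turns the sine of [pi * (N * v)] into a cosine up to sign, and the two
    squares add up to 1. The shift changes the weight by at most 2, hence [wt N v + 2]. *)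
Lemma dblfejer_ge N v : (0 < N)%N -> 1 <= (wt N v + 2) ^+ 2 * dblfejer N v.
Proof.
move=> N0; have Nn : (0 : R) < N%:R by rewrite ltr0n.
have h Q y : (0 < Q)%N -> fejer Q y * wt Q y ^+ 2 = sin (pi * (Q%:R * y)) ^+ 2.
  move=> Q0; rewrite /wt -[Q%:R in X in _ * X](@ger0_norm R) // -normrM real_normK ?num_real //.
  by rewrite fejer_sin.
pose v' := v - (2 * N%:R)^-1.
have wv' : wt N v' <= wt N v + 2.
  apply: (le_trans (wtD _ _ _)); rewrite lerD2l wtN; apply: (le_trans (wt_le _ _ 0)).
  rewrite addr0 ger0_norm ?invr_ge0 ?mulr_ge0 //.
  by rewrite le_eqVlt; apply/orP; left; apply/eqP; field; rewrite gt_eqF.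
have sqr_mono (a b : R) : 0 <= a -> a <= b -> a ^+ 2 <= b ^+ 2.
  by move=> a0 ab; apply: lerXn2r; rewrite ?nnegrE // (le_trans a0).
rewrite -[leLHS](cos2Dsin2 (pi * (N%:R * v))) /dblfejer mulrDr [leLHS]addrC; apply: lerD.
  rewrite -h // [leLHS]mulrC; apply: ler_wpM2r; rewrite ?fejer_ge0 //; apply: sqr_mono; rewrite ?wt_ge0 // lerDl //.
have -> : cos (pi * (N%:R * v)) ^+ 2 = sin (pi * (N%:R * v')) ^+ 2.
  have -> : pi * (N%:R * v') = pi * (N%:R * v) - pi / 2 by rewrite /v'; field; rewrite gt_eqF.
  by rewrite sinBpihalf sqrrN.
rewrite -h // [leLHS]mulrC -/v'; apply: ler_wpM2r; rewrite ?fejer_ge0 //; apply: sqr_mono; first exact: wt_ge0.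
exact: wv'.
Qed.

Lemma dblfejer_ge0 N v : 0 <= dblfejer N v.
Proof. by rewrite addr_ge0 ?fejer_ge0. Qed.

Lemma sum_cos_grid Q (r : int) x : (`|r| < Q%:Z) -> r != 0 ->
  \sum_(z < Q) cos (x - 2 * pi * r%:~R * (z%:R / Q%:R)) = 0.
Proof.
move=> rQ r0; have Q0 : (0 : R) < Q%:R by rewrite ltr0n; lia.
pose b : R := pi * r%:~R / Q%:R.
have sb : sin b != 0.
  wlog rp : r rQ r0 @b / 0 < r => [H|].
    have [h|] := ltP 0 r; first exact: H.
    rewrite le_eqVlt (negPf r0) /= => h.
    have := H (- r); rewrite normrN oppr_eq0 oppr_gt0 => /(_ rQ r0 h).
    by rewrite rmorphN /= mulrN mulNr sinN oppr_eq0.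
  rewrite gt_eqF // sin_gt0_pi //; apply/andP; split.
    by rewrite /b divr_gt0 // mulr_gt0 ?pi_gt0 // ltr0z.
  rewrite /b ltr_pdivrMr // ltr_pM2l ?pi_gt0 // pmulrn ltr_int; lia.
apply: (mulfI (_ : 2 * sin b != 0)); first by rewrite mulf_neq0 // pnatr_eq0.
rewrite mulr0 mulr_sumr.
transitivity (\sum_(z < Q) (- sin (x + b - 2 * b * z.+1%:R) - - sin (x + b - 2 * b * z%:R))).
  apply: eq_bigr => z _; rewrite -(natr1 z).
  have -> : x - 2 * pi * r%:~R * (z%:R / Q%:R) = x - 2 * b * z%:R by rewrite /b; field; rewrite gt_eqF.
  have -> : x + b - 2 * b * (z%:R + 1) = (x - 2 * b * z%:R) - b by ring.
  have -> : x + b - 2 * b * z%:R = (x - 2 * b * z%:R) + b by ring.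
  move: (x - _) => u; rewrite (sinB u b) (sinD u b); ring.
rewrite (sum_telescope Q (fun z => - sin (x + b - 2 * b * z%:R))) mulr0 subr0.
have -> : 2 * b * Q%:R = 2 * pi * r%:~R by rewrite /b; field; rewrite gt_eqF.
apply/eqP; rewrite subr_eq0 eqr_opp; apply/eqP.
rewrite -[RHS]cosBpihalf -[LHS]cosBpihalf -[RHS](cos_int_2pi (- r)) rmorphN /=; congr cos; ring.
Qed.

(** Frequencies differ by less than [Q], so only the diagonal pairs survive summation over the grid.
    [Q' = Q] makes the kernels a partition of unity; [Q' = N] evaluates the grid sums of the
    majorant. *)
Lemma fejer_grid Q Q' v : (0 < Q' <= Q)%N ->
  \sum_(z < Q) fejer Q' (v - z%:R / Q%:R) = Q%:R / Q'%:R.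
Proof.
move=> /andP [Q0 QQ]; rewrite -mulr_sumr exchange_big /=.
have Qn : (Q'%:R : R) != 0 by rewrite pnatr_eq0 -lt0n.
rewrite -(pair_bigA _ (fun i j : 'I_Q' => \sum_(z < Q) cos (2 * pi * (i%:R - j%:R) * (v - z%:R / Q%:R)))) /=.
under eq_bigr => i _.
  rewrite (bigD1 i) //= [X in _ + X]big1; last first.
    move=> j ji; transitivity (\sum_(z < Q) cos (2 * pi * (i%:R - j%:R) * v - 2 * pi * (i%:Z - j%:Z)%:~R * (z%:R / Q%:R))).
      by apply: eq_bigr => z _; rewrite rmorphB /= -!pmulrn; congr cos; ring.
    apply: sum_cos_grid; first by have := ltn_ord i; have := ltn_ord j; lia.
    by rewrite subr_eq0; apply: contraNneq ji => -[e]; apply/eqP/val_inj.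
  rewrite addr0; under eq_bigr => z _ do rewrite subrr mulr0 mul0r cos0.
  rewrite sumr_const card_ord; over.
rewrite sumr_const card_ord -mulr_natr; field; exact: Qn.
Qed.
End Fejer.

(** Both parts factor into one-variable sums: the constant [eta] over all coordinates, and each
    indicator in its own coordinate against full sums in the others. *)
Lemma sum_prod_weight (R : realFieldType) (m Q : nat) (a : 'I_m -> 'I_Q -> R)
    (b : 'I_m -> 'I_Q -> bool) (E e eta B : R) :
  (forall i z, 0 <= a i z) -> 1 <= E -> (forall i, \sum_z a i z <= E) ->
  (forall i, \sum_z a i z * (b i z)%:R <= e) -> 0 <= eta -> 0 <= B ->
  \sum_(z : {ffun 'I_m -> 'I_Q}) (\prod_i a i (z i)) * (eta + B * \sum_i (b i (z i))%:R)
    <= E ^+ m * (eta + m%:R * B * e).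
Proof.
move=> a0 E1 aE abe eta0 B0.
have prodE : \prod_(i < m) \sum_z a i z <= E ^+ m.
  rewrite -[m in leRHS]card_ord -prodr_const; apply: ler_prod => i _.
  by rewrite aE sumr_ge0.
have -> : \sum_(z : {ffun 'I_m -> 'I_Q}) (\prod_i a i (z i)) * (eta + B * \sum_i (b i (z i))%:R) =
  eta * \prod_i \sum_z a i z + B * \sum_i \prod_j \sum_z a j z * (if j == i then (b j z)%:R else 1).
  rewrite bigA_distr_bigA mulr_sumr mulr_sumr.
  under [X in _ = _ + X]eq_bigr => i _ do rewrite bigA_distr_bigA mulr_sumr.
  rewrite exchange_big -big_split /=; apply: eq_bigr => z _.
  rewrite mulrDr [eta * _]mulrC; congr (_ + _); rewrite mulrCA mulr_sumr mulr_sumr.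
  apply: eq_bigr => i _; rewrite big_split /=; congr (_ * (_ * _)).
  by rewrite -big_mkcond /= big_pred1_eq.
have key i : \prod_j \sum_z a j z * (if j == i then (b j z)%:R else 1) <= e * E ^+ m.
  have e0 : 0 <= e by apply: le_trans (abe i); apply: sumr_ge0 => z _; rewrite mulr_ge0.
  rewrite (bigD1 i) //= eqxx; apply: ler_pM => //.
  - by apply: sumr_ge0 => z _; rewrite mulr_ge0.
  - apply: prodr_ge0 => j ji; apply: sumr_ge0 => z _; rewrite mulr_ge0 //; case: ifP => //.
  rewrite -[m in leRHS]card_ord -prodr_const [leRHS](bigD1 i) //=.
  rewrite -[leLHS]mul1r; apply: ler_pM => //.
    apply: prodr_ge0 => j ji; apply: sumr_ge0 => z _; rewrite mulr_ge0 //; case: ifP => //.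
  apply: ler_prod => j ji; rewrite (negPf ji).
  under eq_bigr => z _ do rewrite mulr1.
  by rewrite aE sumr_ge0.
rewrite mulrDr; apply: lerD; first by rewrite mulrC ler_wpM2r.
have -> : E ^+ m * (m%:R * B * e) = B * \sum_(i < m) (e * E ^+ m).
  by rewrite sumr_const card_ord -mulr_natl; ring.
by rewrite ler_wpM2l // ler_sum.
Qed.

Lemma mul_sqr_succ_le (R : realFieldType) (F w u : R) :
  0 <= F -> F * w ^+ 2 <= u -> F * (w + 1) ^+ 2 <= 2 * F + 2 * u.
Proof. by move=> F0 h; have := mulr_ge0 F0 (sqr_ge0 (w - 1)); lra. Qed.

Section Kernel.
Variables (R : realType) (N lam L : nat).
Hypothesis N0 : (0 < N)%N.
Hypothesis lam0 : (0 < lam)%N.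
Notation Q := (lam * N)%N.
Variables (rho delta : R).
Hypothesis rho0 : 0 <= rho.
Hypothesis delta0 : 0 < delta.
Implicit Types (v : R) (z : 'I_Q).

Definition gridpt z : R := (z%:R - L%:R) / Q%:R.
Let c : R := (rho + 2) ^+ 2.
Let kap : R := (1 + 2 / delta) ^+ 2.
Let lR : R := lam%:R.

Let Q0 : (0 < Q)%N. Proof. by rewrite muln_gt0 lam0. Qed.
Let l0 : 0 < lR. Proof. by rewrite ltr0n. Qed.

Let l1 : 1 <= lR. Proof. by rewrite ler1n. Qed.

Let c1 : 1 <= c.
Proof. by rewrite /c exprn_ege1 //; move: rho0; lra. Qed.

Let kap1 : 1 <= kap.
Proof. by rewrite /kap expr_ge1 // ?addr_ge0 ?divr_ge0 ?ltW // ltrDl divr_gt0. Qed.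

Lemma sum_fejer_grid v : \sum_z fejer Q (v - gridpt z) = 1.
Proof.
transitivity (\sum_(z < Q) fejer Q (v + L%:R / Q%:R - z%:R / Q%:R)).
  by apply: eq_bigr => z _; congr fejer; rewrite /gridpt; ring.
rewrite fejer_grid; last by rewrite Q0 leqnn.
by rewrite divff // pnatr_eq0 -lt0n Q0.
Qed.

Lemma sum_dblfejer_grid v : \sum_z dblfejer N (v - gridpt z) = 2 * lR.
Proof.
have H u : \sum_z fejer N (u - gridpt z) = lR.
  transitivity (\sum_(z < Q) fejer N (u + L%:R / Q%:R - z%:R / Q%:R)).
    by apply: eq_bigr => z _; congr fejer; rewrite /gridpt; ring.
  rewrite fejer_grid; last by rewrite N0 leq_pmull.
  by rewrite natrM mulfK // pnatr_eq0 -lt0n.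
rewrite big_split /= H.
under eq_bigr => z _ do rewrite addrAC.
by rewrite H; ring.
Qed.

Lemma sum_dblfejer_grid0 : \sum_z dblfejer N (gridpt z) <= 4 * lR.
Proof.
have H u : \sum_z fejer N (gridpt z - u) = lR.
  transitivity (\sum_z fejer N (u - gridpt z)).
    apply: eq_bigr => z _; congr (_ * _); apply: eq_bigr => p _.
    by rewrite -cosN; congr cos; ring.
  transitivity (\sum_(z < Q) fejer N (u + L%:R / Q%:R - z%:R / Q%:R)).
    by apply: eq_bigr => z _; congr fejer; rewrite /gridpt; ring.
  rewrite fejer_grid; last by rewrite N0 leq_pmull.
  by rewrite natrM mulfK // pnatr_eq0 -lt0n.
rewrite big_split /= H.
have -> : \sum_(i < Q) fejer N (gridpt i) = lR.
  by rewrite -(H 0); apply: eq_bigr => z _; rewrite subr0.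
by have -> : lR + lR = 2 * lR; [ring | rewrite ler_wpM2r ?ler_nat // ltW].
Qed.

Lemma wt_fejer v : fejer Q v * (lR * wt N v) ^+ 2 <= 1.
Proof.
have -> : lR * wt N v = wt Q v by rewrite /wt natrM mulrA.
exact: fejer_le1. Qed.

(** [fejer Q] is at most [(lam * wt N v) ^ -2], while [dblfejer N] is at least [(wt N v + 2) ^ -2];
    beyond [delta] the two weights are comparable, with constant [kap]. *)
Lemma fejer_far v : delta < wt N v -> lR ^+ 2 * fejer Q v <= kap * dblfejer N v.
Proof.
move=> dw; have w0 : 0 < wt N v by apply: lt_trans dw.
have h : (wt N v + 2) ^+ 2 <= kap * wt N v ^+ 2.
  rewrite /kap -exprMn; apply: lerXn2r; rewrite ?nnegrE ?addr_ge0 ?mulr_ge0 ?addr_ge0 ?divr_ge0 ?(ltW w0) ?(ltW delta0) //.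
  by rewrite mulrDl mul1r lerD2l mulrAC ler_pdivlMr // ler_wpM2l // ltW.
have D0 := dblfejer_ge0 N v; have D1 := dblfejer_ge v N0; have F0 := fejer_ge0 Q v.
have F1 := wt_fejer v.
apply: (@le_trans _ _ (lR ^+ 2 * fejer Q v * (kap * wt N v ^+ 2 * dblfejer N v))).
  rewrite -[leLHS]mulr1; apply: ler_wpM2l; first by rewrite mulr_ge0 ?sqr_ge0.
  by apply: (le_trans D1); rewrite ler_wpM2r.
have -> : lR ^+ 2 * fejer Q v * (kap * wt N v ^+ 2 * dblfejer N v) =
  (fejer Q v * (lR * wt N v) ^+ 2) * (kap * dblfejer N v) by ring.
rewrite ler_piMl // mulr_ge0 // (le_trans _ kap1) //.
Qed.

Lemma near_le v : wt N v <= rho -> 1 <= c * dblfejer N v.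
Proof.
move=> wr; apply: (le_trans (dblfejer_ge v N0)); apply: ler_wpM2r; first exact: dblfejer_ge0.
by apply: lerXn2r; rewrite ?nnegrE ?addr_ge0 ?wt_ge0 // lerD2r.
Qed.

Lemma shift_le v t : wt N (v - t) <= rho -> 1 <= (wt N t + 1) ^+ 2 * (c * dblfejer N v).
Proof.
move=> wr; apply: (le_trans (dblfejer_ge v N0)); rewrite mulrA.
apply: ler_wpM2r; first exact: dblfejer_ge0.
have w0 := wt_ge0 N t; have wv := wt_ge0 N v.
rewrite /c -exprMn; apply: lerXn2r; rewrite ?nnegrE ?mulr_ge0 ?addr_ge0 //.
have := wtD N (v - t) t; rewrite subrK => h.
have := mulr_ge0 w0 rho0; move: (wt N v) (wt N t) (wt N _) wr h w0 => x y w; lra.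
Qed.

Lemma sum_fejer_far v :
  \sum_z fejer Q (v - gridpt z) * (delta < wt N (v - gridpt z))%R%:R <= 2 * kap / lR.
Proof.
have -> : 2 * kap / lR = \sum_z (lR ^- 2 * (kap * dblfejer N (v - gridpt z))).
  rewrite -!mulr_sumr sum_dblfejer_grid; field; exact: lt0r_neq0.
apply: ler_sum => z _; have [/fejer_far h|_] := boolP (delta < wt N (v - gridpt z)); last first.
  rewrite mulr0; apply: mulr_ge0; first by rewrite invr_ge0 sqr_ge0.
  by apply: mulr_ge0; [exact: le_trans kap1 | exact: dblfejer_ge0].
by rewrite mulr1 ler_pdivlMl ?exprn_gt0.
Qed.

Let supp z := wt N (gridpt z) <= rho.

Lemma count_supp : \sum_z (supp z)%:R <= 4 * lR * c.
Proof.
apply: (@le_trans _ _ (\sum_z c * dblfejer N (gridpt z))).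
  apply: ler_sum => z _; rewrite /supp; have [/near_le //|_] := boolP (wt N (gridpt z) <= rho).
  by rewrite mulr_ge0 ?dblfejer_ge0 // (le_trans _ c1).
rewrite -mulr_sumr mulrC ler_wpM2r ?sum_dblfejer_grid0 // (le_trans _ c1) //.
Qed.

Let a v z : R := fejer Q (v - gridpt z) * (wt N (v - gridpt z) + 1) ^+ 2 * (supp z)%:R.

Lemma a_ge0 v z : 0 <= a v z.
Proof. by rewrite /a; apply: mulr_ge0 => //; apply: mulr_ge0; [exact: fejer_ge0|exact: sqr_ge0]. Qed.

Lemma fejer_w2 v : fejer Q v * wt N v ^+ 2 <= lR ^- 2.
Proof.
rewrite -[leRHS]mul1r ler_pdivlMr ?exprn_gt0 //; apply: le_trans (wt_fejer v).
by rewrite le_eqVlt; apply/orP; left; apply/eqP; ring.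
Qed.

Lemma sum_a v : \sum_z a v z <= 2 + 8 * c.
Proof.
apply: (@le_trans _ _ (\sum_z (2 * fejer Q (v - gridpt z) + 2 * lR ^- 2 * (supp z)%:R))).
  apply: ler_sum => z _; rewrite /a; have F0 := fejer_ge0 Q (v - gridpt z).
  have F2 := fejer_w2 (v - gridpt z); have w0 := wt_ge0 N (v - gridpt z).
  case: (supp z) => /=; rewrite ?mulr1 ?mulr0 ?addr0; last by rewrite mulr_ge0.
  exact: mul_sqr_succ_le.
rewrite big_split /= -[X in X + _]mulr_sumr -[X in _ + X]mulr_sumr sum_fejer_grid mulr1 lerD2l.
apply: (@le_trans _ _ (2 * lR ^- 2 * (4 * lR * c))).
  by rewrite ler_wpM2l ?count_supp // mulr_ge0 // invr_ge0 sqr_ge0.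
have -> : 2 * lR ^- 2 * (4 * lR * c) = 8 * c / lR by field; exact: lt0r_neq0.
by rewrite ler_pdivrMr // ler_peMr // mulr_ge0 // (le_trans _ c1).
Qed.

Lemma sum_a_far v : \sum_z a v z * (delta < wt N (v - gridpt z))%R%:R <= 4 * c * kap / lR.
Proof.
have -> : 4 * c * kap / lR = lR ^- 2 * kap * (4 * lR * c) by field; exact: lt0r_neq0.
have K0 : 0 <= lR ^- 2 * kap by rewrite mulr_ge0 ?invr_ge0 ?sqr_ge0 // (le_trans _ kap1).
apply: le_trans (ler_wpM2l K0 count_supp); rewrite mulr_sumr; apply: ler_sum => z _.
rewrite /a mulrAC; apply: ler_wpM2r => //.
set t := v - gridpt z; have F0 := fejer_ge0 Q t; have F2 := fejer_w2 t.
have [dw|_] := boolP (delta < wt N t); last by rewrite mulr0; exact: K0.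
rewrite mulr1 mulrC [leRHS]mulrC.
have w0 : 0 < wt N t by apply: lt_trans dw.
have h : (wt N t + 1) ^+ 2 <= kap * wt N t ^+ 2.
  rewrite /kap -exprMn; apply: lerXn2r; rewrite ?nnegrE ?addr_ge0 ?mulr_ge0 ?addr_ge0 ?divr_ge0 ?(ltW w0) ?(ltW delta0) //.
  rewrite mulrDl mul1r lerD2l mulrAC ler_pdivlMr // mul1r; lra.
apply: le_trans (ler_wpM2r F0 h) _; rewrite -mulrA [wt N t ^+ 2 * _]mulrC; apply: ler_wpM2l F2; exact: le_trans kap1.
Qed.

(* When [y] is far from the support the decay must come from the kernels themselves: inserting
   [(wt N t + 1) ^+ 2] costs only a constant after summation over the grid points of the support, while
   its inverse produces the majorant [dblfejer N (y i)]. *)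
Lemma kernel_approx (m : nat) (y : 'I_m -> R) (g0 : R) (g : {ffun 'I_m -> 'I_Q} -> R) (eta B : R) :
  0 <= eta -> 0 <= B ->
  (forall z : {ffun 'I_m -> 'I_Q}, `|g0 - g z| <= eta + B * \sum_i (delta < wt N (y i - gridpt (z i)))%R%:R) ->
  (g0 != 0 -> forall i, wt N (y i) <= rho) ->
  (forall z : {ffun 'I_m -> 'I_Q}, g z != 0 -> forall i, wt N (gridpt (z i)) <= rho) ->
  `|g0 - \sum_(z : {ffun 'I_m -> 'I_Q}) g z * \prod_i fejer Q (y i - gridpt (z i))| <=
    (c * (2 + 8 * c)) ^+ m * (eta + m%:R * B * (4 * c * kap / lR)) * \prod_i dblfejer N (y i).
Proof.
move=> eta0 B0 gz s0 sz; pose E := 2 + 8 * c; pose e := 4 * c * kap / lR.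
have c4 : 2 <= 4 * c by apply: (@le_trans _ _ (4 * 1)); [rewrite mulr1 ler_nat | exact: ler_wpM2l c1].
have E1 : 1 <= E by rewrite /E -[leLHS]addr0; apply: lerD; [rewrite ler1n | apply: mulr_ge0 => //; exact: le_trans c1].
have c0 : 0 <= c by exact: le_trans c1.
have k0 : 0 <= kap by exact: le_trans kap1.
have e0 : 0 <= e by rewrite /e; apply: mulr_ge0; [apply: mulr_ge0 => //; apply: mulr_ge0 | rewrite invr_ge0 ltW].
have X0 : 0 <= eta + m%:R * B * e by apply: addr_ge0 => //; apply: mulr_ge0 => //; apply: mulr_ge0.
have F1 : \sum_(z : {ffun 'I_m -> 'I_Q}) \prod_i fejer Q (y i - gridpt (z i)) = 1.
  rewrite -(bigA_distr_bigA (fun i z => fejer Q (y i - gridpt z))) /= big1 // => i _.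
  exact: sum_fejer_grid.
have P0 (z : {ffun 'I_m -> 'I_Q}) : 0 <= \prod_i fejer Q (y i - gridpt (z i)).
  by apply: prodr_ge0 => i _; exact: fejer_ge0.
have -> : g0 - \sum_(z : {ffun 'I_m -> 'I_Q}) g z * \prod_i fejer Q (y i - gridpt (z i)) =
  \sum_(z : {ffun 'I_m -> 'I_Q}) (g0 - g z) * \prod_i fejer Q (y i - gridpt (z i)).
  under [RHS]eq_bigr => z _ do rewrite mulrBl.
  by rewrite sumrB -[X in _ = X - _]mulr_sumr F1 mulr1.
apply: (le_trans (ler_norm_sum _ _ _)).
have -> : \sum_(z : {ffun 'I_m -> 'I_Q}) `|(g0 - g z) * \prod_i fejer Q (y i - gridpt (z i))| =
    \sum_(z : {ffun 'I_m -> 'I_Q}) `|g0 - g z| * \prod_i fejer Q (y i - gridpt (z i)).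
  by apply: eq_bigr => z _; rewrite normrM [X in _ * X]ger0_norm.
have -> : (c * (2 + 8 * c)) ^+ m * (eta + m%:R * B * (4 * c * kap / lR)) * \prod_i dblfejer N (y i) =
    c ^+ m * \prod_i dblfejer N (y i) * (E ^+ m * (eta + m%:R * B * e)).
  by rewrite exprMn -/E -/e; ring.
have [g00|g0n] := eqVneq g0 0; last first.
  apply: (@le_trans _ _ (E ^+ m * (eta + m%:R * B * e))).
    apply: (@le_trans _ _ (1 ^+ m * (eta + m%:R * B * e))); last first.
      by apply: ler_wpM2r => //; rewrite expr1n exprn_ege1.
    apply: (le_trans _ (@sum_prod_weight R m Q (fun i z => fejer Q (y i - gridpt z))
      (fun i z => delta < wt N (y i - gridpt z)) 1 e eta B _ _ _ _ _ _)) => //.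
    - by apply: ler_sum => z _; rewrite mulrC ler_wpM2l.
    - by move=> i z; exact: fejer_ge0.
    - by move=> i; rewrite sum_fejer_grid.
    move=> i; apply: (le_trans (sum_fejer_far _)); rewrite /e.
    apply: ler_wpM2r; first by rewrite invr_ge0 ltW.
    by apply: ler_wpM2r c4; exact: le_trans kap1.
  apply: ler_peMl; first by apply: mulr_ge0 => //; apply: exprn_ge0; exact: le_trans E1.
  rewrite -[m in c ^+ m]card_ord -prodr_const -big_split /=.
  apply: (@le_trans _ _ (\prod_(i < m) 1)); first by rewrite big1.
  by apply: ler_prod => i _; rewrite ler01 /=; apply: near_le; exact: s0.
have H0 : 0 <= c ^+ m * \prod_i dblfejer N (y i).
  apply: mulr_ge0; first exact: exprn_ge0.
  by apply: prodr_ge0 => i _; exact: dblfejer_ge0.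
apply: (@le_trans _ _ (c ^+ m * \prod_i dblfejer N (y i) *
   \sum_(z : {ffun 'I_m -> 'I_Q}) (\prod_i a (y i) (z i)) *
     (eta + B * \sum_i (delta < wt N (y i - gridpt (z i)))%R%:R))); last first.
  apply: ler_wpM2l => //.
  apply: (@sum_prod_weight R m Q (fun i z => a (y i) z) (fun i z => delta < wt N (y i - gridpt z)) E e eta B _ E1 _ _ eta0 B0).
  - by move=> i z; exact: a_ge0.
  - by move=> i; exact: sum_a.
  by move=> i; exact: sum_a_far.
rewrite mulr_sumr; apply: ler_sum => z _.
have A0 : 0 <= \prod_i a (y i) (z i) by apply: prodr_ge0 => i _; exact: a_ge0.
have W0 : 0 <= eta + B * \sum_i (delta < wt N (y i - gridpt (z i)))%R%:R.
  by rewrite addr_ge0 // mulr_ge0 // sumr_ge0.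
have [gz0|gzn] := eqVneq (g z) 0.
  rewrite g00 gz0 subrr normr0 mul0r; apply: mulr_ge0; first exact: H0.
  exact: mulr_ge0.
rewrite mulrA [leRHS]mulrC; apply: ler_pM => //.
rewrite -[m in c ^+ m]card_ord -prodr_const -!big_split /=; apply: ler_prod => i _.
rewrite fejer_ge0 /= /a /supp (sz z gzn i) mulr1.
rewrite [leRHS]mulrC -mulrA -[leLHS]mulr1 ler_wpM2l ?fejer_ge0 //.
by apply: shift_le; rewrite opprB addrC subrK sz.
Qed.
End Kernel.

(** * Variance and almost everywhere convergence *)

(** The sine sums vanish, so each factor is a sum of complex exponentials; these multiply, and the
    real part is read off at the end. *)
Lemma prod_sum_cos (R : realType) (m : nat) (P : finType) (a : 'I_m -> P -> R) :
  (forall i, \sum_p sin (a i p) = 0) ->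
  \prod_i \sum_p cos (a i p) = \sum_(F : {ffun 'I_m -> P}) cos (\sum_i a i (F i)).
Proof.
move=> a0; pose e (t : R) := complex.Complex (cos t) (sin t).
have sumE (I : finType) (f g : I -> R) :
    \sum_i complex.Complex (f i) (g i) = complex.Complex (\sum_i f i) (\sum_i g i).
  by elim/big_ind3: _ => // x1 x2 x3 y1 y2 y3 -> ->.
have eD : {morph e : x y / x + y >-> x * y}.
  by move=> x y; rewrite /e cosD sinD [sin x * _ + _]addrC.
have e0 : e 0 = 1 by rewrite /e cos0 sin0.
have : \prod_i \sum_p e (a i p) = \sum_(F : {ffun 'I_m -> P}) e (\sum_i a i (F i)).
  by rewrite bigA_distr_bigA; apply: eq_bigr => F _; rewrite (big_morph e eD e0).
rewrite sumE; under eq_bigr => i _ do rewrite sumE a0.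
have -> : \prod_i complex.Complex (\sum_p cos (a i p)) 0 = complex.Complex (\prod_i \sum_p cos (a i p)) 0.
  elim/big_ind2: _ => // x1 x2 y1 y2 -> ->.
  by congr complex.Complex; rewrite ?mulr0 ?mul0r ?subr0 ?addr0.
by case.
Qed.

Section Variance.
Variable R : realType.
Notation mu := (@lebesgue_measure R).

Lemma is_derive_bigsum (I : Type) (r : seq I) (P : pred I) (f : I -> R -> R) (df : I -> R) (x : R) :
  (forall i, is_derive x 1 (f i) (df i)) ->
  is_derive x 1 (fun t => \sum_(i <- r | P i) f i t) (\sum_(i <- r | P i) df i).
Proof.
move=> h; elim: r => [|i r IH].
  rewrite big_nil (_ : (fun _ => _) = cst 0); first exact: is_derive_cst.
  by apply/funext => t; rewrite big_nil.
rewrite big_cons; under eq_fun => t do rewrite big_cons.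
by case: (P i) => //; exact: is_deriveD.
Qed.

Definition antider (k : int) (c t : R) : R :=
  if k == 0 then t * cos c else (2 * pi * k%:~R)^-1 * sin (2 * pi * k%:~R * t + c).

Lemma is_derive_antider k c (t : R) : is_derive t 1 (antider k c) (cos (2 * pi * k%:~R * t + c)).
Proof.
rewrite /antider; have [->|k0] := eqVneq k 0.
  rewrite mulr0 mul0r add0r (_ : (fun t => _) = cos c \*: id); last first.
    by apply/funext => x; rewrite /= mulrC.
  by apply: is_derive_eq; rewrite -[_ *: _]/(_ * _) mulr1.
set w := 2 * pi * k%:~R.
have w0 : w != 0 by rewrite /w !mulf_neq0 ?pnatr_eq0 ?intr_eq0 // gt_eqF ?pi_gt0.
have h1 : is_derive t 1 (fun x => w * x + c) w.
  rewrite (_ : (fun x => _) = w \*: id + cst c); last by apply/funext.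
  by apply: is_derive_eq; rewrite addr0 -[_ *: _]/(_ * _) mulr1.
have h2 : is_derive t 1 (sin \o (fun x => w * x + c)) (w * cos (w * t + c)).
  by rewrite mulrC; apply: is_derive1_comp.
rewrite (_ : (fun t => _) = w^-1 \*: (sin \o (fun x => w * x + c))); last by apply/funext.
by apply: is_derive_eq; rewrite -[_ *: _]/(_ * _) mulrA mulVf // mul1r.
Qed.

(** With integer [K] the interval is a whole number of periods of every nonzero integer frequency,
    whose integral is therefore 0. *)
Lemma antider_diff k c (K : nat) :
  antider k c K%:R - antider k c (- K%:R) <= 2 * K%:R * (k == 0)%R%:R.
Proof.
rewrite /antider; case: (k == 0) => /=.
  have := ler_wpM2l (ler0n R K) (cos_le1 c); lra.
rewrite mulr0 -mulrBr; set w := 2 * pi * k%:~R.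
suff -> : sin (w * K%:R + c) = sin (w * - K%:R + c) by rewrite subrr mulr0.
rewrite -cosBpihalf -[RHS]cosBpihalf -[RHS](cos_int_2pi (k * (2 * K%:Z))); congr cos.
by rewrite !rmorphM /= -!pmulrn /w; ring.
Qed.

Lemma continuous_sum_cos (T : finType) (A : pred T) (k : T -> int) (c : T -> R) :
  continuous (fun t => \sum_(x | A x) cos (2 * pi * (k x)%:~R * t + c x) : R).
Proof.
move=> t; have d1 (x : T) : is_derive t 1 (fun t => cos (2 * pi * (k x)%:~R * t + c x) : R)
    (- sin (2 * pi * (k x)%:~R * t + c x) * (2 * pi * (k x)%:~R)).
  apply: (@is_derive1_comp _ cos (fun t => 2 * pi * (k x)%:~R * t + c x)).
  rewrite (_ : (fun t => _) = (2 * pi * (k x)%:~R) \*: id + cst (c x)); last by apply/funext.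
  by apply: is_derive_eq; rewrite addr0 -[_ *: _]/(_ * _) mulr1.
apply: differentiable_continuous; apply/derivable1_diffP.
exact: (@ex_derive _ _ _ _ _ _ _ (is_derive_bigsum (index_enum T) A d1)).
Qed.

Lemma continuous_sqr_cos (T : finType) (A : pred T) (k : T -> int) (c : T -> R) :
  continuous (fun t => (\sum_(x | A x) cos (2 * pi * (k x)%:~R * t + c x)) ^+ 2 : R).
Proof.
by move=> t; under eq_fun => s do rewrite expr2; apply: cvgM; exact: continuous_sum_cos.
Qed.

Lemma integral_sqr_cos (T : finType) (A : pred T) (k : T -> int) (c : T -> R) (K : nat) : (0 < K)%N ->
  (\int[mu]_(t in `[(- K%:R)%R, K%:R]) ((\sum_(x | A x) cos (2 * pi * (k x)%:~R * t + c x)) ^+ 2)%:E <=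
  (K%:R * ((\sum_(x | A x) \sum_(y | A y) (k x + k y == 0)%R)%N%:R +
           (\sum_(x | A x) \sum_(y | A y) (k x - k y == 0)%R)%N%:R))%:E)%E.
Proof.
move=> K0; have K1 : (0 : R) < K%:R by rewrite ltr0n.
pose F t := \sum_(x | A x) \sum_(y | A y)
  (2^-1 * antider (k x + k y) (c x + c y) t + 2^-1 * antider (k x - k y) (c x - c y) t).
pose f t := (\sum_(x | A x) cos (2 * pi * (k x)%:~R * t + c x)) ^+ 2.
have dF (t : R) : is_derive t 1 (F : R -> R) (f t).
  have -> : f t = \sum_(x | A x) \sum_(y | A y)
      (2^-1 * cos (2 * pi * (k x + k y)%:~R * t + (c x + c y)) +
       2^-1 * cos (2 * pi * (k x - k y)%:~R * t + (c x - c y))).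
    rewrite /f expr2 mulr_suml; apply: eq_bigr => x _; rewrite mulr_sumr; apply: eq_bigr => y _.
    rewrite rmorphD rmorphB /=; move: ((k x)%:~R) ((k y)%:~R) => p q.
    have -> : 2 * pi * (p + q) * t + (c x + c y) = (2 * pi * p * t + c x) + (2 * pi * q * t + c y) by ring.
    have -> : 2 * pi * (p - q) * t + (c x - c y) = (2 * pi * p * t + c x) - (2 * pi * q * t + c y) by ring.
    move: (2 * pi * p * t + c x) (2 * pi * q * t + c y) => u v.
    by rewrite (cosB u v) (cosD u v); field.
  apply: is_derive_bigsum => x; apply: is_derive_bigsum => y.
  have h1 := is_derive_antider (k x + k y) (c x + c y) t.
  have h2 := is_derive_antider (k x - k y) (c x - c y) t.
  exact: (is_deriveD (is_deriveZ _ h1) (is_deriveZ _ h2)).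
have cF : continuous F.
  move=> t; apply: differentiable_continuous; apply/derivable1_diffP.
  exact: (@ex_derive _ _ _ _ _ _ _ (dF t)).
have cf : continuous f by exact: continuous_sqr_cos.
have KK : - K%:R < K%:R :> R by rewrite gtrN.
rewrite (_ : (\int[mu]_(t in _) _)%E = ((F K%:R)%:E - (F (- K%:R))%:E)%E); last first.
  apply: (@continuous_FTC2 _ f F) => //.
  - by apply: continuous_subspaceT.
  - split.
    + by move=> x _; exact: (@ex_derive _ _ _ _ _ _ _ (dF x)).
    + by apply: cvg_at_right_filter; exact: cF.
    + by apply: cvg_at_left_filter; exact: cF.
  - by move=> x _; rewrite derive1E; exact: derive_val.
rewrite -EFinB lee_fin /F -sumrB !natr_sum -big_split /= mulr_sumr.
apply: ler_sum => x _; rewrite -sumrB !natr_sum -big_split /= mulr_sumr.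
apply: ler_sum => y _.
have h1 := antider_diff (k x + k y) (c x + c y) K.
have h2 := antider_diff (k x - k y) (c x - c y) K.
lra.
Qed.
End Variance.

Section AlmostEverywhere.
Variable R : realType.
Notation mu := (@lebesgue_measure R).

Lemma sum_inv_sqr (n : nat) : \sum_(0 <= i < n) ((i.+1%:R : R) ^+ 2)^-1 <= 2.
Proof.
suff h k : \sum_(0 <= i < k.+1) ((i.+1%:R : R) ^+ 2)^-1 <= 2 - k.+1%:R^-1.
  case: n => [|k]; first by rewrite big_geq.
  by apply: (le_trans (h k)); rewrite gerBl invr_ge0.
elim: k => [|k IH]; first by rewrite big_nat1 expr1n invr1; lra.
rewrite big_nat_recr //=; apply: (le_trans (lerD IH (lexx _))).
have p : (0 : R) < k.+1%:R by rewrite ltr0n.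
have -> : (k.+2%:R : R) = k.+1%:R + 1 by rewrite natr1.
move: (k.+1%:R : R) p => x p; set a := (x + 1)^-1.
have a0 : 0 < a by rewrite invr_gt0; lra.
have ax : a * (x + 1) = 1 by rewrite mulVf // gt_eqF //; lra.
have bx : x^-1 * x = 1 by rewrite mulVf // gt_eqF.
have b0 : 0 < x^-1 by rewrite invr_gt0.
rewrite -exprVn -/a; move: (x^-1) bx b0 => b bx b0.
have -> : b = a + a * b.
  by have := congr1 (fun t => t * b) ax; rewrite -[RHS]mul1r -ax; move: bx; nra.
have : a <= b by nra.
nra.
Qed.

(** The series of squares has a finite integral, so it converges almost everywhere and its terms
    tend to 0. *)
Lemma ae_cvg0_itv (Y : nat -> R -> R) (K C : R) :
  (forall n, continuous (Y n)) ->
  (forall n, (\int[mu]_(x in `[(- K)%R, K]) ((Y n x) ^+ 2)%:E <= (C / n.+1%:R ^+ 2)%:E)%E) ->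
  {ae mu, forall x, x \in `[- K, K] -> (fun n => Y n x) @ \oo --> (0 : R)}.
Proof.
move=> cY iY; pose D : set R := `[- K, K]%classic.
have mD : measurable D by exact: measurable_itv.
have mY n : measurable_fun D (EFin \o (fun x => (Y n x) ^+ 2)).
  apply/measurable_EFinP; apply: measurable_funTS.
  apply: continuous_measurable_fun => x; under eq_fun => s do rewrite expr2.
  by apply: cvgM; exact: cY.
have Y0 n x : D x -> (0 <= ((Y n x) ^+ 2)%:E)%E by rewrite lee_fin sqr_ge0.
pose g x := (\sum_(0 <= n <oo) ((Y n x) ^+ 2)%:E)%E.
have C0 : 0 <= C.
  have := le_trans (integral_ge0 mu (Y0 0%N)) (iY 0%N).
  by rewrite expr1n divr1 lee_fin.
have gi : mu.-integrable D g.
  apply/integrableP; split.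
    by apply: ge0_emeasurable_sum => [k x Dx _|k _]; [exact: Y0|exact: mY].
  under eq_integral => x _.
    rewrite gee0_abs; last by apply: nneseries_ge0 => n _ _; rewrite lee_fin sqr_ge0.
    over.
  rewrite integral_nneseries //; apply: (@le_lt_trans _ _ (C * 2)%:E); last exact: ltry.
  apply: lime_le.
    by apply: is_cvg_nneseries => n _ _; apply: integral_ge0; exact: Y0.
  apply: nearW => n.
  apply: (@le_trans _ _ (\sum_(0 <= i < n) (C / i.+1%:R ^+ 2)%:E)%E).
    by apply: lee_sum => i _; exact: iY.
  by rewrite sumEFin lee_fin -mulr_sumr ler_wpM2l // sum_inv_sqr.
have := @integrable_ae _ _ _ mu D mD g gi; apply: filterS => x h Dx.
have gf := h Dx.
have cs : cvgn (series (fun n => Y n x ^+ 2)).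
  apply: nondecreasing_is_cvgn.
    by apply/nondecreasing_seqP => n; rewrite /series /= big_nat_recr //= lerDl sqr_ge0.
  exists (fine (g x)) => _ [n _ <-]; rewrite -lee_fin fineK // /series /= -sumEFin.
  by apply: nneseries_lim_ge => i _ _; rewrite lee_fin sqr_ge0.
have := cvg_series_cvg_0 cs => /cvgrPdist_lt c0; apply/cvgrPdist_lt => e e0.
have := c0 (e ^+ 2) (exprn_gt0 _ e0); apply: filterS => n.
rewrite !sub0r !normrN normrX ltr_pXn2r ?nnegrE // ltW //.
Qed.

Lemma ae_cvg0 (Y : nat -> R -> R) (C : nat -> R) :
  (forall n, continuous (Y n)) ->
  (forall K n, (0 < K)%N ->
     (\int[mu]_(x in `[(- K%:R)%R, K%:R]) ((Y n x) ^+ 2)%:E <= (C K / n.+1%:R ^+ 2)%:E)%E) ->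
  {ae mu, forall x, (fun n => Y n x) @ \oo --> (0 : R)}.
Proof.
move=> cY iY; have : {ae mu, forall x, forall K : nat, x \in `[- K.+1%:R, K.+1%:R] ->
    (fun n => Y n x) @ \oo --> (0 : R)}.
  by apply: ae_foralln => K; apply: (@ae_cvg0_itv Y K.+1%:R (C K.+1)) => // n; exact: iY.
apply: filterS; first exact: (ae_filter_ringOfSetsType mu).
move=> x h; apply: (h (Num.trunc `|x|)).
rewrite /= in_itv /= -ler_norml; apply: ltW; exact: truncnS_gt.
Qed.
End AlmostEverywhere.

Section Correlation.
Variable R : realType.
Notation mu := (@lebesgue_measure R).

Lemma prod_fejer (m Q : nat) (y : 'I_m -> R) :
  \prod_i fejer Q (y i) = (Q%:R ^+ 2) ^- m *
    \sum_(F : {ffun 'I_m -> 'I_Q * 'I_Q}) cos (\sum_i 2 * pi * (udiff F i)%:~R * y i).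
Proof.
rewrite big_split /= prodr_const card_ord exprVn; congr (_ * _).
rewrite (prod_sum_cos (a := fun (i : 'I_m) (p : 'I_Q * 'I_Q) => 2 * pi * ((p.1)%:R - (p.2)%:R) * y i)); last first.
  move=> i; set s := \sum_p _; suff : s = - s by lra.
  rewrite {1}/s (reindex_inj (h := fun p : 'I_Q * 'I_Q => (p.2, p.1))) /=; last by move=> [? ?] [? ?] [-> ->].
  by rewrite /s -sumrN; apply: eq_bigr => p _; rewrite -sinN; congr sin; ring.
by apply: eq_bigr => F _; congr cos; apply: eq_bigr => i _; rewrite /udiff rmorphB.
Qed.

(** A smoothed count of gaps close to [th i / N], at the finer scale [1 / (lam * N)]. The kernels
    have period 1, so no fractional parts appear. *)
Definition corrX (m N lam d : nat) (th : 'I_m -> R) (alpha : R) : R :=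
  N%:R^-1 * \sum_(n : {ffun 'I_m.+1 -> 'I_N} | injectiveb n)
    \prod_i fejer (lam * N) (alpha * (gap d n i)%:~R - th i / N%:R).

Section Fixed.
Variables (m N lam d : nat) (th : 'I_m -> R).
Hypothesis N0 : (0 < N)%N.
Hypothesis lam0 : (0 < lam)%N.
Notation Q := (lam * N)%N.
Let T := ({ffun 'I_m.+1 -> 'I_N} * {ffun 'I_m -> 'I_Q * 'I_Q})%type.
Let cst_ : R := N%:R^-1 * (Q%:R ^+ 2) ^- m.
Let phase (x : T) : R := - \sum_i 2 * pi * (udiff x.2 i)%:~R * (th i / N%:R).
Let A (x : T) := injectiveb x.1 && offdiag x.2.

(** The contribution of the [Q ^ m] diagonal tuples of pairs, whose cosines are all 1, over the
    [N ^_ m.+1] injective [n]. *)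
Definition meanX : R := N%:R^-1 * (N ^_ m.+1)%:R * Q%:R ^- m.

Let Qn : (Q%:R : R) != 0. Proof. by rewrite pnatr_eq0 -lt0n muln_gt0 lam0. Qed.

Lemma card_diag : #|[pred F : {ffun 'I_m -> 'I_Q * 'I_Q} | ~~ offdiag F]| = (Q ^ m)%N.
Proof.
pose h (G : {ffun 'I_m -> 'I_Q}) : {ffun 'I_m -> 'I_Q * 'I_Q} := [ffun i => (G i, G i)].
have hi : injective h.
  by move=> G G' e; apply/ffunP => i; have /ffunP/(_ i) := e; rewrite !ffunE => -[].
rewrite -[in RHS](card_ord Q) -[in RHS](card_ord m) -card_ffun -[RHS](card_imset _ hi) -cardsE.
apply: eq_card => F; rewrite !inE; apply/idP/imsetP => [|[G _ ->]].
  rewrite negb_exists => /forallP e; exists [ffun i => (F i).1] => //.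
  by apply/ffunP => i; rewrite !ffunE; have := e i; rewrite negbK; case: (F i) => a b /= /eqP ->.
by rewrite negb_exists; apply/forallP => i; rewrite ffunE negbK.
Qed.

Lemma corrX_expand (alpha : R) :
  corrX N lam d th alpha - meanX =
  cst_ * \sum_(x | A x) cos (2 * pi * (freq d x.1 x.2)%:~R * alpha + phase x).
Proof.
rewrite /corrX; under eq_bigr => n _ do rewrite prod_fejer.
rewrite -mulr_sumr mulrA -/cst_.
have -> : meanX = cst_ * \sum_(x : T | injectiveb x.1 && ~~ offdiag x.2) 1.
  rewrite (eq_bigl (fun x : T => [pred n | injectiveb n] x.1 && [pred F | ~~ offdiag F] x.2)) //.
  rewrite -(pair_big [pred n : {ffun 'I_m.+1 -> 'I_N} | injectiveb n]
     [pred F : {ffun 'I_m -> 'I_Q * 'I_Q} | ~~ offdiag F] (fun _ _ => 1)) /=.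
  under eq_bigr => n _ do rewrite sumr_const card_diag.
  rewrite sumr_const -cardsE card_inj_ffuns !card_ord /meanX /cst_ -mulrnA -!mulrA; congr (_ * _).

  rewrite [X in _ = _ * X](_ : _ = Q%:R ^+ m * (N ^_ m.+1)%:R); last by rewrite (natrM R (Q ^ m)%N (N ^_ m.+1)) natrX.
  by move: Qn; move: (Q%:R : R) => q qn; rewrite -exprM mul2n -addnn exprD; field; rewrite expf_neq0.
rewrite -mulrBr; congr (_ * _).
rewrite (pair_big [pred n : {ffun 'I_m.+1 -> 'I_N} | injectiveb n] xpredT
  (fun n F => cos (\sum_i 2 * pi * (udiff F i)%:~R * (alpha * (gap d n i)%:~R - th i / N%:R)))) /=.
rewrite (bigID (fun x : T => offdiag x.2)) /= -addrA.
have arg (x : T) : \sum_i 2 * pi * (udiff x.2 i)%:~R * (alpha * (gap d x.1 i)%:~R - th i / N%:R) =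
    2 * pi * (freq d x.1 x.2)%:~R * alpha + phase x.
  rewrite /phase -sumrN /freq rmorph_sum /= mulr_sumr mulr_suml -big_split /=.
  by apply: eq_bigr => i _; rewrite rmorphM /=; ring.
rewrite [X in _ + X](_ : _ = 0) ?addr0.
  by apply: eq_big => x; rewrite ?andbT // arg.
apply/eqP; rewrite subr_eq0; apply/eqP; apply: eq_big => x; first by rewrite andbT.
rewrite andbT => /andP [_]; rewrite negb_exists => /forallP e.
rewrite big1 ?cos0 // => i _; rewrite /udiff.
by have := e i; rewrite negbK => /eqP ->; rewrite subrr mulr0 mul0r.
Qed.

(** The squared constant is [N ^ -2 * Q ^ (-4 * m)] and the frequency counts bring [Q ^ (2 * m)]
    times the number of solutions. After the bound [C0 * N ^ (2 * m.+1) / M ^ 2] all powers of [N]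
    cancel. *)
Lemma corrX_variance (K M C0 : nat) : (0 < K)%N -> (0 < M)%N ->
  (M ^ 2 * \sum_(n : {ffun 'I_m.+1 + 'I_m.+1 -> 'I_N} | inj_sides (@side2 m) n)
     #|nzsols (@side2 m) (2 * Q) d n| <= C0 * N ^ (2 * m.+1))%N ->
  (\int[mu]_(t in `[(- K%:R)%R, K%:R]) ((corrX N lam d th t - meanX) ^+ 2)%:E <=
    ((2 * K * C0)%:R / M%:R ^+ 2)%:E)%E.
Proof.
move=> K0 M0 hC; set S := (\sum_(n : {ffun _ -> _} | _) _)%N in hC.
under eq_integral => t _ do rewrite corrX_expand exprMn EFinM.
have mS : measurable_fun (`[(- K%:R)%R, K%:R]%classic : set R)
    (EFin \o (fun t : R => (\sum_(x | A x) cos (2 * pi * (freq d x.1 x.2)%:~R * t + phase x)) ^+ 2)).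
  apply/measurable_EFinP; apply: measurable_funTS.
  apply: continuous_measurable_fun; exact: continuous_sqr_cos.
rewrite ge0_integralZl_EFin //; last by rewrite sqr_ge0.
  2: by move=> t _; rewrite lee_fin sqr_ge0.
apply: le_trans (_ : (cst_ ^+ 2)%:E * (K%:R * ((2 * ((Q ^ m) ^ 2 * S))%N%:R))%:E <= _)%E.
  apply: lee_wpmul2l; first by rewrite lee_fin sqr_ge0.
  apply: (le_trans (integral_sqr_cos _ _ _ K0)); rewrite lee_fin ler_wpM2l //.
  rewrite -natrD ler_nat mul2n -addnn; apply: leq_add; [exact: count_freq_opp | exact: count_freq_eq].
rewrite -EFinM lee_fin ler_pdivlMr ?exprn_gt0 ?ltr0n //.
have N1 : (0 : R) < N%:R by rewrite ltr0n.
have l1 : (0 : R) < lam%:R by rewrite ltr0n.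
have hR : (M%:R ^+ 2 * S%:R : R) <= C0%:R * N%:R ^+ (2 * m.+1).
  by rewrite -!natrX -!natrM ler_nat.
have -> : cst_ ^+ 2 * (K%:R * (2 * ((Q ^ m) ^ 2 * S))%N%:R) * M%:R ^+ 2 =
    (2 * K%:R * (N%:R^-1 ^+ 2 * (Q%:R ^- m) ^+ 2)) * (M%:R ^+ 2 * S%:R).
  rewrite (natrM R 2 ((Q ^ m) ^ 2 * S)) (natrM R ((Q ^ m) ^ 2)) natrX natrX /cst_.
  move: Qn; move: (Q%:R : R) => q qn; rewrite -exprM mulnC exprM.
  have := expf_neq0 m qn; move: (q ^+ m) => u un; field.
  by rewrite un gt_eqF.
apply: (le_trans (ler_wpM2l _ hR)); first by rewrite !mulr_ge0 ?invr_ge0 ?sqr_ge0.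
have -> : 2 * K%:R * (N%:R^-1 ^+ 2 * (Q%:R ^- m) ^+ 2) * (C0%:R * N%:R ^+ (2 * m.+1)) =
   (2 * K * C0)%:R * (lam%:R ^- m) ^+ 2 :> R.
  rewrite !natrM mulnC exprM [N%:R ^+ m.+1]exprS [(lam%:R * N%:R) ^+ m]exprMn; have := expf_neq0 m (lt0r_neq0 l1).
  have := expf_neq0 m (lt0r_neq0 N1); move: (N%:R ^+ m) (lam%:R ^+ m) => u v un vn; field.
  by rewrite un vn gt_eqF.
rewrite ler_piMr // exprn_ile1 ?invr_ge0 ?exprn_ge0 // invf_le1 ?exprn_gt0 //.
by rewrite exprn_ege1 // ler1n.
Qed.

Lemma continuous_corrX : continuous (fun t => corrX N lam d th t - meanX).
Proof.
have -> : (fun t => corrX N lam d th t - meanX) = (fun t : R => cst_ *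
    \sum_(x | A x) cos (2 * pi * (freq d x.1 x.2)%:~R * t + phase x)).
  by apply/funext => t; exact: corrX_expand.
by move=> t; apply: cvgMr; exact: continuous_sum_cos.
Qed.
End Fixed.

Lemma ffact_ratio (N k : nat) : (0 < N)%N ->
  (1 : R) - (k ^ 2)%:R / N%:R <= ((N ^_ k)%:R / N%:R ^+ k : R) <= 1.
Proof.
move=> N0; have p : (0 : R) < N%:R by rewrite ltr0n.
elim: k => [|k /andP [IH1 IH2]]; first by rewrite ffactn0 expr0 divr1 mul0r subr0 lexx.
have r0 : 0 <= (N ^_ k)%:R / N%:R ^+ k :> R by rewrite divr_ge0 ?exprn_ge0.
have -> : (N ^_ k.+1)%:R / N%:R ^+ k.+1 = ((N ^_ k)%:R / N%:R ^+ k : R) * ((N - k)%N%:R / N%:R).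
  rewrite ffactnSr natrM exprSr; have := expf_neq0 k (lt0r_neq0 p); move: (N%:R ^+ k) => u un.
  by field; rewrite un gt_eqF.
move: ((N ^_ k)%:R / N%:R ^+ k : R) IH1 IH2 r0 => r IH1 IH2 r0.
have h1 : 1 - k%:R / N%:R <= (N - k)%N%:R / N%:R :> R.
  have [kN|Nk] := leqP k N; first by rewrite natrB // mulrBl divff // gt_eqF.
  rewrite (_ : (N - k)%N = 0%N) ?mul0r; last by lia.
  by rewrite subr_le0 ler_pdivlMr // mul1r ler_nat ltnW.
have h2 : (N - k)%N%:R / N%:R <= 1 :> R by rewrite ler_pdivrMr // mul1r ler_nat leq_subr.
have h3 : 0 <= (N - k)%N%:R / N%:R :> R by rewrite divr_ge0.
move: h1 h2 h3; move: ((N - k)%N%:R / N%:R : R) => s h1 h2 h3; apply/andP; split; last first.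
  by rewrite -[leRHS]mulr1; apply: ler_pM.
have kk : (k.+1 ^ 2)%:R / N%:R = (k ^ 2)%:R / N%:R + 2 * (k%:R / N%:R) + N%:R^-1 :> R.
  have -> : (k.+1 ^ 2 = k ^ 2 + 2 * k + 1)%N by ring.
  by rewrite !natrD natrM; field; rewrite gt_eqF.
have kN0 : 0 <= k%:R / N%:R :> R by rewrite divr_ge0.
have N10 : 0 <= N%:R^-1 :> R by rewrite invr_ge0.
rewrite kk; move: (N%:R^-1 : R) (k%:R / N%:R : R) ((k ^ 2)%:R / N%:R : R) IH1 h1 kN0 N10 => e a b IH1 h1 a0 e0.
have : 0 <= (1 - r) * (1 - s) by rewrite mulr_ge0 // subr_ge0.
have := ler_wpM2r a0 IH2; lra.
Qed.

Lemma meanX_cvg (m lam A : nat) : (0 < lam)%N -> (0 < A)%N ->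
  (fun M => meanX m (M.+1 ^ A) lam) @ \oo --> (lam%:R ^- m : R).
Proof.
move=> lam0 A0; have l1 : (0 : R) < lam%:R by rewrite ltr0n.
have E M : meanX m (M.+1 ^ A) lam = ((M.+1 ^ A) ^_ m.+1)%:R / (M.+1 ^ A)%:R ^+ m.+1 * lam%:R ^- m.
  have p : (0 : R) < (M.+1 ^ A)%:R by rewrite ltr0n expn_gt0.
  rewrite /meanX [(lam * _)%:R]natrM exprMn [_ ^+ m.+1]exprS.
  have := expf_neq0 m (lt0r_neq0 l1); have := expf_neq0 m (lt0r_neq0 p).
  move: (lam%:R ^+ m) (_%:R ^+ m) => v u un vn; field; by rewrite un vn gt_eqF.
rewrite (_ : (fun M => _) = fun M => ((M.+1 ^ A) ^_ m.+1)%:R / (M.+1 ^ A)%:R ^+ m.+1 * lam%:R ^- m); last first.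
  by apply/funext => M; exact: E.
rewrite -[X in _ --> X]mul1r; apply: cvgMl.
apply: (@squeeze_cvgr _ _ _ _ (fun M => 1 - (m.+1 ^ 2)%:R * M.+1%:R^-1) (fun=> 1)).
- apply: nearW => M; have /andP [h1 h2] := @ffact_ratio (M.+1 ^ A) m.+1 (expn_gt0 _ _).
  rewrite h2 andbT; apply: le_trans h1; rewrite lerD2l lerN2 ler_wpM2l // lef_pV2 ?posrE ?ltr0n ?expn_gt0 //.
  by rewrite ler_nat -{1}(expn1 M.+1) leq_pexp2l.
- rewrite -[X in _ --> X]subr0 -[X in _ --> _ - X](mulr0 (m.+1 ^ 2)%:R).
  by apply: cvgB; [exact: cvg_cst | apply: cvgMr; exact: cvg_harmonic].
exact: cvg_cst.
Qed.

Lemma corrX_ae (m d lam : nat) (th : 'I_m -> R) : (3 <= m.+1)%N ->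
  ((2 * m.+1) ^ (4 * m.+1) < d)%N -> (0 < lam)%N ->
  {ae mu, forall x, (fun M => corrX (M.+1 ^ exponent m.+1) lam d th x) @ \oo --> (lam%:R ^- m : R)}.
Proof.
move=> m3 dl lam0; pose A := exponent m.+1.
have A0 : (0 < A)%N by [].
have cJ : #|{: 'I_m.+1 + 'I_m.+1}| = (2 * m.+1)%N by rewrite card_sum card_ord mul2n addnn.
(* [wdiff] is bounded by [2 * Q = 2 * lam * N]. *)
have w0 : (0 < 2 * lam)%N by rewrite muln_gt0.
have [C0 hC] := @count_solutions_large _ (@side2 m) m.+1 d (2 * lam) m3 cJ dl w0.
have N0 M : (0 < M.+1 ^ A)%N by rewrite expn_gt0.
have := @ae_cvg0 R (fun M t => corrX (M.+1 ^ A) lam d th t - meanX m (M.+1 ^ A) lam)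
  (fun K => (2 * K * C0)%:R) (fun M => @continuous_corrX m _ lam d th (N0 M) lam0) _.
move=> /(_ _) H; have {H} : {ae mu, forall x, (fun M => corrX (M.+1 ^ A) lam d th x - meanX m (M.+1 ^ A) lam) @ \oo --> (0 : R)}.
  apply: H => K M K0; apply: corrX_variance => //.
  apply: hC => //; by rewrite mulnA.
apply: filterS; first exact: (ae_filter_ringOfSetsType mu).
move=> x h; rewrite -[X in _ --> X]add0r.
rewrite (_ : (fun M => _) = fun M => (corrX (M.+1 ^ A) lam d th x - meanX m (M.+1 ^ A) lam) + meanX m (M.+1 ^ A) lam).
  by apply: cvgD => //; exact: meanX_cvg.
by apply/funext => M; rewrite subrK.
Qed.
End Correlation.

(** * Compactly supported test functions *)

Section Periodization.
Variables (R : realType) (m : nat).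
Implicit Types (f : 'rV[R]_m -> R) (y : 'I_m -> R) (T eta delta B : R).

Definition box_supp f (r : nat) := forall x, f x != 0 -> forall i, `|x ord0 i| < r%:R.
Definition modulus f eta delta :=
  forall x y : 'rV[R]_m, (forall i, `|x ord0 i - y ord0 i| <= delta) -> `|f x - f y| <= eta.

(** The scale [T] is kept apart from the number of points, so that either can vary while the other
    is frozen. *)
Definition periodize f T y : R :=
  \sum_(k \in [set: 'rV[int]_m]) f (\row_i (T * (y i + (k ord0 i)%:~R))).

(** A second contributing [k] would differ from [k0] by less than 1 in each coordinate. The bound
    [1 - r / T], weaker than one half, also admits lifts that are not nearest to 0. *)
Lemma periodize_single f (r : nat) T y (k0 : 'rV[int]_m) : box_supp f r -> 0 < T ->
  (forall i, `|y i + (k0 ord0 i)%:~R| <= 1 - r%:R / T) ->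
  periodize f T y = f (\row_i (T * (y i + (k0 ord0 i)%:~R))).
Proof.
move=> fr T0 hk; rewrite /periodize -(fsbig_widen [set k0]) ?fsbig_set1 //.
move=> k [_ /= kk]; apply/eqP; apply: contraT => /fr h; exfalso; apply: kk.
apply/rowP => i; apply/eqP; rewrite -subr_eq0; apply: contraT => ki.
have := h i; have := hk i; rewrite mxE normrM (gtr0_norm T0) -ltr_pdivlMl // mulrC => h1 h2.
have : `|(k ord0 i - k0 ord0 i)%:~R : R| < 1.
  have -> : (k ord0 i - k0 ord0 i)%:~R = (y i + (k ord0 i)%:~R) - (y i + (k0 ord0 i)%:~R) :> R.
    by rewrite rmorphB /=; ring.
  apply: (le_lt_trans (ler_normB _ _)); lra.
rewrite -intr_norm -[1]/(1%:~R) ltr_int; move: ki; move: (_ - _) => u; lia.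
Qed.

Lemma periodize_rnd f r T y : box_supp f r -> 0 < T -> 2 * r%:R <= T ->
  periodize f T y = f (\row_i (T * (y i - (rnd (y i))%:~R))).
Proof.
move=> fr T0 rT; rewrite (@periodize_single f r T y (\row_i - rnd (y i))) //.
  by congr f; apply/rowP => i; rewrite !mxE rmorphN.
move=> i; rewrite mxE rmorphN /=; apply: (le_trans (rnd_le _)).
have : r%:R / T <= 2^-1 by rewrite ler_pdivrMr //; lra.
lra.
Qed.

Lemma periodize_supp f r T y (N : nat) : box_supp f r -> 0 < T -> 2 * r%:R <= T -> N%:R <= T ->
  periodize f T y != 0 -> forall i, wt N (y i) <= 4 * r%:R.
Proof.
move=> fr T0 rT NT; rewrite (periodize_rnd _ fr) // => /fr h i.
have := h i; rewrite mxE normrM (gtr0_norm T0) => h1.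
apply: (le_trans (wt_le _ _ (- rnd (y i)))); rewrite rmorphN /= mulrCA ler_wpM2l //.
by apply: ltW; apply: le_lt_trans h1; rewrite ler_wpM2r.
Qed.

Lemma periodize_close f r eta delta (N : nat) y g : box_supp f r -> modulus f eta delta ->
  (0 < N)%N -> 2 * (r%:R + delta) <= N%:R -> 0 <= delta ->
  (forall i, wt N (y i - g i) <= delta) ->
  `|periodize f N%:R y - periodize f N%:R g| <= eta.
Proof.
move=> fr fm N0 rN d0 h; have N1 : (0 : R) < N%:R by rewrite ltr0n.
pose j i := rnd (y i - g i).
have s i : N%:R * `|y i - g i - (j i)%:~R| <= delta by exact: le_trans (le_wt _ _) (h i).
rewrite (periodize_rnd _ fr) //; last by lra.
(* The lift of [g] next to the nearest-integer lift of [y]; near the boundary it may exceed one half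
   in absolute value. *)
rewrite (@periodize_single f r N%:R g (\row_i (j i - rnd (y i)))) //; last first.
  move=> i; rewrite mxE rmorphB /=.
  have -> : g i + ((j i)%:~R - (rnd (y i))%:~R) = (y i - (rnd (y i))%:~R) - (y i - g i - (j i)%:~R) by ring.
  apply: (le_trans (ler_normB _ _)); have := rnd_le (y i); have := s i.
  rewrite -ler_pdivlMl // mulrC => s1 s2.
  have : (r%:R + delta) / N%:R <= 2^-1 by rewrite ler_pdivrMr //; lra.
  rewrite mulrDl; lra.
apply: fm => i; rewrite !mxE -mulrBr normrM (gtr0_norm N1).
apply: le_trans (s i); rewrite le_eqVlt; apply/orP; left; apply/eqP; congr (_ * `|_|).
by rewrite rmorphB /=; ring.
Qed.

Lemma periodize_le f r T y B : box_supp f r -> 0 < T -> 2 * r%:R <= T ->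
  (forall x, `|f x| <= B) -> `|periodize f T y| <= B.
Proof. by move=> fr T0 rT fB; rewrite (periodize_rnd _ fr). Qed.

(* With [L = lam * r] the grid points [(w - L) / lam] fill the box [[-r, r[]. *)
Definition gridval (lam L : nat) (w : 'I_(2 * L)) : R := ((w%:R : R) - L%:R) / lam%:R.

Lemma sum_ffun_widen (V : zmodType) (a b : nat) (h : {ffun 'I_m -> 'I_b} -> V) (ab : (a <= b)%N) :
  (forall z, h z != 0 -> forall i, (z i < a)%N) ->
  \sum_z h z = \sum_(w : {ffun 'I_m -> 'I_a}) h [ffun i => widen_ord ab (w i)].
Proof.
move=> hz; pose e (w : {ffun 'I_m -> 'I_a}) : {ffun 'I_m -> 'I_b} := [ffun i => widen_ord ab (w i)].
have ei : injective e.
  move=> w w' ww; apply/ffunP => i; apply: val_inj.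
  by have /ffunP/(_ i) := ww; rewrite !ffunE => /(congr1 val).
rewrite (bigID (mem (e @: [set: _]%SET))) /= [X in _ + X]big1 ?addr0.
  by rewrite big_imset /=; [apply: eq_bigl => w; rewrite inE | move=> ? ? _ _; exact: ei].
move=> z; apply: contraNeq => /hz za; apply/imsetP.
exists [ffun i => Ordinal (za i)] => //; apply/ffunP => i; apply: val_inj.
by rewrite !ffunE.
Qed.

Section Approx.
Variables (f : 'rV[R]_m -> R) (r lam N : nat) (eta delta B : R).
Hypothesis fr : box_supp f r.
Hypothesis fm : modulus f eta delta.
Hypothesis fB : forall x, `|f x| <= B.
Hypothesis lam0 : (0 < lam)%N.
Hypothesis N0 : (0 < N)%N.
Hypothesis delta0 : 0 < delta.
Hypothesis eta0 : 0 <= eta.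
Hypothesis rN : 2 * (r%:R + delta) <= N%:R.
Notation L := (lam * r)%N.
Notation Q := (lam * N)%N.
Let c : R := (4 * r%:R + 2) ^+ 2.

(** The constant of [kernel_approx] with [rho = 4 * r], as provided by [periodize_supp], and with
    [2 * B] bounding the difference of any two values. *)
Definition approx_err : R :=
  (c * (2 + 8 * c)) ^+ m * (eta + m%:R * (2 * B) * (4 * c * (1 + 2 / delta) ^+ 2 / lam%:R)).

Lemma periodize_approx y :
  `|periodize f N%:R y - \sum_(w : {ffun 'I_m -> 'I_(2 * L)}) f (\row_i gridval lam (w i)) *
      \prod_i fejer Q (y i - gridval lam (w i) / N%:R)| <=
  approx_err * \prod_i dblfejer N (y i).
Proof.
have N1 : (0 : R) < N%:R by rewrite ltr0n.
have l1 : (0 : R) < lam%:R by rewrite ltr0n.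
have B0 : 0 <= B by apply: le_trans (fB 0); exact: normr_ge0.
have rN' : 2 * r%:R <= (N%:R : R) by move: delta0 rN; lra.
have rNn : (2 * r <= N)%N by rewrite -(ler_nat R) natrM.
have LQ : (2 * L <= Q)%N by rewrite mulnCA leq_mul2l rNn orbT.
pose g (z : {ffun 'I_m -> 'I_Q}) := periodize f N%:R (fun i => @gridpt R N lam L (z i)).
have gE z : g z = f (\row_i (((z i)%:R - L%:R) / lam%:R)).
  rewrite /g (@periodize_single f r N%:R _ 0) //.
    congr f; apply/rowP => i; rewrite !mxE addr0 /gridpt natrM; field.
    by rewrite !gt_eqF.
  move=> i; rewrite mxE addr0 /gridpt ler_norml.
  have Q1 : (0 : R) < Q%:R by rewrite ltr0n muln_gt0 lam0.
  have rQ : r%:R / N%:R = L%:R / Q%:R :> R by rewrite !natrM; field; rewrite !gt_eqF.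
  rewrite rQ; have z1 : (z i)%:R <= Q%:R :> R by rewrite ler_nat ltnW.
  have L2 : 2 * L%:R <= Q%:R :> R by rewrite -natrM ler_nat.
  have z0 : 0 <= (z i)%:R :> R by [].
  have -> : 1 - L%:R / Q%:R = (Q%:R - L%:R) / Q%:R :> R by rewrite mulrBl divff // gt_eqF.
  rewrite -mulNr !ler_pM2r ?invr_gt0 // opprB; apply/andP; split; lra.
have -> : \sum_(w : {ffun 'I_m -> 'I_(2 * L)}) f (\row_i gridval lam (w i)) *
      \prod_i fejer Q (y i - gridval lam (w i) / N%:R) =
   \sum_(z : {ffun 'I_m -> 'I_Q}) g z * \prod_i fejer Q (y i - @gridpt R N lam L (z i)).
  rewrite (@sum_ffun_widen _ _ _ _ LQ); last first.
    move=> z; rewrite mulf_eq0 negb_or gE => /andP [/fr h _] i; have := h i.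
    rewrite mxE normrM [`|_^-1|]gtr0_norm ?invr_gt0 // ltr_pdivrMr // -natrM ltr_norml.
    move=> /andP [_]; rewrite ltrBlDr -natrD ltr_nat; lia.
  apply: eq_bigr => w _; rewrite gE; congr (_ * _).
    by congr f; apply/rowP => i; rewrite !mxE ffunE.
  apply: eq_bigr => i _; congr fejer; rewrite ffunE /gridval /gridpt /= natrM; field.
  by rewrite !gt_eqF.
apply: kernel_approx => //.
- exact: mulr_ge0.
- move=> z; have [/forallP h|] := boolP [forall i, wt N (y i - @gridpt R N lam L (z i)) <= delta].
    apply: (le_trans (periodize_close fr fm N0 rN (ltW delta0) h)); rewrite lerDl.
    by apply: mulr_ge0; [exact: mulr_ge0 | exact: sumr_ge0].
  rewrite negb_forall; case/fintype.existsP => i; rewrite -ltNge => hi.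
  apply: (@le_trans _ _ (2 * B)).
    apply: (le_trans (ler_normB _ _)); have -> : 2 * B = B + B by ring.
    by apply: lerD; apply: (periodize_le _ fr).
  rewrite -[leLHS]add0r; apply: lerD => //; rewrite -[leLHS]mulr1 ler_wpM2l ?mulr_ge0 //.
  by rewrite (bigD1 i) //= hi lerDl sumr_ge0.
- by move=> h; exact: (periodize_supp fr N1 rN' (lexx _) h).
by move=> z h; exact: (periodize_supp fr N1 rN' (lexx _) h).
Qed.
End Approx.
End Periodization.

Lemma cvg_bigsum (R : realType) (I : Type) (s : seq I) (P : pred I) (u : I -> nat -> R) (l : I -> R) :
  (forall i, u i @ \oo --> l i) ->
  (fun n => \sum_(i <- s | P i) u i n) @ \oo --> \sum_(i <- s | P i) l i.
Proof.
move=> h; elim: s => [|i s IH].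
  rewrite big_nil (_ : (fun _ => _) = cst 0); first exact: cvg_cst.
  by apply/funext => n; rewrite big_nil.
rewrite big_cons; under eq_fun => n do rewrite big_cons.
by case: (P i) => //; exact: cvgD.
Qed.

(** * Convergence along the subsequence *)

Section Subsequence.
Variables (R : realType) (m d : nat).
Implicit Types (f : 'rV[R]_m -> R) (alpha : R).

Definition corrG f (N : nat) alpha : R :=
  N%:R^-1 * \sum_(n : {ffun 'I_m.+1 -> 'I_N} | injectiveb n)
    periodize f N%:R (fun i => alpha * (gap d n i)%:~R).

Definition avg_dbl (N : nat) alpha : R :=
  N%:R^-1 * \sum_(n : {ffun 'I_m.+1 -> 'I_N} | injectiveb n)
    \prod_i dblfejer N (alpha * (gap d n i)%:~R).

(** The shift [(2 * N)^-1] is [th / N] for [th = 1 / 2]. Expanding the product thus gives averages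
    [corrX] with [lam = 1], so the majorant converges by the same almost everywhere statement as the
    main term. *)
Lemma avg_dblE N alpha : (0 < N)%N ->
  avg_dbl N alpha = \sum_(b : {ffun 'I_m -> bool})
    corrX N 1 d (fun i => if b i then 2^-1 else 0) alpha.
Proof.
move=> N0; rewrite /corrX -mulr_sumr exchange_big /=; congr (_ * _); apply: eq_bigr => n _.
rewrite mul1n -(bigA_distr_bigA (fun i (b : bool) =>
   fejer N (alpha * (gap d n i)%:~R - (if b then 2^-1 else 0) / N%:R))) /=.
apply: eq_bigr => i _; rewrite big_bool /= mul0r subr0 addrC /dblfejer invfM //.
Qed.

Lemma corrG_approx f (r lam N : nat) eta delta B alpha :
  box_supp f r -> modulus f eta delta -> (forall x, `|f x| <= B) -> (0 < lam)%N -> (0 < N)%N ->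
  0 < delta -> 0 <= eta -> 2 * (r%:R + delta) <= N%:R ->
  `|corrG f N alpha - \sum_(w : {ffun 'I_m -> 'I_(2 * (lam * r))})
      f (\row_i gridval R lam (w i)) * corrX N lam d (fun i => gridval R lam (w i)) alpha| <=
  approx_err m r lam eta delta B * avg_dbl N alpha.
Proof.
move=> fr fm fB lam0 N0 d0 e0 rN.
have -> : \sum_(w : {ffun 'I_m -> 'I_(2 * (lam * r))})
      f (\row_i gridval R lam (w i)) * corrX N lam d (fun i => gridval R lam (w i)) alpha =
  N%:R^-1 * \sum_(n : {ffun 'I_m.+1 -> 'I_N} | injectiveb n)
   \sum_(w : {ffun 'I_m -> 'I_(2 * (lam * r))}) f (\row_i gridval R lam (w i)) *
     \prod_i fejer (lam * N) (alpha * (gap d n i)%:~R - gridval R lam (w i) / N%:R).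
  rewrite exchange_big /= mulr_sumr; apply: eq_bigr => w _.
  by rewrite /corrX mulrCA -mulr_sumr.
rewrite /corrG -mulrBr -sumrB normrM ger0_norm ?invr_ge0 // mulrCA ler_wpM2l ?invr_ge0 //.
rewrite mulr_sumr; apply: (le_trans (ler_norm_sum _ _ _)); apply: ler_sum => n _.
exact: periodize_approx.
Qed.

(** Rational shifts form a countable family, and they include all grid values and the shift one half
    of the majorant. *)
Definition good (A : nat) alpha := forall (lam : nat) (th : {ffun 'I_m -> rat}), (0 < lam)%N ->
  (fun M => corrX (M.+1 ^ A) lam d (fun i => ratr (th i)) alpha) @ \oo --> (lam%:R ^- m : R).

Lemma avg_dbl_cvg A alpha : good A alpha ->
  (fun M => avg_dbl (M.+1 ^ A) alpha) @ \oo --> (2 ^+ m : R).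
Proof.
move=> gd.
rewrite (_ : (fun M => _) = fun M => \sum_(b : {ffun 'I_m -> bool})
    corrX (M.+1 ^ A) 1 d (fun i => ratr ([ffun i => if b i then 2^-1 else 0 : rat] i)) alpha); last first.
  apply/funext => M; rewrite avg_dblE ?expn_gt0 //; apply: eq_bigr => b _; congr corrX.
  by apply/funext => i; rewrite ffunE; case: (b i); rewrite ?fmorphV ?rmorph_nat ?rmorph0.
have -> : (2 ^+ m : R) = \sum_(b : {ffun 'I_m -> bool}) 1%:R ^- m.
  by rewrite expr1n invr1 sumr_const card_ffun card_bool card_ord natrX.
by apply: cvg_bigsum => b; exact: gd.
Qed.

Definition riemann f (r lam : nat) : R :=
  lam%:R ^- m * \sum_(w : {ffun 'I_m -> 'I_(2 * (lam * r))}) f (\row_i gridval R lam (w i)).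

Lemma main_term_cvg f r lam A alpha : good A alpha -> (0 < lam)%N ->
  (fun M => \sum_(w : {ffun 'I_m -> 'I_(2 * (lam * r))}) f (\row_i gridval R lam (w i)) *
     corrX (M.+1 ^ A) lam d (fun i => gridval R lam (w i)) alpha) @ \oo --> riemann f r lam.
Proof.
move=> gd lam0; rewrite /riemann mulr_sumr; apply: cvg_bigsum => w.
rewrite mulrC; apply: cvgMr.
rewrite (_ : (fun i => gridval R lam (w i)) = fun i =>
  ratr ([ffun i => ((w i)%:R - (lam * r)%:R) / lam%:R : rat] i)); first exact: gd.
by apply/funext => i; rewrite ffunE fmorph_div rmorphB /= !ratr_nat.
Qed.

(** The properties of test functions that survive passage to positive and negative parts, where
    smoothness is lost. *)
Record nice f (r : nat) (B : R) : Prop := Nice {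
  nice_supp : box_supp f r;
  nice_bound : forall x, `|f x| <= B;
  nice_mod : forall eta, 0 < eta -> exists2 delta, 0 < delta & modulus f eta delta }.

Lemma modulusW f eta delta delta' : delta' <= delta -> modulus f eta delta -> modulus f eta delta'.
Proof. by move=> dd h x y xy; apply: h => i; apply: le_trans dd. Qed.

Lemma corrG_cvg_sub f r B (I : R) A alpha : (0 < A)%N -> good A alpha -> nice f r B ->
  riemann f r @ \oo --> I ->
  (fun M => corrG f (M.+1 ^ A) alpha) @ \oo --> I.
Proof.
move=> A0 gd [fr fB fm] RI; apply/cvgrPdist_le => eps eps0.
have B0 : 0 <= B by apply: le_trans (fB 0); exact: normr_ge0.
pose c : R := (4 * r%:R + 2) ^+ 2.
pose E : R := (c * (2 + 8 * c)) ^+ m.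
pose D : R := 2 ^+ m + 1.
have c0 : 0 < c by rewrite exprn_gt0 // ltr_wpDl // mulr_ge0.
have E0 : 0 < E by rewrite exprn_gt0 // mulr_gt0 // addr_gt0 // mulr_gt0.
have D0 : 0 < D by rewrite ltr_wpDl // exprn_ge0.
have ED0 : 0 < E * D by rewrite mulr_gt0.
(* The order of choices is [eta], then [delta], then [lam], as [K] depends on [delta]; [M] comes
   last. The constant [D] bounds [avg_dbl] eventually, since its limit is [2 ^+ m]. *)
pose eta := eps / 4 / (E * D).
have eta0 : 0 < eta by rewrite !divr_gt0.
have [delta1 d1 fm1] := fm _ eta0.
pose delta := Num.min delta1 1.
have d0 : 0 < delta by rewrite lt_min d1 ltr01.
have dle1 : delta <= 1 by rewrite ge_min lexx orbT.
have fm2 : modulus f eta delta by apply: modulusW fm1; rewrite ge_min lexx.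
pose K : R := m%:R * (2 * B) * (4 * c * (1 + 2 / delta) ^+ 2).
have K0 : 0 <= K.
  rewrite /K; apply: mulr_ge0; first by apply: mulr_ge0 => //; apply: mulr_ge0.
  by apply: mulr_ge0; [apply: mulr_ge0 => //; exact: ltW | exact: sqr_ge0].
have [lam [lam0 lamK lamI]] : exists lam : nat, [/\ (0 < lam)%N,
    K / lam%:R <= eta & `|I - riemann f r lam| <= eps / 4].
  have eps4 : 0 < eps / 4 by rewrite divr_gt0.
  have h1 : \forall lam \near \oo, `|I - riemann f r lam| <= eps / 4.
    by move/cvgrPdist_le : RI; apply.
  have h2 : \forall lam \near \oo, ((Num.trunc (K / eta)).+1 <= lam)%N by exact: nbhs_infty_ge.
  have [lam [l1 l2]] := filter_ex (filterI h1 h2).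
  have lp : (0 < lam)%N by apply: leq_trans l2.
  exists lam; split => //; rewrite ler_pdivrMr ?ltr0n // mulrC -ler_pdivrMr //.
  by apply: (le_trans (ltW (truncnS_gt _))); rewrite ler_nat.
have err : approx_err m r lam eta delta B * D <= eps / 4 + eps / 4.
  have -> : approx_err m r lam eta delta B = E * (eta + K / lam%:R).
    by rewrite /approx_err -/c -/E /K; congr (_ * (_ + _)); rewrite mulrA.
  have -> : eps / 4 + eps / 4 = (E * D) * (eta + eta).
    by rewrite /eta; field; rewrite !gt_eqF.
  by rewrite mulrAC ler_pM2l // lerD2l.
have hD : \forall M \near \oo, avg_dbl (M.+1 ^ A) alpha <= D.
  have /cvgrPdist_le/(_ _ ltr01) := avg_dbl_cvg gd; apply: filterS => M.
  by rewrite distrC /D => h; have := le_trans (ler_norm _) h; rewrite lerBlDl addrC.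
have hmain := @main_term_cvg f r lam A alpha gd lam0.
have hmain' : \forall M \near \oo, `|riemann f r lam - \sum_(w : {ffun 'I_m -> 'I_(2 * (lam * r))})
   f (\row_i gridval R lam (w i)) * corrX (M.+1 ^ A) lam d (fun i => gridval R lam (w i)) alpha| <= eps / 4.
  by move/cvgrPdist_le : hmain; apply; rewrite divr_gt0.
have hN : \forall M \near \oo, (2 * r.+1 <= M)%N by exact: nbhs_infty_ge.
near=> M.
have NM : (2 * r.+1 <= M.+1 ^ A)%N.
  apply: (@leq_trans M.+1); first by apply: leqW; near: M.
  by rewrite -{1}(expn1 M.+1) leq_pexp2l.
have rN : 2 * (r%:R + delta) <= (M.+1 ^ A)%:R.
  apply: (@le_trans _ _ ((2 * r.+1)%:R)); last by rewrite ler_nat.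
  rewrite natrM ler_wpM2l // -natr1; lra.
have e := corrG_approx alpha fr fm2 fB lam0 (leq_trans _ NM) d0 (ltW eta0) rN.
have e2 : approx_err m r lam eta delta B * avg_dbl (M.+1 ^ A) alpha <= eps / 4 + eps / 4.
  apply: le_trans err; apply: ler_wpM2l; last by near: M.
  have -> : approx_err m r lam eta delta B = E * (eta + K / lam%:R).
    by rewrite /approx_err -/c -/E /K; congr (_ * (_ + _)); rewrite mulrA.
  by apply: mulr_ge0; [exact: ltW | apply: addr_ge0; [exact: ltW | exact: divr_ge0]].
have e3 : `|riemann f r lam - \sum_(w : {ffun 'I_m -> 'I_(2 * (lam * r))})
   f (\row_i gridval R lam (w i)) * corrX (M.+1 ^ A) lam d (fun i => gridval R lam (w i)) alpha| <= eps / 4.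
  by near: M.
have e1 := le_trans (e isT) e2; move: e1 e3 lamI; clear.
move: (corrG _ _ _) (riemann _ _ _) (\sum_(w : _) _) => x y z h1 h2 h3.
have -> : I - x = (I - y) + (y - z) - (x - z) by ring.
apply: (le_trans (ler_normB _ _)).
have := ler_normD (I - y) (y - z); lra.
Unshelve. all: by end_near.
Qed.
End Subsequence.

(** * From the subsequence to all [N] *)

Section FullSequence.
Variables (R : realType) (m d : nat).
Implicit Types (f : 'rV[R]_m -> R) (alpha : R).

(* [8 r] bounds the weights at any point where one of the two terms is nonzero. *)
Lemma periodize_scale f (r N : nat) (T eta delta : R) (y : 'I_m -> R) :
  box_supp f r -> modulus f eta delta -> 0 <= eta -> (0 < N)%N -> 0 < T ->
  2 * r%:R <= N%:R :> R -> 2 * r%:R <= T -> N%:R <= 2 * T ->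
  `|N%:R - T| * r%:R <= delta * N%:R -> `|N%:R - T| * r%:R <= delta * T ->
  `|periodize f T y - periodize f N%:R y| <=
    eta * ((8 * r%:R + 2) ^+ 2) ^+ m * \prod_i dblfejer N (y i).
Proof.
move=> fr fm eta0 N0 T0 rN rT NT dN dT; have N1 : (0 : R) < N%:R by rewrite ltr0n.
rewrite !(periodize_rnd _ fr) //.
set u := fun i => y i - (rnd (y i))%:~R.
have D0 i : 0 <= dblfejer N (y i) by exact: dblfejer_ge0.
have P0 : 0 <= \prod_i dblfejer N (y i) by exact: prodr_ge0.
have c0 : 0 <= (8 * r%:R + 2) ^+ 2 :> R by exact: sqr_ge0.
suff near (S : R) : 0 < S -> N%:R <= 2 * S -> `|N%:R - T| * r%:R <= delta * S ->
    (forall i, S * `|u i| < r%:R) ->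
    `|f (\row_i (T * u i)) - f (\row_i (N%:R * u i))| <= eta * ((8 * r%:R + 2) ^+ 2) ^+ m * \prod_i dblfejer N (y i).
  have [fT|fT] := eqVneq (f (\row_i (T * u i))) 0; last first.
    apply: (near T) => // i; have := fr _ fT i.
    by rewrite mxE normrM (gtr0_norm T0).
  have [fN|fN] := eqVneq (f (\row_i (N%:R * u i))) 0; last first.
    apply: (near N%:R) => // [|i]; first by move: N1; lra.
    by have := fr _ fN i; rewrite mxE normrM (gtr0_norm N1).
  rewrite fT fN subrr normr0; apply: mulr_ge0 => //; apply: mulr_ge0 => //; exact: exprn_ge0.
move=> S0 NS dS h.
apply: (@le_trans _ _ eta).
  apply: fm => i; rewrite !mxE -mulrBl normrM distrC.
  rewrite -(ler_pM2r S0); apply: le_trans dS; rewrite -mulrA ler_wpM2l //.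
  by rewrite mulrC ltW.
rewrite -mulrA -[leLHS]mulr1 ler_wpM2l //.
rewrite -[m in _ ^+ m]card_ord -prodr_const -big_split /=.
apply: (@le_trans _ _ (\prod_(i < m) 1)); first by rewrite big1.
apply: ler_prod => i _; rewrite ler01 /=; apply: near_le => //.
apply: (le_trans (wt_le _ _ (- rnd (y i)))); rewrite rmorphN /= -/(u i).
have hi := ltW (h i); have := ler_wpM2r (normr_ge0 (u i)) NS; lra.
Qed.

Definition gsum f (N : nat) (T : R) alpha : R :=
  \sum_(n : {ffun 'I_m.+1 -> 'I_N} | injectiveb n) periodize f T (fun i => alpha * (gap d n i)%:~R).

Lemma gsum_mono f r (N N' : nat) (T alpha : R) : box_supp f r -> (forall x, 0 <= f x) ->
  0 < T -> 2 * r%:R <= T -> (N <= N')%N -> gsum f N T alpha <= gsum f N' T alpha.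
Proof.
move=> fr f0 T0 rT NN.
pose e (n : {ffun 'I_m.+1 -> 'I_N}) : {ffun 'I_m.+1 -> 'I_N'} := [ffun i => widen_ord NN (n i)].
have ei : injective e.
  move=> w w' ww; apply/ffunP => i; apply: val_inj.
  by have /ffunP/(_ i) := ww; rewrite !ffunE => /(congr1 val).
have p0 y : 0 <= periodize f T y by rewrite (periodize_rnd _ fr).
have -> : gsum f N T alpha = \sum_(n in e @: [set n : {ffun 'I_m.+1 -> 'I_N} | injectiveb n]%SET)
   periodize f T (fun i => alpha * (gap d n i)%:~R).
  rewrite big_imset /=; last by move=> ? ? _ _; exact: ei.
  apply: eq_big => n; rewrite ?inE // => _; congr periodize; apply/funext => i.
  by rewrite /gap !ffunE.
rewrite /gsum [leRHS](bigID (mem (e @: [set n : {ffun 'I_m.+1 -> 'I_N} | injectiveb n]%SET))) /= -[leLHS]addr0.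
apply: lerD; last exact: sumr_ge0.
rewrite le_eqVlt; apply/orP; left; apply/eqP; apply: eq_bigl => n.
apply/idP/andP => [h|[]//]; split => //; case/imsetP: h => n0; rewrite inE => /injectiveP n0i ->.
by apply/injectiveP => i j; rewrite !ffunE => /(congr1 val) /= /val_inj /n0i.
Qed.

Lemma gsum_scale f (r N : nat) (T eta delta alpha : R) :
  box_supp f r -> modulus f eta delta -> 0 <= eta -> (0 < N)%N -> 0 < T ->
  2 * r%:R <= N%:R :> R -> 2 * r%:R <= T -> N%:R <= 2 * T ->
  `|N%:R - T| * r%:R <= delta * N%:R -> `|N%:R - T| * r%:R <= delta * T ->
  `|gsum f N T alpha - N%:R * corrG d f N alpha| <=
    eta * ((8 * r%:R + 2) ^+ 2) ^+ m * (N%:R * avg_dbl m d N alpha).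
Proof.
move=> fr fm eta0 N0 T0 rN rT NT dN dT; have Nn : N%:R != 0 :> R by rewrite pnatr_eq0 -lt0n.
rewrite /corrG /avg_dbl !mulVKf // /gsum -sumrB mulr_sumr.
apply: (le_trans (ler_norm_sum _ _ _)); apply: ler_sum => n _.
exact: (@periodize_scale f r N T eta delta _ fr fm).
Qed.

(** With the scale frozen at [T = N], the sums increase in the number of points from [N1] through
    [N] to [N2]; then [gsum_scale] moves the scale to [N1] or [N2], at a cost controlled by the
    majorant. *)
Lemma corrG_between f r (N1 N N2 : nat) (eta delta alpha : R) :
  box_supp f r -> (forall x, 0 <= f x) -> modulus f eta delta -> 0 <= eta -> 0 <= delta ->
  (0 < N1)%N -> (N1 <= N)%N -> (N <= N2)%N -> (N2 <= 2 * N1)%N ->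
  2 * r%:R <= N1%:R :> R -> (N2 - N1)%N%:R * r%:R <= delta * N1%:R ->
  let k := eta * ((8 * r%:R + 2) ^+ 2) ^+ m in
  let q : R := N2%:R / N1%:R in
  q^-1 * (corrG d f N1 alpha - k * avg_dbl m d N1 alpha) <= corrG d f N alpha <=
  q * (corrG d f N2 alpha + k * avg_dbl m d N2 alpha).
Proof.
move=> fr f0 fm eta0 delta0 N10 N1N NN2 N22 rN dN; cbv zeta.
set k := eta * ((8 * r%:R + 2) ^+ 2) ^+ m; set q := N2%:R / N1%:R.
have N0 : (0 < N)%N by apply: leq_trans N1N.
have N20 : (0 < N2)%N by apply: leq_trans NN2.
have p1 : (0 : R) < N1%:R by rewrite ltr0n.
have p : (0 : R) < N%:R by rewrite ltr0n.
have p2 : (0 : R) < N2%:R by rewrite ltr0n.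
have l1 : N1%:R <= N%:R :> R by rewrite ler_nat.
have l2 : N%:R <= N2%:R :> R by rewrite ler_nat.
have l3 : N2%:R <= 2 * N1%:R :> R by rewrite -natrM ler_nat.
have dN' : (N2%:R - N1%:R) * r%:R <= delta * N1%:R.
  by rewrite -natrB // (leq_trans N1N).
have rr : 0 <= r%:R :> R by [].
have corE : corrG d f N alpha = N%:R^-1 * gsum f N N%:R alpha by [].
have dmono : delta * N1%:R <= delta * N%:R by rewrite ler_wpM2l.
have dmono2 : delta * N%:R <= delta * N2%:R by rewrite ler_wpM2l.
have g0 K : 0 <= gsum f K N%:R alpha.
  apply: sumr_ge0 => n _; rewrite (periodize_rnd _ fr) //; exact: le_trans l1.
have e1 : `|gsum f N1 N%:R alpha - N1%:R * corrG d f N1 alpha| <= k * (N1%:R * avg_dbl m d N1 alpha).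
  have h : `|N1%:R - N%:R| * r%:R <= delta * N1%:R.
    apply: le_trans dN'; rewrite ler_wpM2r // distrC ger0_norm ?subr_ge0 // lerD2r //.
  apply: (gsum_scale (delta := delta)) => //; [exact: le_trans l1 | lra | exact: le_trans dmono].
have e2 : `|gsum f N2 N%:R alpha - N2%:R * corrG d f N2 alpha| <= k * (N2%:R * avg_dbl m d N2 alpha).
  have h : `|N2%:R - N%:R| * r%:R <= delta * N1%:R.
    apply: le_trans dN'; rewrite ler_wpM2r // ger0_norm ?subr_ge0 // lerD2l lerN2 //.
  apply: (gsum_scale (delta := delta)) => //.
  - exact: le_trans (le_trans l1 l2).
  - exact: le_trans l1.
  - by move: l1 l3; lra.
  - by apply: (le_trans h); apply: le_trans dmono2.
  by apply: (le_trans h).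
have m1 : gsum f N1 N%:R alpha <= gsum f N N%:R alpha.
  by apply: (gsum_mono _ fr) => //; exact: le_trans l1.
have m2 : gsum f N N%:R alpha <= gsum f N2 N%:R alpha.
  by apply: (gsum_mono _ fr) => //; exact: le_trans l1.
rewrite corE; apply/andP; split.
  have -> : q^-1 * (corrG d f N1 alpha - k * avg_dbl m d N1 alpha) =
    N2%:R^-1 * (N1%:R * corrG d f N1 alpha - k * (N1%:R * avg_dbl m d N1 alpha)).
    by rewrite /q; field; rewrite !gt_eqF.
  apply: (@le_trans _ _ (N2%:R^-1 * gsum f N N%:R alpha)).
    rewrite ler_wpM2l ?invr_ge0 //; apply: le_trans m1.
    by move: e1; rewrite ler_norml => /andP [h _]; move: h; lra.
  by apply: ler_wpM2r => //; rewrite lef_pV2 ?posrE.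
have -> : q * (corrG d f N2 alpha + k * avg_dbl m d N2 alpha) =
    N1%:R^-1 * (N2%:R * corrG d f N2 alpha + k * (N2%:R * avg_dbl m d N2 alpha)).
  by rewrite /q; field; rewrite !gt_eqF.
apply: (@le_trans _ _ (N1%:R^-1 * gsum f N N%:R alpha)).
  by apply: ler_wpM2r => //; rewrite lef_pV2 ?posrE.
rewrite ler_wpM2l ?invr_ge0 //; apply: (le_trans m2).
by move: e2; rewrite ler_norml => /andP [_ h]; move: h; lra.
Qed.

Lemma ratio_cvg A : (fun M => (M.+2 ^ A)%:R / (M.+1 ^ A)%:R : R) @ \oo --> (1 : R).
Proof.
have h1 : (fun M => 1 + M.+1%:R^-1 : R) @ \oo --> (1 : R).
  rewrite -[X in _ --> X]addr0; apply: cvgD; [exact: cvg_cst | exact: cvg_harmonic].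
have -> : (fun M => (M.+2 ^ A)%:R / (M.+1 ^ A)%:R : R) = fun M => (1 + M.+1%:R^-1) ^+ A.
  apply/funext => M; rewrite !natrX -expr_div_n; congr (_ ^+ _).
  have : (M.+1%:R : R) != 0 by rewrite pnatr_eq0.
  by rewrite -[M.+2%:R]natr1; move: (M.+1%:R : R) => x x0; field.
elim: A => [|A IH]; first by under eq_fun => M do rewrite expr0; exact: cvg_cst.
rewrite -[X in _ --> X]mulr1; under eq_fun => M do rewrite exprS; exact: cvgM.
Qed.

Lemma corrG_cvg_ge0 f r B (I : R) A alpha : (0 < A)%N -> good m d A alpha -> nice f r B ->
  (forall x, 0 <= f x) -> riemann f r @ \oo --> I ->
  (fun N => corrG d f N alpha) @ \oo --> I.
Proof.
move=> A0 gd nf f0 RI; have [fr fB fm] := nf; apply/cvgrPdist_le => eps eps0.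
pose c : R := ((8 * r%:R + 2) ^+ 2) ^+ m.
have c0 : 0 < c by rewrite !exprn_gt0 // ltr_wpDl // mulr_ge0.
pose eta := eps / 2 / (c * 2 ^+ m).
have eta0 : 0 < eta by rewrite !divr_gt0 // mulr_gt0 // exprn_gt0.
have [delta d0 fm1] := fm _ eta0.
pose k := eta * c.
have kE : k * 2 ^+ m = eps / 2.
  by rewrite /k /eta; field; rewrite !gt_eqF // exprn_gt0.
have cs := corrG_cvg_sub A0 gd nf RI.
have ca := avg_dbl_cvg gd.
have cr := ratio_cvg A.
have chi : (fun M => (M.+2 ^ A)%:R / (M.+1 ^ A)%:R *
    (corrG d f (M.+2 ^ A) alpha + k * avg_dbl m d (M.+2 ^ A) alpha)) @ \oo --> I + eps / 2.
  rewrite -[X in _ --> X]mul1r -kE; apply: cvgM => //; apply: cvgD.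
    by have := cs; rewrite -(cvg_shiftS (fun M => corrG d f (M.+1 ^ A) alpha)).
  by apply: cvgMr; have := ca; rewrite -(cvg_shiftS (fun M => avg_dbl m d (M.+1 ^ A) alpha)).
have clo : (fun M => ((M.+2 ^ A)%:R / (M.+1 ^ A)%:R)^-1 *
    (corrG d f (M.+1 ^ A) alpha - k * avg_dbl m d (M.+1 ^ A) alpha)) @ \oo --> I - eps / 2.
  have -> : I - eps / 2 = 1^-1 * (I - k * 2 ^+ m) by rewrite kE invr1 mul1r.
  apply: cvgM.
    by apply: cvgV => //; rewrite oner_eq0.
  by apply: cvgB => //; apply: cvgMr.
have e2 : 0 < eps / 2 by rewrite divr_gt0.
have /cvgrPdist_le/(_ _ e2) hhi := chi.
have /cvgrPdist_le/(_ _ e2) hlo := clo.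
(* The value 1 ensures [N2 <= 2 * N1], and [delta / r.+1] the closeness of the scales; [r.+1] avoids
   dividing by 0. *)
pose t := Num.min 1 (delta / r.+1%:R).
have t0 : 0 < t by rewrite lt_min ltr01 divr_gt0.
have /cvgrPdist_le/(_ _ t0) hr := cr.
have hN : \forall M \near \oo, (2 * r <= M)%N by exact: nbhs_infty_ge.
have [M0 _ hM0] := filterI (filterI hhi hlo) (filterI hr hN).
exists (M0.+1 ^ A)%N => // N /= hN0.
have exj : exists j, (j.+1 ^ A <= N)%N by exists M0.
have bdj j : (j.+1 ^ A <= N)%N -> (j <= N)%N.
  move=> h; apply: leq_trans h; apply: (@leq_trans j.+1) => //.
  by rewrite -{1}(expn1 j.+1) leq_pexp2l.
have [j jN jmax] := ex_maxnP exj bdj.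
have jM0 : (M0 <= j)%N by exact: jmax.
have Nj : (N <= j.+2 ^ A)%N.
  by rewrite leqNgt; apply/negP => /ltnW /jmax; rewrite ltnn.
have [[h1 h2] [h3 h4]] := hM0 _ jM0.
have p1 : (0 : R) < (j.+1 ^ A)%:R by rewrite ltr0n expn_gt0.
have jj : (j.+1 ^ A <= j.+2 ^ A)%N by exact: leq_trans jN Nj.
have q1 : (j.+2 ^ A)%:R / (j.+1 ^ A)%:R - 1 <= t.
  by apply: le_trans h3; rewrite distrC ler_norm.
have q2 : (j.+2 ^ A)%:R - (j.+1 ^ A)%:R <= t * (j.+1 ^ A)%:R :> R.
  by rewrite -ler_pdivrMr // mulrBl divff // gt_eqF.
have q3 : (j.+2 ^ A <= 2 * j.+1 ^ A)%N.
  rewrite -(ler_nat R) natrM.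
  have : t * (j.+1 ^ A)%:R <= 1 * (j.+1 ^ A)%:R by rewrite ler_pM2r // ge_min lexx.
  by move: q2; lra.
have q4 : (j.+2 ^ A - j.+1 ^ A)%N%:R * r%:R <= delta * (j.+1 ^ A)%:R.
  rewrite natrB //; apply: (@le_trans _ _ (delta / r.+1%:R * (j.+1 ^ A)%:R * r.+1%:R)).
    apply: ler_pM => //; rewrite ?subr_ge0 ?ler_nat //.
    by apply: (le_trans q2); rewrite ler_pM2r // ge_min lexx orbT.
  by rewrite mulrAC divfK // pnatr_eq0.
have q5 : 2 * r%:R <= (j.+1 ^ A)%:R :> R.
  rewrite -natrM ler_nat; apply: (leq_trans h4); apply: (@leq_trans j.+1) => //.
  by rewrite -{1}(expn1 j.+1) leq_pexp2l.
have := @corrG_between f r (j.+1 ^ A) N (j.+2 ^ A) eta delta alpha fr f0 fm1 (ltW eta0) (ltW d0)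
  (expn_gt0 _ _) jN Nj q3 q5 q4.
cbv zeta; rewrite -/c -/k => /andP [lo hi].
rewrite /= ler_norml in h1; rewrite /= ler_norml in h2.
case/andP: h1 => [h1 _]; case/andP: h2 => [_ h2].
have aux (x y z : R) : - (eps / 2) <= I + eps / 2 - x -> I - eps / 2 - y <= eps / 2 ->
    y <= z -> z <= x -> `|I - z| <= eps.
  by move=> *; rewrite ler_norml; apply/andP; split; lra.
exact: aux h1 h2 lo hi.
Qed.
End FullSequence.

(** * Riemann sums *)

Section OneDim.
Variable R : realType.
Notation mu := (@lebesgue_measure R).
Variables (phi : R -> R) (eta h : R).
Hypothesis phic : continuous phi.
Hypothesis h0 : 0 < h.
Hypothesis osc : forall t t', `|t - t'| <= h -> `|phi t - phi t'| <= eta.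

Lemma integrable_seg (a b : R) : mu.-integrable `[a, b] (EFin \o phi).
Proof.
apply: continuous_compact_integrable; first exact: segment_compact.
exact: continuous_subspaceT.
Qed.

Lemma Rintegral_cell x :
  `|Rintegral mu `]x, (x + h)] phi - h * phi x| <= h * eta.
Proof.
have mD : measurable (`]x, (x + h)]%classic : set R) by exact: measurable_itv.
have mD2 : measurable (`[x, (x + h)]%classic : set R) by exact: measurable_itv.
have xh : x < x + h by rewrite ltrDl.
have sub : `]x, (x + h)]%classic `<=` (`[x, (x + h)]%classic : set R) by exact: subset_itv_oc_cc.
have iphi : mu.-integrable `]x, (x + h)] (EFin \o phi).
  exact: (@integrableS _ _ R mu _ _ (EFin \o phi) mD2 mD sub (integrable_seg _ _)).
have muD : fine (mu `]x, (x + h)]) = h.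
  by rewrite lebesgue_measure_itv /= lte_fin xh -EFinB /= addrAC subrr add0r.
have icst c : mu.-integrable `]x, (x + h)] (EFin \o (fun=> c : R)).
  apply: (@integrableS _ _ R mu _ _ _ mD2 mD sub).
  apply: continuous_compact_integrable; first exact: segment_compact.
  by apply: continuous_subspaceT => ?; exact: cvg_cst.
have b t : `]x, (x + h)]%classic t -> `|phi t - phi x| <= eta.
  by rewrite /= in_itv /= => /andP [t1 t2]; apply: osc; rewrite gtr0_norm ?subr_gt0 // lerBlDl.
have c1 : Rintegral mu `]x, (x + h)] (fun=> phi x - eta) <= Rintegral mu `]x, (x + h)] phi.
  by apply: le_Rintegral => // t /b; rewrite ler_norml => /andP [? _]; lra.
have c2 : Rintegral mu `]x, (x + h)] phi <= Rintegral mu `]x, (x + h)] (fun=> phi x + eta).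
  by apply: le_Rintegral => // t /b; rewrite ler_norml => /andP [_ ?]; lra.
rewrite !Rintegral_cst //= muD in c1 c2.
by rewrite ler_norml; apply/andP; split; move: c1 c2; lra.
Qed.

Lemma Rintegral_cells (a : R) (k : nat) :
  `|Rintegral mu `[a, (a + k%:R * h)] phi - h * \sum_(z < k) phi (a + z%:R * h)| <= k%:R * (h * eta).
Proof.
elim: k => [|k IH].
  by rewrite big_ord0 mul0r addr0 set_itv1 Rintegral_set1 !mulr0 mul0r subr0 normr0.
rewrite big_ord_recr /=.
have -> : a + k.+1%:R * h = (a + k%:R * h) + h by rewrite -natr1; ring.
have h1 : a <= a + k%:R * h by rewrite lerDl mulr_ge0 // ltW.
have := @Rintegral_itvB R phi (BLeft a) (BRight (a + k%:R * h + h)) (a + k%:R * h) (integrable_seg _ _).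
rewrite !bnd_simp h1 lerDl (ltW h0) => /(_ isT isT) e.
have c := Rintegral_cell (a + k%:R * h); move/eqP: e; rewrite subr_eq => /eqP ->.
rewrite -natr1 mulrDl mul1r.
have -> (x y s p : R) : x + y - h * (s + p) = (y - h * s) + (x - h * p) by ring.
by apply: (le_trans (ler_normD _ _)); apply: lerD.
Qed.
End OneDim.

Lemma Rintegral_riemann (R : realType) (phi : R -> R) (r lam : nat) (eta delta : R) :
  continuous phi -> (0 < lam)%N -> lam%:R^-1 <= delta ->
  (forall t, r%:R <= `|t| -> phi t = 0) ->
  (forall t t', `|t - t'| <= delta -> `|phi t - phi t'| <= eta) ->
  `|Rintegral (@lebesgue_measure R) setT phi -
     lam%:R^-1 * \sum_(z < 2 * (lam * r)) phi (gridval R lam z)| <= 2 * r%:R * eta.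
Proof.
move=> phic lam0 ld phi0 osc; have l0 : (0 : R) < lam%:R by rewrite ltr0n.
have h0 : (0 : R) < lam%:R^-1 by rewrite invr_gt0.
have := @Rintegral_cells R phi eta lam%:R^-1 phic h0 _ (- r%:R) (2 * (lam * r)).
move=> /(_ (fun t t' tt => osc t t' (le_trans tt ld))).
have -> : - r%:R + (2 * (lam * r))%N%:R * lam%:R^-1 = r%:R :> R.
  by rewrite !natrM; field; rewrite gt_eqF.
have -> : (2 * (lam * r))%N%:R * (lam%:R^-1 * eta) = 2 * r%:R * eta.
  by rewrite !natrM; field; rewrite gt_eqF.
have -> : \sum_(z < 2 * (lam * r)) phi (- r%:R + z%:R * lam%:R^-1) =
   \sum_(z < 2 * (lam * r)) phi (gridval R lam z).
  apply: eq_bigr => z _; congr phi; rewrite /gridval natrM; field; by rewrite gt_eqF.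
rewrite Rintegral_mkcond (_ : phi \_ _ = phi) //.
apply/funext => t; rewrite patchE; case: ifPn => //.
rewrite notin_setE /= in_itv /= -ler_norml => /negP; rewrite -ltNge => tr.
by rewrite phi0 // ltW.
Qed.

Section Riemann.
Variable R : realType.

Definition slice m (f : 'rV[R]_m.+1 -> R) (t : R) : 'rV[R]_m -> R :=
  fun v => f (row_mx (const_mx t : 'rV[R]_1) v).

Lemma slice_ord0 m (t : R) (v : 'rV[R]_m) :
  (row_mx (const_mx t : 'rV[R]_1) v : 'rV[R]_m.+1) ord0 ord0 = t.
Proof.
have e : (ord0 : 'I_m.+1) = lshift m (ord0 : 'I_1) by exact: ord_inj.
by rewrite e (@row_mxEl R 1 1 m) mxE.
Qed.

Lemma slice_lift m (t : R) (v : 'rV[R]_m) i :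
  (row_mx (const_mx t : 'rV[R]_1) v : 'rV[R]_m.+1) ord0 (lift ord0 i) = v ord0 i.
Proof.
have e : lift ord0 i = rshift 1 i :> 'I_m.+1 by exact: ord_inj.
by rewrite e (@row_mxEr R 1 1 m).
Qed.

Lemma ordP_lift m (P : 'I_m.+1 -> Prop) : P ord0 -> (forall i, P (lift ord0 i)) -> forall i, P i.
Proof. by move=> P0 Pl i; case: (unliftP ord0 i) => [j|] ->. Qed.

Lemma slice_modulus m (f : 'rV[R]_m.+1 -> R) eta delta t : 0 <= delta ->
  modulus f eta delta -> modulus (slice f t) eta delta.
Proof.
move=> d0 fm x y xy; apply: fm; apply: ordP_lift => [|i].
  by rewrite !slice_ord0 subrr normr0.
by rewrite !slice_lift.
Qed.

Lemma slice_close m (f : 'rV[R]_m.+1 -> R) eta delta t t' v : 0 <= delta ->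
  modulus f eta delta -> `|t - t'| <= delta -> `|slice f t v - slice f t' v| <= eta.
Proof.
move=> d0 fm tt; apply: fm; apply: ordP_lift => [|i]; first by rewrite !slice_ord0.
by rewrite !slice_lift subrr normr0.
Qed.

Lemma slice_nice m (f : 'rV[R]_m.+1 -> R) r B t : nice f r B -> nice (slice f t) r B.
Proof.
case=> fr fB fm; split.
- by move=> v /fr h i; have := h (lift ord0 i); rewrite slice_lift.
- by move=> v; exact: fB.
by move=> eta /fm [delta d0 h]; exists delta => //; apply: slice_modulus => //; exact: ltW.
Qed.

Lemma riemann_slice m (f : 'rV[R]_m.+1 -> R) (r lam : nat) :
  riemann f r lam = lam%:R^-1 * \sum_(z < 2 * (lam * r)) riemann (slice f (gridval R lam z)) r lam.
Proof.
rewrite /riemann exprSr invfM -mulrA mulrCA; congr (_ * _).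
rewrite -mulr_sumr; congr (_ * _).
set n := (2 * (lam * r))%N.
rewrite (pair_big xpredT xpredT (fun (z : 'I_n) (w : {ffun 'I_m -> 'I_n}) =>
  slice f (gridval R lam z) (\row_i gridval R lam (w i)))) /=.
pose e (p : 'I_n * {ffun 'I_m -> 'I_n}) : {ffun 'I_m.+1 -> 'I_n} :=
  [ffun i => if unlift ord0 i is Some j then p.2 j else p.1].
pose e' (w : {ffun 'I_m.+1 -> 'I_n}) : 'I_n * {ffun 'I_m -> 'I_n} :=
  (w ord0, [ffun j => w (lift ord0 j)]).
rewrite (reindex e) /=; last first.
  exists e' => [[z w] _|w _].
    rewrite /e' /e ffunE unlift_none; congr (_, _); apply/ffunP => j.
    by rewrite !ffunE liftK.
  by apply/ffunP; apply: ordP_lift => [|i]; rewrite !ffunE ?unlift_none ?liftK ?ffunE.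
apply: eq_bigr => p _; congr f; apply/rowP; apply: ordP_lift => [|i].
  by rewrite slice_ord0 mxE ffunE unlift_none.
by rewrite slice_lift !mxE ffunE liftK.
Qed.

Lemma riemann_le m (f g : 'rV[R]_m -> R) (r lam : nat) eta : (0 < lam)%N ->
  (forall v, `|f v - g v| <= eta) -> `|riemann f r lam - riemann g r lam| <= eta * (2 * r%:R) ^+ m.
Proof.
move=> lam0 fg; have l0 : (0 : R) < lam%:R by rewrite ltr0n.
rewrite /riemann -mulrBr -sumrB normrM ger0_norm ?invr_ge0 ?exprn_ge0 //.
rewrite ler_pdivrMl ?exprn_gt0 //; apply: (le_trans (ler_norm_sum _ _ _)).
apply: (@le_trans _ _ (\sum_(w : {ffun 'I_m -> 'I_(2 * (lam * r))}) eta)).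
  by apply: ler_sum => w _; exact: fg.
rewrite sumr_const card_ffun !card_ord -(mulr_natr eta) natrX !natrM [leRHS]mulrCA -exprMn.
by rewrite le_eqVlt; apply/orP; left; apply/eqP; congr (_ * _ ^+ _); ring.
Qed.

Lemma modulus_ge0 m (f : 'rV[R]_m -> R) eta delta : 0 <= delta -> modulus f eta delta -> 0 <= eta.
Proof.
move=> d0 fm; have := fm 0 0; rewrite subrr normr0; apply => i.
by rewrite subrr normr0.
Qed.

Lemma inv_nat_le (x : R) : 0 < x -> exists2 n : nat, (0 < n)%N & n%:R^-1 <= x.
Proof.
move=> x0; exists (Num.trunc x^-1).+1 => //.
rewrite -[leRHS]invrK lef_pV2 ?posrE ?invr_gt0 ?ltr0n //; exact: ltW (truncnS_gt _).
Qed.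

(** Induction on the dimension, with the slice integrals [phi] as a function of the first
    coordinate. One share [2 * r] of the factor [4 * r] comes from the Riemann sum of [phi], the
    other from replacing its values by Riemann sums of slices. *)
Lemma int_Rn_riemann m (f : 'rV[R]_m -> R) (r : nat) B eta delta (lam : nat) :
  nice f r B -> modulus f eta delta -> (0 < lam)%N -> lam%:R^-1 <= delta ->
  `|int_Rn f - riemann f r lam| <= eta * (4 * r%:R) ^+ m.
Proof.
elim: m f eta delta lam => [|m IH] f eta delta lam fn fm lam0 ld.
  have d0 : 0 <= delta by apply: le_trans ld; rewrite invr_ge0.
  rewrite expr0 mulr1 /riemann expr0 invr1 mul1r /=.
  rewrite (eq_bigr (fun=> f 0)); last by move=> w _; congr f; apply/rowP; case.
  rewrite sumr_const card_ffun !card_ord expn0 mulr1n subrr normr0.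
  exact: modulus_ge0 fm.
have l0 : (0 : R) < lam%:R by rewrite ltr0n.
have d0 : 0 < delta by apply: lt_le_trans ld; rewrite invr_gt0.
have eta0 : 0 <= eta by apply: modulus_ge0 fm; exact: ltW.
pose phi t := int_Rn (slice f t).
have r0 : 0 <= r%:R :> R by [].
pose Z : R := (4 * r%:R) ^+ m; pose Z2 : R := (2 * r%:R) ^+ m.
have Z0 : 0 <= Z by rewrite exprn_ge0 // mulr_ge0.
have Z20 : 0 <= Z2 by rewrite exprn_ge0 // mulr_ge0.
have Z2Z : Z2 <= Z.
  by apply: lerXn2r; rewrite ?nnegrE ?mulr_ge0 // ler_wpM2r // ler_nat.
have small (x y : R) (c : R) : 0 <= c -> (forall e, 0 < e -> x <= y + e * c) -> x <= y.
  move=> c0 hx; apply/ler_addgt0Pr => e e0.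
  have c1 : 0 < c + 1 by rewrite ltr_wpDl.
  apply: (le_trans (hx (e / (c + 1)) _)); first by rewrite divr_gt0.
  rewrite lerD2l -mulrA ler_piMr ?(ltW e0) // mulrC ler_pdivrMr // mul1r lerDl //.
(* The induction hypothesis controls [phi] only through Riemann sums, so they are compared on an
   auxiliary mesh [n], unrelated to [lam], whose error [small] lets tend to 0. *)
have osc e t t' dl : 0 < dl -> modulus f e dl -> `|t - t'| <= dl -> `|phi t - phi t'| <= e * Z2.
  move=> dl0 fm1 tt; apply: (small _ _ (2 * Z)); first by rewrite mulr_ge0.
  move=> e1 e10; have [_ _ /(_ _ e10) [dl1 dl10 fm2]] := fn.
  have [n n0 nd] := inv_nat_le dl10.
  have h s := IH (slice f s) e1 dl1 n (slice_nice s fn) (slice_modulus s (ltW dl10) fm2) n0 nd.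
  have h3 := @riemann_le m (slice f t) (slice f t') r n e n0
    (fun v => slice_close v (ltW dl0) fm1 tt).
  have -> : phi t - phi t' = (riemann (slice f t) r n - riemann (slice f t') r n)
     + (phi t - riemann (slice f t) r n) - (phi t' - riemann (slice f t') r n) by ring.
  apply: (le_trans (ler_normB _ _)); have := ler_normD (riemann (slice f t) r n - riemann (slice f t') r n)
     (phi t - riemann (slice f t) r n).
  move: (h t) (h t') h3; rewrite -/(phi t) -/(phi t') -/Z -/Z2; lra.
have phic : continuous phi.
  move=> t; apply/cvgrPdist_le => e e0.
  have z1 : 0 < Z2 + 1 by rewrite ltr_wpDl.
  have [_ _ /(_ (e / (Z2 + 1)) (divr_gt0 e0 z1)) [dl dl0 fm2]] := fn.
  near=> s; apply: (le_trans (osc _ t s dl dl0 fm2 _)).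
    by near: s; apply: cvgr_dist_le => //; exact: cvg_id.
  by rewrite mulrAC ler_pdivrMr // ler_pM2l // lerDl.
have phi0 t : r%:R <= `|t| -> phi t = 0.
  move=> tr; have f0 v : slice f t v = 0.
    apply/eqP; apply: contraT => /(nice_supp fn) /(_ ord0).
    by rewrite slice_ord0 ltNge tr.
  apply/eqP; rewrite -normr_le0; apply: (small _ _ Z) => // e1 e10; rewrite add0r.
  have [_ _ /(_ _ e10) [dl1 dl10 fm2]] := fn; have [n n0 nd] := inv_nat_le dl10.
  have := IH (slice f t) e1 dl1 n (slice_nice t fn) (slice_modulus t (ltW dl10) fm2) n0 nd.
  by rewrite /riemann big1 ?mulr0 ?subr0.
have h1 := Rintegral_riemann phic lam0 ld phi0 (fun t t' => osc eta t t' delta d0 fm).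
have h2 : `|lam%:R^-1 * \sum_(z < 2 * (lam * r)) phi (gridval R lam z) - riemann f r lam|
    <= 2 * r%:R * (eta * Z).
  rewrite riemann_slice -mulrBr -sumrB normrM ger0_norm ?invr_ge0 // ler_pdivrMl //.
  apply: (le_trans (ler_norm_sum _ _ _)).
  apply: (@le_trans _ _ (\sum_(z < 2 * (lam * r)) eta * Z)).
    apply: ler_sum => z _.
    exact: (IH _ eta delta lam (slice_nice _ fn) (slice_modulus _ (ltW d0) fm) lam0 ld).
  rewrite sumr_const card_ord -(mulr_natl (eta * Z)) !natrM le_eqVlt; apply/orP; left; apply/eqP; ring.
have -> : int_Rn f = Rintegral (@lebesgue_measure R) setT phi by [].
rewrite exprS; have h3 := ler_wpM2l eta0 Z2Z; have h4 := ler_wpM2l r0 h3.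
move: h1 h2; set x := Rintegral _ _ _; set y := _ * \sum_(z < _) _; set z := riemann _ _ _.
rewrite -/Z2 -/Z => h1 h2.
have -> : x - z = (x - y) + (y - z) by ring.
apply: (le_trans (ler_normD _ _)); lra.
Unshelve. all: by end_near.
Qed.

Lemma riemann_cvg m (f : 'rV[R]_m -> R) r B : nice f r B -> riemann f r @ \oo --> int_Rn f.
Proof.
move=> fn; apply/cvgrPdist_le => e e0; pose Z : R := (4 * r%:R) ^+ m.
have Z0 : 0 <= Z by rewrite exprn_ge0 // mulr_ge0.
have z1 : 0 < Z + 1 by rewrite ltr_wpDl.
have [_ _ /(_ (e / (Z + 1)) (divr_gt0 e0 z1)) [dl dl0 fm]] := fn.
have [n n0 nd] := inv_nat_le dl0.
exists n => // k /= nk; have k0 : (0 < k)%N by apply: leq_trans nk.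
apply: (le_trans (int_Rn_riemann fn fm k0 _)).
  by apply: le_trans nd; rewrite lef_pV2 ?posrE ?ltr0n // ler_nat.
by rewrite -/Z mulrAC ler_pdivrMr // ler_pM2l // lerDl.
Qed.
End Riemann.

(** * Conclusion *)

Section Conclusion.
Variable R : realType.
Notation mu := (@lebesgue_measure R).

Lemma rnd_int (x : R) (k : int) : rnd (x + k%:~R) = rnd x + k.
Proof. by rewrite /rnd addrAC floorDrz ?intrKfloor // intr_int. Qed.

Lemma compact_support_box m (f : 'rV[R]_m -> R) : compact_support f ->
  exists2 r : nat, (0 < r)%N & box_supp f r.
Proof.
move=> /compact_bounded [M [_ hM]].
exists (Num.trunc `|M|).+2 => // x fx i.
have M1 : M < `|M| + 1 by apply: (le_lt_trans (ler_norm M)); rewrite ltrDl.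
have : `|x| <= `|M| + 1 by apply: (hM _ M1); apply: subset_closure; exact/eqP.
move=> xM; apply: (@le_lt_trans _ _ (`|M| + 1)).
  apply: le_trans xM; rewrite [leRHS]/Num.norm /= mx_normrE.
  exact: (le_bigmax _ (fun ij : 'I_1 * 'I_m => `|x ij.1 ij.2|) (ord0, i)).
by rewrite -natr1 ltrD2r truncnS_gt.
Qed.

Lemma uniform_modulus m (f : 'rV[R]_m -> R) : continuous f -> compact_support f ->
  forall eta, 0 < eta -> exists2 delta, 0 < delta & modulus f eta delta.
Proof.
move=> fc /compact_near_coveringP cK eta eta0; set K := closure _ in cK.
pose P (delta : R) (x : 'rV[R]_m) := forall y : 'rV[R]_m,
  (forall i, `|x ord0 i - y ord0 i| <= delta) -> `|f x - f y| <= eta.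
have H : \forall delta \near 0^'+, K `<=` P delta.
  apply: cK => x _; have e2 : 0 < eta / 2 by rewrite divr_gt0.
  have /cvgrPdist_lt/(_ _ e2) := fc x; case/nbhs_ballP => e /= e0 he.
  exists (ball x (e / 2), [set t | t < e / 2]).
    split; first by apply: nbhsx_ballx; rewrite divr_gt0.
    by apply: nbhs_right_lt; rewrite divr_gt0.
  move=> [x' t] [/= [_ xx'] te] y x'y.
  have h1 : `|f x - f x'| < eta / 2.
    apply: he; split => // i j; rewrite (ord1 i); have := xx' ord0 j.
    by rewrite /ball /= => h3; apply: (lt_le_trans h3); rewrite ler_pdivrMr //; lra.
  have h2 : `|f x - f y| < eta / 2.
    apply: he; split => // i j; rewrite (ord1 i); have := xx' ord0 j; rewrite /ball /= => h3.
    have -> : x ord0 j - y ord0 j = (x ord0 j - x' ord0 j) + (x' ord0 j - y ord0 j) by ring.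
    apply: (le_lt_trans (ler_normD _ _)); have := x'y j; move: te h3; rewrite /=; lra.
  have -> : f x' - f y = (f x - f y) - (f x - f x') by ring.
  by apply: (le_trans (ler_normB _ _)); lra.
have [delta [dp dK]] := filter_ex (filterI (nbhs_right_gt (0 : R)) H).
exists delta => // x y xy.
(* [P delta] is known only on the closed support, so the estimate is centred at whichever point lies
   in it. *)
have [fx|fx] := eqVneq (f x) 0; last first.
  by apply: (dK x) => //; apply: subset_closure; exact/eqP.
have [fy|fy] := eqVneq (f y) 0; first by rewrite fx fy subrr normr0 ltW.
rewrite distrC; apply: (dK y); first by apply: subset_closure; exact/eqP.
by move=> i; rewrite distrC.
Qed.

Lemma nice_of_Cc m (f : 'rV[R]_m -> R) : Cc_infty f -> exists r B, nice f r B.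
Proof.
move=> [sm cs]; have [_ fc] := sm [::]; have [r r0 fr] := compact_support_box cs.
have um := uniform_modulus fc cs.
have [M hM] : exists M, forall x, `|f x| <= M.
  have [M [_ hM]] := compact_bounded (continuous_compact (continuous_subspaceT fc) cs).
  exists (`|M| + 1) => x; have M1 : M < `|M| + 1 by apply: (le_lt_trans (ler_norm M)); rewrite ltrDl.
  have [fx|fx] := eqVneq (f x) 0; first by rewrite fx normr0 addr_ge0.
  by apply: (hM _ M1); exists x => //; apply: subset_closure; exact/eqP.
by exists r, M; split.
Qed.

Lemma nice_max0 m (f : 'rV[R]_m -> R) r B : nice f r B -> nice (fun x => Num.max (f x) 0) r B.
Proof.
have lip (a b : R) : `|Num.max a 0 - Num.max b 0| <= `|a - b|.
  rewrite !maxEle; case: (leP a 0); case: (leP b 0) => h1 h2; rewrite ?subrr ?normr0 ?sub0r ?subr0 //.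
    rewrite normrN gtr0_norm // distrC ger0_norm; lra.
  rewrite gtr0_norm // ger0_norm; lra.
case=> fr fB fm; split.
- by move=> x h; apply: fr; apply: contraNneq h => ->; rewrite maxxx.
- by move=> x; have := lip (f x) 0; rewrite maxxx !subr0 => h; apply: (le_trans h).
move=> eta /fm [delta d0 h]; exists delta => // x y xy.
by apply: (le_trans (lip _ _)); exact: h.
Qed.

Lemma nice_opp m (f : 'rV[R]_m -> R) r B : nice f r B -> nice (fun x => - f x) r B.
Proof.
case=> fr fB fm; split.
- by move=> x; rewrite oppr_eq0; exact: fr.
- by move=> x; rewrite normrN.
move=> eta /fm [delta d0 h]; exists delta => // x y xy.
by rewrite -opprD normrN; exact: h.
Qed.

(** Taking fractional parts changes each difference by an integer, which shifts the nearest integer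
    by the same amount. *)
Lemma Rcorr_corrG m d (N : nat) (alpha : R) (f : 'rV[R]_m -> R) r B : nice f r B -> (0 < N)%N ->
  (2 * r <= N)%N -> @Rcorr R m.+1 N d alpha f = corrG d f N alpha.
Proof.
move=> [fr _ _] N0 rN; congr (_ * _); apply: eq_bigr => n _.
have N1 : (0 : R) < N%:R by rewrite ltr0n.
have rN' : 2 * r%:R <= N%:R :> R by rewrite -natrM ler_nat.
pose x (j : 'I_m.+1) := xseq alpha d (n j).+1.
transitivity (periodize f N%:R (fun i => x (widen_ord (leqnSn m) i) - x (lift ord0 i))) => //.
rewrite !(periodize_rnd _ fr) //; congr f; apply/rowP => i; rewrite !mxE; congr (_ * _).
rewrite /x /xseq /frac; set a := alpha * _; set b := alpha * _.
have -> : alpha * (gap d n i)%:~R = a - b.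
  by rewrite /gap rmorphB !rmorphXn /= -!pmulrn mulrBr.
have -> : a - (Num.floor a)%:~R - (b - (Num.floor b)%:~R) = (a - b) + (Num.floor b - Num.floor a)%:~R.
  by rewrite rmorphB /=; ring.
by rewrite rnd_int !rmorphD /=; ring.
Qed.

(** Interpolation between the terms of the subsequence requires a nonnegative function, hence the
    splitting into two parts. *)
Lemma corrG_cvg m d A (alpha : R) (f : 'rV[R]_m -> R) r B : (0 < A)%N -> good m d A alpha ->
  nice f r B -> (fun N => corrG d f N alpha) @ \oo --> int_Rn f.
Proof.
move=> A0 gd nf; pose fp x := Num.max (f x) 0; pose fn x := Num.max (- f x) 0.
have np : nice fp r B by exact: nice_max0.
have nn : nice fn r B by apply: nice_max0; exact: nice_opp.
have fE x : f x = fp x - fn x.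
  by rewrite /fp /fn !maxEle; case: (leP (f x) 0); case: (leP (- f x) 0); lra.
have fp0 x : 0 <= fp x by rewrite /fp le_max lexx orbT.
have fn0 x : 0 <= fn x by rewrite /fn le_max lexx orbT.
have cp := corrG_cvg_ge0 A0 gd np fp0 (riemann_cvg np).
have cn := corrG_cvg_ge0 A0 gd nn fn0 (riemann_cvg nn).
(* Additivity of the iterated integral, obtained from the additivity of Riemann sums and uniqueness
   of limits. *)
have IE : int_Rn f = int_Rn fp - int_Rn fn.
  have RE : (fun lam => riemann fp r lam - riemann fn r lam) = riemann f r.
    apply/funext => lam; rewrite /riemann -mulrBr -sumrB; congr (_ * _).
    by apply: eq_bigr => w _.
  have h : riemann f r @ \oo --> int_Rn fp - int_Rn fn.
    by rewrite -RE; apply: cvgB; [exact: (riemann_cvg np) | exact: (riemann_cvg nn)].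
  by rewrite -(cvg_lim (@norm_hausdorff _ _) (riemann_cvg nf)) (cvg_lim (@norm_hausdorff _ _) h).
rewrite IE; have cpn : (fun N => corrG d fp N alpha - corrG d fn N alpha) @ \oo --> int_Rn fp - int_Rn fn by exact: cvgB.
apply: cvg_trans cpn.
apply: near_eq_cvg; near=> N.
have N1 : (0 < N)%N by near: N; exact: nbhs_infty_gt.
have rN : (2 * r <= N)%N by near: N; exact: nbhs_infty_ge.
have N0 : (0 : R) < N%:R by rewrite ltr0n.
have rN' : 2 * r%:R <= N%:R :> R by rewrite -natrM ler_nat.
rewrite /corrG /= -mulrBr -sumrB; congr (_ * _); apply: eq_bigr => n _.
by rewrite (periodize_rnd _ (nice_supp np)) // (periodize_rnd _ (nice_supp nn)) //
  (periodize_rnd _ (nice_supp nf)).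
Unshelve. all: by end_near.
Qed.

(** Enumerating the rational shifts by [pickle] leaves a countable union of null sets. *)
Lemma good_ae m d : (3 <= m.+1)%N -> ((2 * m.+1) ^ (4 * m.+1) < d)%N ->
  {ae mu, forall alpha : R, good m d (exponent m.+1) alpha}.
Proof.
move=> m3 dl.
have : {ae mu, forall alpha : R, forall lam k : nat,
    if (unpickle k : option {ffun 'I_m -> rat}) is Some th then
      (fun M => corrX (M.+1 ^ exponent m.+1) lam.+1 d (fun i => ratr (th i)) alpha) @ \oo -->
        (lam.+1%:R ^- m : R) else True}.
  apply: ae_foralln => lam; apply: ae_foralln => k.
  case: (unpickle k) => [th|]; first exact: corrX_ae.
  by apply: aeW.
apply: filterS; first exact: (ae_filter_ringOfSetsType mu).
move=> alpha h lam th lam0; have := h lam.-1 (pickle th).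
by rewrite pickleK prednK.
Qed.
End Conclusion.

Theorem theorem1p2 (R : realType) (l : nat) (hl : (3 <= l)%N) :
  {ae (@lebesgue_measure R), forall alpha : R,
    forall d : nat, ((2 * l) ^ (4 * l) < d)%N -> poissonian_corr l d alpha}.
Proof.
(* Each [d] has its own null set; there are countably many. *)
case: l hl => // m m3; apply: ae_foralln => d.
have [dl|dl] := ltnP ((2 * m.+1) ^ (4 * m.+1)) d; last first.
  by apply: aeW.
have := good_ae R m3 dl; apply: filterS; first exact: (ae_filter_ringOfSetsType (@lebesgue_measure R)).
move=> alpha gd _ f /nice_of_Cc [r [B nf]].
apply: cvg_trans (corrG_cvg _ gd nf); last by [].
apply: near_eq_cvg; near=> N; apply/esym; apply: (Rcorr_corrG _ _ nf).
  by near: N; exact: nbhs_infty_gt.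
by near: N; exact: nbhs_infty_ge.
Unshelve. all: by end_near.
Qed.
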